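(* Let $l\ge1$ and let $U\subset(F[d_x,d_y])^l$ be a left $F[d_x,d_y]$-submodule of differential type at least $1$. Then $U$ has a non-zero fractional-derivatives series solution; that is, there exist $k\ge 1$, rational numbers $1>s_2>\cdots>s_k>0$, elements $f_1,\dots,f_k\in F$ with $(d_xf_1,d_yf_1)\neq(0,0)$, and, for $G=G_{s_2,\dots,s_k}(f_1,\dots,f_k)$, a non-zero vector $(H_1,\dots,H_l)\in V_G^l$ such that $\sum_{1\le i\le l}p_iH_i=0$ for all $(p_1,\dots,p_l)\in U$.
   Context: $F$ is a differentially closed (universal in the sense of Kolchin) differential field of characteristic $0$ with two commuting derivations $d_x,d_y$; $F[d_x,d_y]$ is the ring of linear partial differential operators over $F$. The Hilbert–Kolchin polynomial of $U$ is the polynomial equal, for all large integers $z$, to $\dim_F\bigl(M_{\le z}/(M_{\le z}\cap U)\bigr)$, where $M_{\le z}\subset(F[d_x,d_y])^l$ is the set of vectors of operators of order $\le z$; the differential type of $U$ is its degree. Let $k\ge1$, let $1>s_2>\cdots>s_k>0$ be rational and $f_1,\dots,f_k\in F$. The symbol $G=G^{(0)}=G_{s_2,\dots,s_k}(f_1,\dots,f_k)$ comes with $F$-linearly independent formal symbols $\{G^{(s)}\}_{s\in\mathbb Q}$ and the rule $dG^{(s)}=(df_1)G^{(1+s)}+(df_2)G^{(s_2+s)}+\cdots+(df_k)G^{(s_k+s)}$ for $d\in\{d_x,d_y\}$. With $q$ the common denominator of $s_2,\dots,s_k$ ($q=1$ if $k=1$), a fractional-derivatives series is a formal series $H=\sum_{0\le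 i<\infty}h_iG^{(s_0-i/q)}$ with $h_i\in F$, $s_0q\in\mathbb Z$. $V_G$ is the set of all these series (for the given $G$) together with $0$; it is an $F[d_x,d_y]$-module, operators acting termwise via the Leibniz rule and the rule above. *)

(* Defs.v *)
From mathcomp Require Import all_boot all_order all_algebra.

Set Implicit Arguments.
Unset Strict Implicit.
Unset Printing Implicit Defensive.

Import Order.TTheory GRing.Theory Num.Theory.
Local Open Scope ring_scope.

Definition is_derivation (K : fieldType) (d : K -> K) : Prop :=
  (forall a b, d (a + b) = d a + d b) /\
  (forall a b, d (a * b) = d a * b + a * d b).

Record diffField := DiffField {
  df_field :> fieldType;
  dx : df_field -> df_field;
  dy : df_field -> df_field;
  df_pchar0 : [pchar df_field] =i pred0;
  dx_derivation : is_derivation dx;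
  dy_derivation : is_derivation dy;
  dx_dy_comm : forall a, dx (dy a) = dy (dx a)
}.

Definition diff_morphism (K L : diffField) (phi : K -> L) : Prop :=
  forall a, phi (dx a) = dx (phi a) /\ phi (dy a) = dy (phi a).

(* As [0^-1 = 0] in MathComp, closure under [a / b] needs no side condition. *)
Definition diff_subfield (K : diffField) (A : K -> Prop) : Prop :=
  [/\ A 1,
      forall a b, A a -> A b -> A (a - b),
      forall a b, A a -> A b -> A (a / b)
    & forall a, A a -> A (dx a) /\ A (dy a)].

Definition diff_generated (K : diffField) (A : K -> Prop) : Prop :=
  forall B : K -> Prop, diff_subfield B -> (forall a, A a -> B a) ->
  forall b, B b.

Definition diff_finitely_generated (K : diffField) : Prop :=
  exists S : seq K, diff_generated (fun a => a \in S).

Definition diff_finitely_generated_over (K L : diffField) (phi : K -> L) :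
    Prop :=
  exists S : seq L, diff_generated (fun b => b \in S \/ exists a, b = phi a).

(* Kolchin's universal differential fields (over the prime field): every
   finitely generated differential extension of a finitely generated
   differential subfield of [F] embeds in [F] over that subfield. The subfield
   is given as the image of an embedding [j : K -> F], the extension as an
   embedding [i : K -> L]; morphisms of fields are injective. *)
Definition kolchin_universal (F : diffField) : Prop :=
  forall (K L : diffField) (j : {rmorphism K -> F}) (i : {rmorphism K -> L}),
    diff_morphism j -> diff_morphism i ->
    diff_finitely_generated K -> diff_finitely_generated_over i ->
  exists psi : {rmorphism L -> F},
    diff_morphism psi /\ forall a, psi (i a) = j a.

(* [p : diffop F] is the operator with coefficient [p`_i`_j] in front of
   d_x^i d_y^j, coefficients on the left. Only the additive structure of
   [{poly {poly F}}] is that of F[d_x, d_y]: the product of operators is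
   [opmul], not the commutative product of polynomials. *)
Definition diffop (F : diffField) := {poly {poly F}}.

Definition op_scale (F : diffField) (c : F) (p : diffop F) : diffop F :=
  c%:P%:P * (p : {poly {poly F}}).

(* Left multiplication by d_x and d_y: d (a t) = d(a) t + a (d t) for every
   monomial t in d_x and d_y. *)
Definition op_dx (F : diffField) (p : diffop F) : diffop F :=
  map_poly (map_poly (@dx F)) p + (p : {poly {poly F}}) * 'X.

Definition op_dy (F : diffField) (p : diffop F) : diffop F :=
  map_poly (map_poly (@dy F)) p + (p : {poly {poly F}}) * 'X%:P.

Definition opmul (F : diffField) (p q : diffop F) : diffop F :=
  \sum_(i < size p) \sum_(j < size p`_i)
    op_scale p`_i`_j (iter i (@op_dx F) (iter j (@op_dy F) q)).

Definition op_order_le (F : diffField) (z : nat) (p : diffop F) : Prop :=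
  forall i j : nat, p`_i`_j != 0 -> (i + j <= z)%N.

Definition left_submodule (F : diffField) (l : nat)
    (U : 'rV[diffop F]_l -> Prop) : Prop :=
  [/\ U 0,
      forall u v, U u -> U v -> U (u + v)
    & forall (r : diffop F) u, U u -> U (map_mx (opmul r) u)].

Definition filtration (F : diffField) (l z : nat) (u : 'rV[diffop F]_l) :
    Prop :=
  forall i, op_order_le z (u 0 i).

(* dim_F (M_{<= z} / (M_{<= z} \cap U)) = n: some [e] of length [n] in
   M_{<= z} is a basis of M_{<= z} modulo U. *)
Definition quotient_dim (F : diffField) (l : nat) (U : 'rV[diffop F]_l -> Prop)
    (z n : nat) : Prop :=
  exists e : 'I_n -> 'rV[diffop F]_l,
    [/\ forall k, filtration z (e k),
        forall c : 'I_n -> F,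
          U (\sum_(k < n) map_mx (op_scale (c k)) (e k)) -> forall k, c k = 0
      & forall u, filtration z u -> exists c : 'I_n -> F,
          U (u - \sum_(k < n) map_mx (op_scale (c k)) (e k))].

Definition hilbert_kolchin_polynomial (F : diffField) (l : nat)
    (U : 'rV[diffop F]_l -> Prop) (P : {poly rat}) : Prop :=
  exists z0 : nat, forall z : nat, (z0 <= z)%N ->
    exists2 n : nat, quotient_dim U z n & P.[z%:R] = n%:R.

(* The type is left undefined when the Hilbert-Kolchin polynomial is 0. *)
Definition differential_type (F : diffField) (l : nat)
    (U : 'rV[diffop F]_l -> Prop) (t : nat) : Prop :=
  exists2 P : {poly rat}, hilbert_kolchin_polynomial U P & size P = t.+1.

(* A symbol G_{s_2,...,s_k}(f_1,...,f_k) is given by [s] = (s_2, ..., s_k) and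
   [f] = (f_1, ..., f_k), with k = [m.+1]; the exponent s_1 is 1. *)

Definition G_exponents (m : nat) (s : m.-tuple rat) : Prop :=
  sorted (fun a b : rat => b < a) (1 :: rcons s 0).

Definition G_denominator (m : nat) (s : m.-tuple rat) : nat :=
  \big[lcmn/1%N]_(a <- s) `|denq a|%N.

(* As the symbols G^{(t)} are F-linearly independent, a series is identified
   with its coefficient function: [H t] is the coefficient of G^{(t)}. *)
Definition V_G (F : diffField) (m : nat) (s : m.-tuple rat) (H : rat -> F) :
    Prop :=
  exists2 s0 : rat, s0 * (G_denominator s)%:R \is a Num.int &
    forall t, H t != 0 ->
      exists i : nat, t = s0 - i%:R / (G_denominator s)%:R.

(* The coefficient of G^{(t)} in d H, where
   d (h G^{(u)}) = (d h) G^{(u)} + \sum_j h (d f_j) G^{(s_j + u)}. *)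
Definition series_deriv (F : diffField) (m : nat) (s : m.-tuple rat)
    (f : m.+1.-tuple F) (d : F -> F) (H : rat -> F) : rat -> F :=
  fun t => d (H t) +
    \sum_(j < m.+1) d (tnth f j) * H (t - tnth [tuple of 1 :: s] j).

Definition op_apply (F : diffField) (m : nat) (s : m.-tuple rat)
    (f : m.+1.-tuple F) (p : diffop F) (H : rat -> F) : rat -> F :=
  fun t => \sum_(i < size p) \sum_(j < size p`_i)
    p`_i`_j * iter i (series_deriv s f (@dx F))
                     (iter j (series_deriv s f (@dy F)) H) t.

(* Main.v *)
(* A symbol G with exponents s_j and functions f_j behaves like exp(g), g = \sum_j f_j T^{s_j}, and
   G^{(t)} like T^t exp(g), where T is a formal constant; V_G is the space of Laurent series in
   T^{-1/q} times exp(g). Hence solving one operator L amounts to choosing g such that the leading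
   part in T of exp(-g) L exp(g) is an ordinary operator. The term f_1 T is fixed by straightening:
   c is a root of the symbol of L, f_1 solves the eikonal equation (dx - c dy) f_1 = 0 with
   dy f_1 <> 0, and in the derivations dx - c dy and (dy f_1)^{-1} dy the function f_1 becomes a
   coordinate y. The other terms come from a Newton-Puiseux iteration on the roots r = dx f of edge
   polynomials; Euler's identity shows that the edges do not involve dy. The universality of F
   supplies the roots and the solutions of linear equations in dx - c dy.
   For a module U of positive type, let I_r be the ideal of the r-th coordinates of the vectors of U
   that vanish beyond r. Not all I_r have finite codimension; for the last r that does not,
   I_r is generated up to factors b(dy) by one operator L, while each later I_i contains some
   b(dy) <> 0. As b(dy) is bijective on V_G when dy f_1 <> 0, a solution of L extends to
   one of U. A preliminary shear dy + c dx makes the highest coefficient in dx of one operator of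
   each I_r non-zero. *)

Require Import Defs.
From HB Require Import structures.
From mathcomp Require Import all_boot all_order all_algebra all_field archimedean.
From mathcomp Require Import generic_quotient boolp functions ring zify lra.

Set Implicit Arguments.
Unset Strict Implicit.
Unset Printing Implicit Defensive.

Import Order.TTheory GRing.Theory Num.Theory.
Local Open Scope ring_scope.

(** * Derivations and modules over the ring of operators *)

(** Noncommutativity is confined to module actions. Multiplication of operators, conjugation by a
    phase and change of derivations all have the form [act L w] in a twisted commutative polynomial
    ring, and two such constructions are compared by a map that respects scalars and both
    derivations. Up to terms of lower weight an operator acts as its commutative symbol; all
    leading-term statements rest on this. Universality embeds only finitely generated extensions.
    Each root or solution is therefore built in a convenient large extension, a simple algebraic one
    or fractions of power series, and universality is applied to the differential subfield that it
    generates. The denominator [Q] of all exponents is fixed before the Newton-Puiseux iteration, so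
    slopes are natural numbers and their descent proves termination. The final ordinary operator has
    positive order: a non-zero element of its kernel is the leading coefficient of the solution, and
    its surjectivity supplies all lower coefficients. The differential type enters only through
    infinite codimension. *)

Definition is_der (R : comNzRingType) (d : R -> R) : Prop :=
  (forall a b, d (a + b) = d a + d b) /\
  (forall a b, d (a * b) = d a * b + a * d b).

Section Derivations.
Variables (R : comNzRingType) (d : R -> R).
Hypothesis dP : is_der d.

Lemma derD a b : d (a + b) = d a + d b. Proof. by case: dP. Qed.
Lemma derM a b : d (a * b) = d a * b + a * d b. Proof. by case: dP. Qed.

Lemma der0 : d 0 = 0.
Proof. by apply: (addrI (d 0)); rewrite -derD !addr0. Qed.

Lemma derN a : d (- a) = - d a.
Proof. by apply: (addrI (d a)); rewrite -derD !subrr der0. Qed.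

Lemma derB a b : d (a - b) = d a - d b.
Proof. by rewrite derD derN. Qed.

Lemma der_sum (I : Type) (r : seq I) (P : pred I) (G : I -> R) :
  d (\sum_(i <- r | P i) G i) = \sum_(i <- r | P i) d (G i).
Proof. exact: (big_morph d derD der0). Qed.

Lemma der1 : d 1 = 0.
Proof.
have := derM 1 1; rewrite !mulr1 mul1r => h.
by apply: (addrI (d 1)); rewrite addr0 -h.
Qed.

Lemma derMn a n : d (a *+ n) = d a *+ n.
Proof. by elim: n => [|n IH]; rewrite ?der0 // !mulrS derD IH. Qed.

Lemma der_nat n : d n%:R = 0.
Proof. by rewrite derMn der1 mul0rn. Qed.

Lemma coef_map_der (p : {poly R}) i : (map_poly d p)`_i = d p`_i.
Proof. exact/coef_map_id0/der0. Qed.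

Lemma map_poly_der : is_der (map_poly d).
Proof.
split=> p q; apply/polyP=> i.
  by rewrite coef_map_der !coefD !coef_map_der derD.
rewrite coef_map_der coefD !coefM der_sum -big_split /=.
by apply: eq_bigr => j _; rewrite derM !coef_map_der.
Qed.

Lemma map_derC c : map_poly d c%:P = (d c)%:P.
Proof. by apply/polyP=> i; rewrite coef_map_der !coefC; case: eqP => // _; exact: der0. Qed.

Lemma map_derX : map_poly d 'X = 0.
Proof.
apply/polyP=> i; rewrite coef_map_der coefX coef0.
by case: eqP => _; [exact: der1 | exact: der0].
Qed.

Lemma map_derXn n : map_poly d 'X^n = 0.
Proof.
apply/polyP=> i; rewrite coef_map_der coefXn coef0.
by case: eqP => _; [exact: der1 | exact: der0].
Qed.

End Derivations.

Lemma is_der_df_x (F : diffField) : is_der (@dx F).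
Proof. exact: (@dx_derivation F). Qed.

Lemma is_der_df_y (F : diffField) : is_der (@dy F).
Proof. exact: (@dy_derivation F). Qed.

#[global] Hint Resolve is_der_df_x is_der_df_y map_poly_der : core.

Lemma map_poly_derC (R : comNzRingType) (d e : R -> R) :
    is_der d -> is_der e -> (forall a, d (e a) = e (d a)) ->
  forall p, map_poly d (map_poly e p) = map_poly e (map_poly d p).
Proof.
move=> dP eP dec p; apply/polyP=> i.
by rewrite !(coef_map_der dP, coef_map_der eP).
Qed.

(** Series, operators, twisted polynomial rings and [F] itself all fit this record, so that one
    theory of [act] serves multiplication, conjugation and changes of derivations. *)
Record dmodule (F : diffField) := Dmodule {
  dm_sort :> zmodType;
  dm_sc : F -> dm_sort -> dm_sort;
  dm_x : dm_sort -> dm_sort;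
  dm_y : dm_sort -> dm_sort;
  dm_scDl : forall a b w, dm_sc (a + b) w = dm_sc a w + dm_sc b w;
  dm_scDr : forall a v w, dm_sc a (v + w) = dm_sc a v + dm_sc a w;
  dm_scA : forall a b w, dm_sc (a * b) w = dm_sc a (dm_sc b w);
  dm_sc1 : forall w, dm_sc 1 w = w;
  dm_xD : forall v w, dm_x (v + w) = dm_x v + dm_x w;
  dm_yD : forall v w, dm_y (v + w) = dm_y v + dm_y w;
  dm_xsc : forall a w, dm_x (dm_sc a w) = dm_sc (dx a) w + dm_sc a (dm_x w);
  dm_ysc : forall a w, dm_y (dm_sc a w) = dm_sc (dy a) w + dm_sc a (dm_y w);
  dm_xy : forall w, dm_x (dm_y w) = dm_y (dm_x w)
}.

Definition act (F : diffField) (M : dmodule F) (p : diffop F) (w : M) : M :=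
  \sum_(i < size p) \sum_(j < size p`_i)
    dm_sc p`_i`_j (iter i (@dm_x F M) (iter j (@dm_y F M) w)).

Section Action.
Variables (F : diffField) (M : dmodule F).
Implicit Types (p q r : diffop F) (w : M).

Local Notation sc := (@dm_sc F M).
Local Notation DX := (@dm_x F M).
Local Notation DY := (@dm_y F M).

Lemma dm_sc0l w : sc 0 w = 0.
Proof. by apply: (addrI (sc 0 w)); rewrite -dm_scDl !addr0. Qed.

Lemma dm_sc0r a : sc a 0 = 0.
Proof. by apply: (addrI (sc a 0)); rewrite -dm_scDr !addr0. Qed.

Lemma dm_x0 : DX 0 = 0.
Proof. by apply: (addrI (DX 0)); rewrite -dm_xD !addr0. Qed.

Lemma dm_y0 : DY 0 = 0.
Proof. by apply: (addrI (DY 0)); rewrite -dm_yD !addr0. Qed.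

Lemma dm_scNl a w : sc (- a) w = - sc a w.
Proof. by apply: (addrI (sc a w)); rewrite -dm_scDl !subrr dm_sc0l. Qed.

Lemma dm_sc_sum a (I : Type) (s : seq I) (P : pred I) (G : I -> M) :
  sc a (\sum_(i <- s | P i) G i) = \sum_(i <- s | P i) sc a (G i).
Proof. exact: (big_morph (sc a) (dm_scDr a) (dm_sc0r a)). Qed.

Lemma dm_x_sum (I : Type) (s : seq I) (P : pred I) (G : I -> M) :
  DX (\sum_(i <- s | P i) G i) = \sum_(i <- s | P i) DX (G i).
Proof. exact: (big_morph DX (@dm_xD F M) dm_x0). Qed.

Lemma dm_y_sum (I : Type) (s : seq I) (P : pred I) (G : I -> M) :
  DY (\sum_(i <- s | P i) G i) = \sum_(i <- s | P i) DY (G i).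
Proof. exact: (big_morph DY (@dm_yD F M) dm_y0). Qed.

Lemma dm_y_iterx i w : DY (iter i DX w) = iter i DX (DY w).
Proof. by elim: i => //= i <-; rewrite dm_xy. Qed.

Lemma iter_dm_xD i v w : iter i DX (v + w) = iter i DX v + iter i DX w.
Proof. by elim: i => //= i ->; rewrite dm_xD. Qed.

Lemma iter_dm_yD i v w : iter i DY (v + w) = iter i DY v + iter i DY w.
Proof. by elim: i => //= i ->; rewrite dm_yD. Qed.

Definition ysize p : nat := (\max_(i < size p) size (p`_i)%R)%N.

Lemma size_coef_ysize p i : (size (p`_i)%R <= ysize p)%N.
Proof.
case: (ltnP i (size p)) => [lt_i|le_i].
  exact: (leq_bigmax (Ordinal lt_i)).
by rewrite nth_default // size_poly0.
Qed.

(** The bounds of the nested sum in [act] depend on the operator; padding with zero coefficients to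
    a common rectangle makes different operators comparable term by term. *)
Lemma act_box p w m n : (size p <= m)%N -> (ysize p <= n)%N ->
  act p w = \sum_(i < m) \sum_(j < n) sc p`_i`_j (iter i DX (iter j DY w)).
Proof.
move=> le_m le_n.
rewrite /act (big_ord_widen_cond _ xpredT (fun i =>
   \sum_(j < size p`_i) sc p`_i`_j (iter i DX (iter j DY w))) le_m) big_mkcond.
apply: eq_bigr => i _ /=.
rewrite (big_ord_widen_cond n xpredT (fun j =>
   sc p`_i`_j (iter i DX (iter j DY w)))); last first.
  exact: leq_trans (size_coef_ysize _ _) le_n.
rewrite big_mkcond; case: ltnP => h.
  apply: eq_bigr => j _ /=; case: ltnP => // h2.
  by rewrite nth_default // dm_sc0l.
rewrite big1 // => j _; rewrite (nth_default _ h) coef0 dm_sc0l.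
by [].
Qed.

Lemma actDl p q w : act (p + q) w = act p w + act q w.
Proof.
pose m := maxn (size (p + q)%R) (maxn (size p) (size q)).
pose n := maxn (ysize (p + q)%R) (maxn (ysize p) (ysize q)).
rewrite !(@act_box _ w m n) ?leq_max ?leqnn ?orbT //.
rewrite -big_split; apply: eq_bigr => i _.
rewrite -big_split; apply: eq_bigr => j _.
by rewrite !coefD dm_scDl.
Qed.

Lemma act0l w : act 0 w = 0.
Proof. by rewrite /act size_poly0 big_ord0. Qed.

Lemma actNl p w : act (- p) w = - act p w.
Proof. by apply: (addrI (act p w)); rewrite -actDl !subrr act0l. Qed.

Lemma actBl p q w : act (p - q) w = act p w - act q w.
Proof. by rewrite actDl actNl. Qed.

Lemma act_suml (I : Type) (s : seq I) (P : pred I) (G : I -> diffop F) w :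
  act (\sum_(i <- s | P i) G i) w = \sum_(i <- s | P i) act (G i) w.
Proof.
by elim/big_rec2: _ => [|i u v _ <-]; [exact: act0l | exact: actDl].
Qed.

Lemma actDr p v w : act p (v + w) = act p v + act p w.
Proof.
rewrite /act -big_split; apply: eq_bigr => i _.
rewrite -big_split; apply: eq_bigr => j _.
by rewrite iter_dm_yD iter_dm_xD dm_scDr.
Qed.

Lemma act0r p : act p 0 = 0 :> M.
Proof. by apply: (addrI (act p 0)); rewrite -actDr !addr0. Qed.

Lemma actNr p w : act p (- w) = - act p w.
Proof. by apply: (addrI (act p w)); rewrite -actDr !subrr act0r. Qed.

Lemma act_scale c p w : act (op_scale c p) w = sc c (act p w).
Proof.
pose m := maxn (size (op_scale c p)) (size p).
pose n := maxn (ysize (op_scale c p)) (ysize p).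
rewrite !(@act_box _ w m n) ?leq_max ?leqnn ?orbT //.
rewrite dm_sc_sum; apply: eq_bigr => i _.
rewrite dm_sc_sum; apply: eq_bigr => j _.
by rewrite /op_scale !coefCM dm_scA.
Qed.

Lemma coef_op_dx p i j :
  (op_dx p)`_i`_j = dx p`_i`_j + (if i is i'.+1 then p`_i'`_j else 0).
Proof.
rewrite /op_dx !coefD (coef_map_der (map_poly_der (@is_der_df_x F))).
rewrite (coef_map_der (@is_der_df_x F)) coefMX.
by case: i => //=; rewrite coef0.
Qed.

Lemma coef_op_dy p i j :
  (op_dy p)`_i`_j = dy p`_i`_j + (if j is j'.+1 then p`_i`_j' else 0).
Proof.
rewrite /op_dy !coefD (coef_map_der (map_poly_der (@is_der_df_y F))).
rewrite (coef_map_der (@is_der_df_y F)) coefMC coefMX.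
by case: j.
Qed.

Lemma act_dx p w : act (op_dx p) w = DX (act p w).
Proof.
pose m := maxn (size (op_dx p)) (size p).
pose n := maxn (ysize (op_dx p)) (ysize p).
rewrite (@act_box (op_dx p) w m.+1 n) ?leq_max ?leqnn ?orbT //; last first.
  by apply: leqW; rewrite leq_max leqnn.
rewrite [in RHS](@act_box p w m n) ?leq_max ?leqnn ?orbT //.
under eq_bigr => i _ do under eq_bigr => j _ do rewrite coef_op_dx dm_scDl.
under eq_bigr => i _ do rewrite big_split /=.
rewrite big_split /= dm_x_sum.
rewrite [X in _ + X]big_ord_recl /= [X in _ + (X + _)]big1 ?add0r; last first.
  by move=> j _; rewrite dm_sc0l.
rewrite [X in X + _]big_ord_recr /= [X in _ + X + _]big1 ?addr0; last first.
  move=> j _; rewrite [p`_m]nth_default ?leq_max ?leqnn ?orbT //.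
  by rewrite coef0 (der0 (@is_der_df_x F)) dm_sc0l.
rewrite -big_split /=; apply: eq_bigr => i _.
rewrite dm_x_sum -big_split; apply: eq_bigr => j _ /=.
by rewrite dm_xsc.
Qed.

Lemma act_dy p w : act (op_dy p) w = DY (act p w).
Proof.
pose m := maxn (size (op_dy p)) (size p).
pose n := maxn (ysize (op_dy p)) (ysize p).
rewrite (@act_box (op_dy p) w m n.+1) ?leq_max ?leqnn ?orbT //; last first.
  by apply: leqW; rewrite leq_max leqnn.
rewrite [in RHS](@act_box p w m n) ?leq_max ?leqnn ?orbT //.
rewrite dm_y_sum; apply: eq_bigr => i _.
under eq_bigr => j _ do rewrite coef_op_dy dm_scDl.
rewrite big_split /= dm_y_sum.
rewrite [X in _ + X]big_ord_recl /= dm_sc0l add0r.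
rewrite [X in X + _]big_ord_recr /= [sc (dy _) _](_ : _ = 0) ?addr0; last first.
  rewrite nth_default ?(der0 (@is_der_df_y F)) ?dm_sc0l //.
  apply: leq_trans (size_coef_ysize _ _) _.
  by rewrite leq_max leqnn orbT.
rewrite -big_split /=; apply: eq_bigr => j _.
by rewrite dm_ysc dm_y_iterx.
Qed.

Lemma act_iter i j p w :
  act (iter i (@op_dx F) (iter j (@op_dy F) p)) w =
  iter i DX (iter j DY (act p w)).
Proof.
elim: i => [|i IH] /=; last by rewrite act_dx IH.
by elim: j => [|j IH] //=; rewrite act_dy IH.
Qed.

(** For the module of operators over themselves this is the associativity of [opmul]. *)
Lemma act_opmul r p w : act (opmul r p) w = act r (act p w).
Proof.
rewrite /opmul act_suml; apply: eq_bigr => i _.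
rewrite act_suml; apply: eq_bigr => j _.
by rewrite act_scale act_iter.
Qed.

Lemma act1 w : act 1 w = w.
Proof.
rewrite (@act_box 1 w 1 1) ?size_poly1 //.
  by rewrite !big_ord1 !coef1 /= dm_sc1.
by rewrite /ysize size_poly1 big_ord1 coef1 size_poly1.
Qed.

Lemma act_closed (P : M -> Prop) p w :
    P 0 -> (forall u v, P u -> P v -> P (u + v)) -> (forall a v, P v -> P (sc a v)) ->
    (forall v, P v -> P (DX v)) -> (forall v, P v -> P (DY v)) ->
  P w -> P (act p w).
Proof.
move=> P0 PD Psc PX PY Pw.
have Pxy a b : P (iter a DX (iter b DY w)).
  elim: a => [|a IH] /=; last exact: PX.
  by elim: b => [|b IH] //=; apply: PY.
by apply: (big_ind P) => // i _; apply: (big_ind P) => // j _; apply: Psc.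
Qed.

End Action.

(** The main device for noncommutative identities: both sides are written as images of one
    generator, and only compatibility with scalars, [dm_x] and [dm_y] is checked. Euler's identity,
    conjugation in stages and changes of derivations are proved this way. *)
Lemma act_morph (F : diffField) (M N : dmodule F) (h : M -> N) p w :
    (forall u v, h (u + v) = h u + h v) ->
    (forall a v, h (dm_sc a v) = dm_sc a (h v)) ->
    (forall v, h (dm_x v) = dm_x (h v)) -> (forall v, h (dm_y v) = dm_y (h v)) ->
  h (act p w) = act p (h w).
Proof.
move=> hD hsc hX hY.
have h0 : h 0 = 0 by apply: (addrI (h 0)); rewrite -hD !addr0.
have hxy a b : h (iter a (@dm_x F M) (iter b (@dm_y F M) w)) =
    iter a (@dm_x F N) (iter b (@dm_y F N) (h w)).
  elim: a => [|a IH] /=; last by rewrite hX IH.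
  by elim: b => [|b IH] //=; rewrite hY IH.
rewrite /act (big_morph h hD h0); apply: eq_bigr => i _.
by rewrite (big_morph h hD h0); apply: eq_bigr => j _; rewrite hsc hxy.
Qed.

Section RingModule.
Variables (F : diffField) (R : comNzRingType) (iota : {rmorphism F -> R}).
Variables (d1 d2 : R -> R) (x1 x2 : R).
Hypotheses (d1P : is_der d1) (d2P : is_der d2).
Hypotheses (d1i : forall a, d1 (iota a) = iota (dx a)).
Hypotheses (d2i : forall a, d2 (iota a) = iota (dy a)).
Hypotheses (d12 : forall b, d1 (d2 b) = d2 (d1 b)) (x12 : d1 x2 = d2 x1).

(** Adding [x1] and [x2] to the derivations is conjugation by the exponential of a potential with
    these partial derivatives, without the exponential having to exist. [x12] is the closedness
    condition under which the twisted derivations commute. *)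
Definition ring_module : dmodule F.
Proof.
refine (@Dmodule F R (fun a w => iota a * w) (fun w => d1 w + x1 * w)
   (fun w => d2 w + x2 * w) _ _ _ _ _ _ _ _ _).
- by move=> a b w; rewrite rmorphD mulrDl.
- by move=> a v w; rewrite mulrDr.
- by move=> a b w; rewrite rmorphM mulrA.
- by move=> w; rewrite rmorph1 mul1r.
- by move=> v w; rewrite (derD d1P); ring.
- by move=> v w; rewrite (derD d2P); ring.
- by move=> a w; rewrite (derM d1P) d1i; ring.
- by move=> a w; rewrite (derM d2P) d2i; ring.
by move=> w; rewrite (derD d1P) (derD d2P) (derM d1P) (derM d2P) d12 x12; ring.
Defined.

End RingModule.

(** * Embeddings into a universal field *)

Section Swap.

Definition swap_df (F : diffField) : diffField :=
  @DiffField F (@dy F) (@dx F) (@df_pchar0 F) (@dy_derivation F)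
    (@dx_derivation F) (fun a => esym (dx_dy_comm a)).

Lemma is_der_shear (K : fieldType) (d e : K -> K) (c : int) :
  is_der d -> is_der e -> is_der (fun a => e a + d a *~ c).
Proof.
move=> dP eP; split=> a b.
  by rewrite (derD dP) (derD eP) mulrzDl addrACA.
by rewrite (derM dP) (derM eP) mulrzDl mulrDl mulrDr mulrzAl mulrzAr addrACA.
Qed.

Lemma derMz (K : fieldType) (d : K -> K) (a : K) (c : int) :
  is_der d -> d (a *~ c) = d a *~ c.
Proof.
move=> dP; case: c => n; first exact: derMn.
by rewrite !NegzE !mulrNz (derN dP) -!pmulrn (derMn dP).
Qed.

Lemma shear_comm (F : diffField) (c : int) (a : F) :
  dx (dy a + dx a *~ c) = dy (dx a) + dx (dx a) *~ c.
Proof. by rewrite (derD (@is_der_df_x F)) (derMz _ _ (@is_der_df_x F)) dx_dy_comm. Qed.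

Definition shear_df (F : diffField) (c : int) : diffField :=
  @DiffField F (@dx F) (fun a => dy a + dx a *~ c) (@df_pchar0 F)
    (@dx_derivation F) (is_der_shear c (@is_der_df_x F) (@is_der_df_y F))
    (shear_comm c).

Lemma diff_subfield_swap (F : diffField) (A : F -> Prop) :
  diff_subfield A <-> diff_subfield (A : swap_df F -> Prop).
Proof.
by split=> -[A1 AB AV Ad];
  (split; [exact: A1 | exact: AB | exact: AV | move=> a /Ad[Ax Ay]; split]).
Qed.

Lemma diff_subfield_Mz (F : diffField) (A : F -> Prop) (hA : diff_subfield A)
  (a : F) (c : int) : A a -> A (a *~ c).
Proof.
case: hA => A1 AB AV _ Aa.
have A0 : A 0 by rewrite -(subrr 1); apply: AB.
have AN b : A b -> A (- b) by move=> Ab; rewrite -sub0r; apply: AB.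
have AD b b' : A b -> A b' -> A (b + b').
  by move=> Ab Ab'; rewrite -[b']opprK; apply: AB => //; apply: AN.
have An n : A (a *+ n) by elim: n => [|n IH] //; rewrite mulrS; apply: AD.
by case: c => n; [exact: An | rewrite NegzE mulrNz; apply: AN; exact: An].
Qed.

Lemma diff_subfield_unshear (F : diffField) (c : int) (A : F -> Prop) :
  diff_subfield (A : shear_df F c -> Prop) -> diff_subfield A.
Proof.
move=> hA; case: (hA) => A1 AB AV Ad.
split; [exact: A1 | exact: AB | exact: AV | move=> a /Ad /= [Ax Ay]; split=> //=].
rewrite -(addrK (dx a *~ c) (dy a)); apply: AB => //.
exact: (diff_subfield_Mz hA).
Qed.

Lemma diff_generated_swap (F : diffField) (A : F -> Prop) :
  diff_generated A -> diff_generated (A : swap_df F -> Prop).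
Proof. by move=> h B /diff_subfield_swap; apply: h. Qed.

Lemma diff_generated_shear (F : diffField) (c : int) (A : F -> Prop) :
  diff_generated A -> diff_generated (A : shear_df F c -> Prop).
Proof. by move=> h B /diff_subfield_unshear; apply: h. Qed.

Lemma universal_swap (F : diffField) :
  kolchin_universal F -> kolchin_universal (swap_df F).
Proof.
move=> hF K L j i hj hi [S hS] [S' hS'].
have [|||| psi [hpsi hij]] := hF (swap_df K) (swap_df L) j i.
- by move=> a; have [] := hj a.
- by move=> a; have [] := hi a.
- by exists S; apply: diff_generated_swap.
- by exists S'; apply: diff_generated_swap.
by exists psi; split=> // a; have [] := hpsi a.
Qed.

(** An embedding problem over the sheared field is sheared back by [- c] and solved in [F];
    generating sets survive because shearing does not change the differential subfields. *)
Lemma universal_shear (F : diffField) (c : int) :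
  kolchin_universal F -> kolchin_universal (shear_df F c).
Proof.
move=> hF K L j i hj hi [S hS] [S' hS'].
have [|||| psi [hpsi hij]] := hF (shear_df K (- c)) (shear_df L (- c)) j i.
- move=> a; have [/= hx hy] := hj a; split=> //.
  by rewrite rmorphD rmorphMz hx hy mulrNz addrK.
- move=> a; have [/= hx hy] := hi a; split=> //=.
  by rewrite rmorphD rmorphMz hx hy.
- by exists S; apply: diff_generated_shear.
- by exists S'; apply: diff_generated_shear.
exists psi; split=> // a; have [/= hx hy] := hpsi a; split=> //=.
by rewrite -hy -hx -rmorphMz -rmorphD mulrNz subrK.
Qed.

End Swap.

Section Subfield.
Variables (F : diffField) (A : F -> Prop) (hA : diff_subfield A).

Definition subf_pred : F -> bool := fun x => `[< A x >].

Lemma subf_divring : divring_closed subf_pred.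
Proof.
case: hA => A1 AB AV _; split.
- exact/asboolP.
- by move=> a b /asboolP Aa /asboolP Ab; apply/asboolP/AB.
by move=> a b /asboolP Aa /asboolP Ab; apply/asboolP/AV.
Qed.

Definition subf_of (_ : diff_subfield A) := {x : F | subf_pred x}.
Local Notation sT := (subf_of hA).

HB.instance Definition _ := GRing.isDivringClosed.Build F subf_pred subf_divring.
HB.instance Definition _ := SubChoice.on sT.
HB.instance Definition _ := [SubChoice_isSubIntegralDomain of sT by <:].
HB.instance Definition _ := [SubIntegralDomain_isSubField of sT by <:].

Lemma subf_dxP (x : sT) : subf_pred (dx (val x)).
Proof. by case: hA => _ _ _ Ad; have /asboolP/Ad[h _] := valP x; apply/asboolP. Qed.
Lemma subf_dyP (x : sT) : subf_pred (dy (val x)).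
Proof. by case: hA => _ _ _ Ad; have /asboolP/Ad[_ h] := valP x; apply/asboolP. Qed.

Definition subf_dx (x : sT) : sT := Sub (dx (val x)) (subf_dxP x).
Definition subf_dy (x : sT) : sT := Sub (dy (val x)) (subf_dyP x).

Lemma subf_dx_der : is_derivation subf_dx.
Proof.
split=> a b; apply: val_inj => /=.
  by rewrite (derD (@is_der_df_x F)).
by rewrite (derM (@is_der_df_x F)).
Qed.
Lemma subf_dy_der : is_derivation subf_dy.
Proof.
split=> a b; apply: val_inj => /=.
  by rewrite (derD (@is_der_df_y F)).
by rewrite (derM (@is_der_df_y F)).
Qed.
Lemma subf_comm a : subf_dx (subf_dy a) = subf_dy (subf_dx a).
Proof. by apply: val_inj => /=; rewrite dx_dy_comm. Qed.
Lemma subf_pchar : [pchar sT] =i pred0.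
Proof.
move=> p; rewrite -(@df_pchar0 F p).
by rewrite -(fmorph_pchar (val : {rmorphism sT -> F})).
Qed.

Definition subf : diffField :=
  @DiffField sT subf_dx subf_dy subf_pchar subf_dx_der subf_dy_der subf_comm.
Definition subf_val : {rmorphism subf -> F} := (val : {rmorphism sT -> F}).

Lemma subf_lift (x : F) : A x -> exists y : subf, subf_val y = x.
Proof. by move=> /asboolP Ax; exists (Sub x Ax : sT). Qed.

Lemma subf_valP (x : subf) : A (subf_val x).
Proof. by apply/asboolP; exact: (valP (x : sT)). Qed.

End Subfield.

Definition diff_gen (F : diffField) (A : F -> Prop) (b : F) : Prop :=
  forall B : F -> Prop, diff_subfield B -> (forall a, A a -> B a) -> B b.

Lemma diff_gen_subfield (F : diffField) (A : F -> Prop) :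
  diff_subfield (diff_gen A).
Proof.
split.
- by move=> B [B1 _ _ _].
- move=> a b Aa Ab B hB hAB; case: (hB) => _ BB _ _.
  by apply: BB; [exact: Aa | exact: Ab].
- move=> a b Aa Ab B hB hAB; case: (hB) => _ _ BV _.
  by apply: BV; [exact: Aa | exact: Ab].
move=> a Aa; split=> B hB hAB; case: (hB) => _ _ _ Bd;
  by case: (Bd a (Aa B hB hAB)).
Qed.

Lemma diff_gen_sub (F : diffField) (A : F -> Prop) a : A a -> diff_gen A a.
Proof. by move=> Aa B _; apply. Qed.

Definition gen_subf (F : diffField) (A : F -> Prop) : diffField :=
  subf (diff_gen_subfield A).

Definition gen_val (F : diffField) (A : F -> Prop) : {rmorphism gen_subf A -> F} :=
  subf_val (diff_gen_subfield A).

Lemma gen_lift (F : diffField) (A : F -> Prop) x :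
  diff_gen A x -> exists y : gen_subf A, gen_val A y = x.
Proof. exact: subf_lift. Qed.

Lemma gen_subf_generated (F : diffField) (A : F -> Prop) (B : gen_subf A -> Prop) :
    (forall x, B x -> A (gen_val A x)) -> (forall a, A a -> exists2 x, B x & gen_val A x = a) ->
  diff_generated B.
Proof.
move=> hBA hAB C hC hBC b.
pose C' (a : F) := exists2 x, C x & gen_val A x = a.
suff hC' : diff_subfield C'.
  have [] : C' (gen_val A b).
    apply: (subf_valP b) => // a /hAB[x Bx <-].
    by exists x => //; exact: hBC.
  by move=> x Cx /fmorph_inj <-.
case: hC => C1 CB CV Cd; split.
- by exists 1 => //; rewrite rmorph1.
- by move=> _ _ [x Cx <-] [y Cy <-]; exists (x - y); [exact: CB | rewrite rmorphB].
- by move=> _ _ [x Cx <-] [y Cy <-]; exists (x / y); [exact: CV | rewrite fmorph_div].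
move=> _ [x Cx <-]; have [Cdx Cdy] := Cd _ Cx.
by split; [exists (dx x) | exists (dy x)].
Qed.

Lemma gen_lift_seq (F : diffField) (A : F -> Prop) (s : seq F) :
    (forall x, x \in s -> A x) ->
  exists t : seq (gen_subf A), map (gen_val A) t = s.
Proof.
elim: s => [|x s IH] hs; first by exists [::].
have [|t <-] := IH; first by move=> y ys; apply: hs; rewrite inE ys orbT.
have [y <-] := gen_lift (diff_gen_sub (hs x (mem_head _ _))).
by exists (y :: t).
Qed.

Section Extend.
Variables (F : diffField) (S : seq F) (LL : diffField).
Hypothesis hF : kolchin_universal F.

Local Notation K := (gen_subf (fun a => a \in S)).
Variables (phi : {rmorphism K -> LL}) (hphi : diff_morphism phi) (hs : seq LL).

(** [LL] may be too large for universality, so only the differential subfield generated by the image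
    of [phi] and the finite list [hs] is embedded. Equations among the elements of [hs] are checked
    in [LL] through [v] and read off in [F] through [psi]. *)
Lemma universal_extend :
  exists (L : diffField) (v : {rmorphism L -> LL}) (psi : {rmorphism L -> F}),
    [/\ diff_morphism v, diff_morphism psi,
        forall h, h \in hs -> exists h', v h' = h
      & forall a : K, exists2 a', v a' = phi a & psi a' = gen_val _ a].
Proof.
pose A (x : LL) := x \in hs \/ exists a : K, x = phi a.
have lift_phi (a : K) : diff_gen A (phi a) by apply: diff_gen_sub; right; exists a.
have i_exP (a : K) : exists y : gen_subf A, gen_val A y = phi a by exact: gen_lift.
pose i (a : K) : gen_subf A := projT1 (cid (i_exP a)).
have iE a : gen_val A (i a) = phi a by rewrite /i; case: cid.
have iB : GRing.zmod_morphism i.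
  move=> a b; apply: (fmorph_inj (gen_val A)).
  by apply: etrans (iE _) _; rewrite !rmorphB; congr (_ - _); rewrite iE.
have iM : GRing.monoid_morphism i.
  split; first by apply: (fmorph_inj (gen_val A)); apply: etrans (iE _) _; rewrite !rmorph1.
  move=> a b; apply: (fmorph_inj (gen_val A)).
  by apply: etrans (iE _) _; rewrite !rmorphM; congr (_ * _); rewrite iE.
pose iz := GRing.isZmodMorphism.Build _ _ i iB.
pose im := GRing.isMonoidMorphism.Build _ _ i iM.
pose irm : {rmorphism K -> gen_subf A} := HB.pack i iz im.
have hi : diff_morphism irm.
  move=> a; split; apply: (fmorph_inj (gen_val A)); apply: etrans (iE _) _.
    by have [-> _] := hphi a; rewrite -iE.
  by have [_ ->] := hphi a; rewrite -iE.
have hj : diff_morphism (gen_val (fun a => a \in S)) by [].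
have fgK : diff_finitely_generated K.
  have [t ht] : exists t : seq K, map (gen_val _) t = S by exact: gen_lift_seq.
  exists t; apply: gen_subf_generated.
    by move=> x xT; rewrite -[in X in _ \in X]ht; apply: map_f.
  by move=> a; rewrite -{1}ht => /mapP[x xT ->]; exists x.
have fgL : diff_finitely_generated_over irm.
  have [t ht] : exists t : seq (gen_subf A), map (gen_val _) t = hs.
    by apply: gen_lift_seq => x xs; left.
  exists t; apply: gen_subf_generated.
    move=> x [xt|[a ->]]; first by left; rewrite -ht; apply: map_f.
    by right; exists a; exact: iE.
  move=> a [|[b ->]]; last by exists (irm b); [right; exists b | exact: iE].
  by rewrite -ht => /mapP[x xT ->]; exists x => //; left.
have [psi [psid psii]] := hF hj hi fgK fgL.
exists (gen_subf A), (gen_val A), psi; split=> //.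
  by move=> h hhs; apply: gen_lift; apply: diff_gen_sub; left.
by move=> a; exists (irm a); [exact: iE | exact: psii].
Qed.

End Extend.

(** The commutator of two derivations is a derivation, so vanishing on [v] and on [x * v] forces
    vanishing on [x]. *)
Lemma der_comm_quotient (K : fieldType) (d e : K -> K) (x v : K) :
    is_der d -> is_der e -> v != 0 ->
    d (e v) = e (d v) -> d (e (x * v)) = e (d (x * v)) ->
  d (e x) = e (d x).
Proof.
move=> dP eP v0 hv; rewrite (derM eP) (derM dP) (derD dP) (derD eP).
rewrite !(derM dP) !(derM eP) hv => h; apply: (mulIf v0).
apply/eqP; rewrite -subr_eq0; apply/eqP; move/eqP: h; rewrite -subr_eq0 => /eqP <-.
by ring.
Qed.

(** * Derivations on fraction fields *)

Section FractionDerivation.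
Variables (R : idomainType).
Local Notation tofrac := (@FracField.tofrac R).

Lemma frac_exP (x : {fraction R}) :
  exists ab : R * R, ab.2 != 0 /\ x = tofrac ab.1 / tofrac ab.2.
Proof.
elim/quotW: x => x; exists (\n_x, \d_x); split; first exact: denom_ratioP.
apply: canRL (mulfK _) _ => /=; first by rewrite tofrac_eq0 denom_ratioP.
unlock FracField.tofrac; rewrite -[LHS]FracField.pi_mul; apply/eqmodP => /=.
by rewrite FracField.equivfE /FracField.mulf !numden_Ratio ?oner_eq0
  ?mulf_neq0 ?denom_ratioP ?oner_eq0 // !mulr1 mulrC.
Qed.

Definition frac_num x := (projT1 (cid (frac_exP x))).1.
Definition frac_den x := (projT1 (cid (frac_exP x))).2.
Lemma frac_den_neq0 x : tofrac (frac_den x) != 0.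
Proof. by rewrite /frac_den; case: cid => ab [] /=; rewrite tofrac_eq0. Qed.
Lemma frac_numden x : x = tofrac (frac_num x) / tofrac (frac_den x).
Proof. by rewrite /frac_den /frac_num; case: cid => ab []. Qed.

(** The quotient rule in the form (n' - x m') / m for x = n / m, with one chosen representative;
    [frac_derE] shows that the choice does not matter. *)
Definition frac_der (d : R -> R) (x : {fraction R}) : {fraction R} :=
  (tofrac (d (frac_num x)) - x * tofrac (d (frac_den x))) / tofrac (frac_den x).

Section OneDer.
Variable d : R -> R.
Hypothesis dP : is_der d.

Lemma frac_derE a b x : b != 0 -> x * tofrac b = tofrac a ->
  frac_der d x * tofrac b = tofrac (d a) - x * tofrac (d b).
Proof.
move=> b0 xba.
have n0 := frac_den_neq0 x; have xE := frac_numden x.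
move: n0 xE; rewrite /frac_der; move: (frac_num x) (frac_den x) => n m m0 xE.
have xm : x * tofrac m = tofrac n by rewrite xE (divfK m0).
have nb : n * b = a * m.
  by apply/eqP; rewrite -tofrac_eq !tofracM -xm -xba mulrAC.
have /(congr1 tofrac) := congr1 d nb; rewrite !(derM dP) !tofracD !tofracM -xba -xm => h.
apply: (mulfI m0); rewrite mulrCA mulrA (divfK m0); move: h.
move: (tofrac _) (tofrac _) (tofrac _) (tofrac _) (tofrac m) (tofrac _) => u v w z t y h.
apply/eqP; rewrite -subr_eq0; apply/eqP.
transitivity ((y * z + x * t * w) - (v * t + x * z * u)); first by ring.
by rewrite h subrr.
Qed.

Lemma frac_der_tofrac a : frac_der d (tofrac a) = tofrac (d a).
Proof.
have := @frac_derE a 1 (tofrac a) (oner_neq0 _).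
by rewrite tofrac1 !mulr1 (der1 dP) tofrac0 mulr0 subr0; apply.
Qed.

Lemma frac_der_der : is_der (frac_der d).
Proof.
have m0 := frac_den_neq0; have xE x : x * tofrac (frac_den x) = tofrac (frac_num x).
  by rewrite [X in X * _]frac_numden (divfK (m0 x)).
have dE x := frac_derE _ (xE x).
split=> x y; have := xE x; have := xE y; have := m0 x; have := m0 y;
  move: (frac_num x) (frac_den x) (frac_num y) (frac_den y) => a b a' b';
  rewrite !tofrac_eq0 => hb' hb ya xa;
  have B0 : b * b' != 0 by rewrite mulf_neq0.
  apply: (mulIf (_ : tofrac (b * b') != 0)); first by rewrite tofrac_eq0.
  rewrite (@frac_derE (a * b' + a' * b)) //; last first.
    by rewrite tofracD !tofracM -xa -ya; ring.
  rewrite !(derD dP) !(derM dP) !tofracD !tofracM.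
  transitivity ((frac_der d x * tofrac b) * tofrac b' + (frac_der d y * tofrac b') * tofrac b).
    by rewrite (frac_derE hb xa) (frac_derE hb' ya) -xa -ya; ring.
  by ring.
apply: (mulIf (_ : tofrac (b * b') != 0)); first by rewrite tofrac_eq0.
rewrite (@frac_derE (a * a')) //; last by rewrite !tofracM -xa -ya; ring.
rewrite !(derM dP) !tofracD !tofracM.
transitivity ((frac_der d x * tofrac b) * (y * tofrac b') + (x * tofrac b) * (frac_der d y * tofrac b')).
  by rewrite (frac_derE hb xa) (frac_derE hb' ya) -xa -ya; ring.
by ring.
Qed.

End OneDer.

Lemma frac_derC (d e : R -> R) : is_der d -> is_der e -> (forall a, d (e a) = e (d a)) ->
  forall x, frac_der d (frac_der e x) = frac_der e (frac_der d x).
Proof.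
move=> dP eP dec x; have [[a b] /= [b0 xE]] := frac_exP x.
have b0' : tofrac b != 0 by rewrite tofrac_eq0.
have xb : x * tofrac b = tofrac a by rewrite xE (divfK b0').
have dP' := frac_der_der dP; have eP' := frac_der_der eP.
have de c : frac_der d (frac_der e (tofrac c)) = frac_der e (frac_der d (tofrac c)).
  by rewrite !frac_der_tofrac // dec.
by apply: (der_comm_quotient dP' eP' b0' (de b)); rewrite xb; exact: de.
Qed.
End FractionDerivation.

(** * Formal power series in one variable *)

Record pseries (K : fieldType) := Pseries { pscoef : nat -> K }.

Section PowerSeries.
Variable K : fieldType.
Local Notation T := (pseries K).
Implicit Types f g h : T.

Lemma psP f g : (forall n, pscoef f n = pscoef g n) -> f = g.
Proof. by case: f g => f [g] /= fg; congr Pseries; apply/funext. Qed.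

HB.instance Definition _ := gen_eqMixin T.
HB.instance Definition _ := gen_choiceMixin T.

Definition ps_add f g : T := Pseries (fun n => pscoef f n + pscoef g n).
Definition ps_opp f : T := Pseries (fun n => - pscoef f n).
Definition ps_zero : T := Pseries (fun _ => 0).
Definition ps_one : T := Pseries (fun n => (n == 0%N)%:R).
Definition ps_mul f g : T :=
  Pseries (fun n => \sum_(i < n.+1) pscoef f i * pscoef g (n - i)).

Lemma ps_addA : associative ps_add.
Proof. by move=> f g h; apply: psP => n /=; rewrite addrA. Qed.
Lemma ps_addC : commutative ps_add.
Proof. by move=> f g; apply: psP => n /=; rewrite addrC. Qed.
Lemma ps_add0 : left_id ps_zero ps_add.
Proof. by move=> f; apply: psP => n /=; rewrite add0r. Qed.
Lemma ps_addN : left_inverse ps_zero ps_opp ps_add.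
Proof. by move=> f; apply: psP => n /=; rewrite addNr. Qed.

HB.instance Definition _ := GRing.isZmodule.Build T ps_addA ps_addC ps_add0 ps_addN.

(** A coefficient of a product involves finitely many coefficients of the factors, so associativity,
    commutativity and the Leibniz rule are inherited from polynomials through truncation. *)
Definition ps_trunc n f : {poly K} := \poly_(i < n.+1) pscoef f i.

Lemma coef_trunc n f i : (i <= n)%N -> (ps_trunc n f)`_i = pscoef f i.
Proof. by move=> le_in; rewrite coef_poly ltnS le_in. Qed.

Lemma coef_truncM n f g m : (m <= n)%N ->
  (ps_trunc n f * ps_trunc n g)`_m = pscoef (ps_mul f g) m.
Proof.
move=> le_mn; rewrite coefM; apply: eq_bigr => i _.
have le_im : (i <= m)%N by rewrite -ltnS.
by rewrite !coef_trunc ?(leq_trans le_im) ?(leq_trans (leq_subr _ _)).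
Qed.

Lemma ps_mulA : associative ps_mul.
Proof.
move=> f g h; apply: psP => n.
transitivity ((ps_trunc n f * (ps_trunc n g * ps_trunc n h))`_n).
  rewrite coefM /=; apply: eq_bigr => i _.
  by rewrite coef_trunc -1?ltnS // coef_truncM ?leq_subr.
rewrite mulrA coefM /=; apply: eq_bigr => i _.
by rewrite coef_truncM -1?ltnS // coef_trunc ?leq_subr.
Qed.

Lemma ps_mulC : commutative ps_mul.
Proof.
move=> f g; apply: psP => n.
by rewrite -(coef_truncM f g (leqnn n)) mulrC coef_truncM.
Qed.

Lemma ps_mul1 : left_id ps_one ps_mul.
Proof.
move=> f; apply: psP => n /=; rewrite big_ord_recl mul1r subn0 big1 ?addr0 //.
by move=> i _; rewrite mul0r.
Qed.

Lemma ps_mulDl : left_distributive ps_mul ps_add.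
Proof.
move=> f g h; apply: psP => n /=; rewrite -big_split /=.
by apply: eq_bigr => i _; rewrite mulrDl.
Qed.

Lemma ps_one_neq0 : ps_one != ps_zero.
Proof. by apply/eqP => /(congr1 (fun f => pscoef f 0)) /eqP /=; rewrite oner_eq0. Qed.

HB.instance Definition _ := GRing.Zmodule_isComNzRing.Build T
  ps_mulA ps_mulC ps_mul1 ps_mulDl ps_one_neq0.

Lemma pscoefD f g n : pscoef (f + g) n = pscoef f n + pscoef g n.
Proof. by []. Qed.
Lemma pscoefB f g n : pscoef (f - g) n = pscoef f n - pscoef g n.
Proof. by []. Qed.
Lemma pscoefM f g n : pscoef (f * g) n = \sum_(i < n.+1) pscoef f i * pscoef g (n - i).
Proof. by []. Qed.
Lemma pscoef_sum (I : Type) (r : seq I) (P : pred I) (G : I -> T) n :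
  pscoef (\sum_(i <- r | P i) G i) n = \sum_(i <- r | P i) pscoef (G i) n.
Proof. by elim/big_rec2: _ => // i u v _ <-. Qed.

Definition ps_unit : pred T := fun f => `[< exists g, g * f = 1 >].
Definition ps_inv f : T := if pselect (exists g, g * f = 1) is left h then projT1 (cid h) else f.

Lemma ps_mulV : {in ps_unit, left_inverse 1 ps_inv *%R}.
Proof. by move=> f /asboolP hf; rewrite /ps_inv; case: pselect => // h; case: cid. Qed.
Lemma ps_unitP f g : g * f = 1 -> ps_unit f.
Proof. by move=> gf; apply/asboolP; exists g. Qed.
Lemma ps_inv_out : {in [predC ps_unit], ps_inv =1 id}.
Proof. by move=> f /asboolP nf; rewrite /ps_inv; case: pselect. Qed.

HB.instance Definition _ := GRing.ComNzRing_hasMulInverse.Build T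
  ps_mulV ps_unitP ps_inv_out.

Lemma ps_neq0 f : f != 0 ->
  exists2 n, pscoef f n != 0 & forall i, (i < n)%N -> pscoef f i = 0.
Proof.
move=> f0; have exf : exists n, pscoef f n != 0.
  by apply: contra_notP (elimN eqP f0) => /forallNP h; apply: psP => n /=;
     apply/eqP; apply: contra_notT (h n).
case: (ex_minnP exf) => n fn nmin; exists n => // i lt_in.
by apply/eqP; apply: contraTT lt_in => /nmin; rewrite leqNgt.
Qed.

Lemma ps_integral f g : f * g = 0 -> (f == 0) || (g == 0).
Proof.
move=> fg0; apply/norP => -[/ps_neq0[m fm fmin] /ps_neq0[n gn gmin]].
have /eqP := congr1 (fun f => pscoef f (m + n)%N) fg0; apply/negP.
have lt_m : (m < (m + n).+1)%N by rewrite ltnS leq_addr.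
rewrite pscoefM (bigD1 (Ordinal lt_m)) //= addKn big1 ?addr0 ?mulf_neq0 //.
move=> i; rewrite -val_eqE /= => ne_im.
by case: (ltngtP i m) ne_im => // h _; [rewrite fmin ?mul0r | rewrite gmin ?mulr0 //; have := ltn_ord i; lia].
Qed.

HB.instance Definition _ := GRing.ComUnitRing_isIntegral.Build T ps_integral.

Definition ps_const (a : K) : T := Pseries (fun n => if n == 0%N then a else 0).

Definition ps_deriv f : T := Pseries (fun n => pscoef f n.+1 *+ n.+1).

Lemma ps_deriv_der : is_der ps_deriv.
Proof.
split=> f g; apply: psP => n; first by rewrite /= mulrnDl.
rewrite -[LHS]/(pscoef (ps_mul f g) n.+1 *+ n.+1) -(coef_truncM f g (leqnn n.+1)).
rewrite -coef_deriv derivM coefD pscoefD !pscoefM !coefM; congr (_ + _); apply: eq_bigr => i _.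
  have le_in : (i <= n)%N by rewrite -ltnS.
  by rewrite coef_deriv !coef_trunc ?ltnS // leqW ?leq_subr.
have le_in : (i <= n)%N by rewrite -ltnS.
by rewrite coef_deriv !coef_trunc ?(leqW le_in) // ltnS leq_subr.
Qed.

Definition ps_map (d : K -> K) f : T := Pseries (fun n => d (pscoef f n)).

Lemma ps_map_der d : is_der d -> is_der (ps_map d).
Proof.
move=> dP; split=> f g; apply: psP => n /=; first exact: derD.
by rewrite (der_sum dP) -big_split /=; apply: eq_bigr => i _; rewrite (derM dP).
Qed.

Lemma ps_deriv_map d f : is_der d -> ps_deriv (ps_map d f) = ps_map d (ps_deriv f).
Proof. by move=> dP; apply: psP => n /=; rewrite (derMn dP). Qed.

End PowerSeries.

(** * Taylor expansion and formal linear differential equations *)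

Section Taylor.
Variable K : diffField.

Local Notation tofrac := (@FracField.tofrac (pseries K)).

(* [taylor] sends [dx] to [d/dt] and [dy] to the coefficientwise [dy], so that linear equations in
   [dx - c dy] become triangular systems for the coefficients of a power series in [t]. *)
Definition taylor (a : K) : pseries K :=
  Pseries (fun n => iter n (@dx K) a / n`!%:R).

Lemma natr_neq0 n : (n.+1%:R : K) != 0.
Proof. by have /charf0P -> := @df_pchar0 K. Qed.

Lemma taylor_dx a : ps_deriv (taylor a) = taylor (dx a).
Proof.
apply: psP => n /=; rewrite -iterSr factS natrM -iterS.
by rewrite -[LHS]mulr_natr invfM mulrA mulrAC (divfK (natr_neq0 n)).
Qed.

Lemma taylor_dy a : ps_map (@dy K) (taylor a) = taylor (dy a).
Proof.
apply: psP => n /=.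
have -> : iter n (@dx K) (dy a) = dy (iter n (@dx K) a).
  by elim: n => //= n ->; rewrite dx_dy_comm.
have n0 : n`!%:R != 0 :> K by case: n`! (fact_gt0 n) => // m _; exact: natr_neq0.
apply: (mulIf n0); rewrite (divfK n0).
rewrite -[in RHS](divfK n0 (iter n (@dx K) a)) [in RHS](derM (@is_der_df_y K)).
by rewrite (der_nat (@is_der_df_y K)) mulr0 addr0.
Qed.

Lemma iter_dxD n (a b : K) : iter n (@dx K) (a + b) = iter n (@dx K) a + iter n (@dx K) b.
Proof. by elim: n => //= n ->; rewrite (derD (@is_der_df_x K)). Qed.

Lemma taylorD a b : taylor (a + b) = taylor a + taylor b.
Proof. by apply: psP => n /=; rewrite iter_dxD mulrDl. Qed.

(** The constant terms agree, and a later coefficient is determined by the derivative, where the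
    Leibniz rule holds on both sides; the division by [n.+1] uses characteristic 0. *)
Lemma taylorM a b : taylor (a * b) = taylor a * taylor b.
Proof.
apply: psP => n; elim: n a b => [|n IH] a b.
  by rewrite pscoefM big_ord1 /= fact0 !divr1.
apply: (mulIf (natr_neq0 n)); rewrite !mulr_natr.
rewrite -[LHS]/(pscoef (ps_deriv (taylor (a * b))) n).
rewrite -[RHS]/(pscoef (ps_deriv (taylor a * taylor b)) n).
rewrite taylor_dx (derM (@is_der_df_x K)) taylorD pscoefD !IH -pscoefD.
by rewrite (derM (@ps_deriv_der K)) !taylor_dx.
Qed.

Lemma taylor1 : taylor 1 = 1.
Proof.
apply: psP => -[|n] /=; first by rewrite fact0 divr1.
suff -> : dx (iter n (@dx K) 1) = 0 by rewrite mul0r.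
by elim: n => [|n IH]; rewrite /= ?IH ?(der1 (@is_der_df_x K)) ?(der0 (@is_der_df_x K)).
Qed.

End Taylor.

(** Successive approximation: a correction starting at index [i] changes the value of [Phi] there by
    [B i] of its first entry and leaves the earlier values alone. It serves both power series and
    fractional-derivatives series. *)
Lemma triangular_surj (A : zmodType) (Phi : (nat -> A) -> nat -> A)
    (B : nat -> A -> A) :
    (forall f g i, Phi (fun n => f n - g n) i = Phi f i - Phi g i) ->
    (forall i h, (forall j, (j < i)%N -> h j = 0) -> Phi h i = B i (h i)) ->
    (forall i z, exists x, B i x = z) ->
  forall k, exists h, forall i, Phi h i = k i.
Proof.
move=> PhiB PhiL Bsurj k.
pose b i z := projT1 (cid (Bsurj i z)).
have bE i z : B i (b i z) = z by rewrite /b; case: cid.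
(* [P n] holds the first [n] entries, followed by zeros; the entry added next removes the error left
   at index [n]. *)
pose fix P n : nat -> A :=
  if n is m.+1 then fun j => if j == m then b m (k m - Phi (P m) m) else P m j
  else fun _ => 0.
have P0 n j : (n <= j)%N -> P n j = 0.
  elim: n => [|n IH] //= lt_nj; rewrite gtn_eqF // IH //; exact: ltnW.
have Pst n j : (j < n)%N -> P n j = P j.+1 j.
  elim: n => // n IH; rewrite ltnS leq_eqVlt => /orP[/eqP -> //|lt_jn].
  by rewrite [LHS]/= ltn_eqF // IH.
exists (fun j => P j.+1 j) => i.
rewrite -[LHS](subrK (Phi (P i) i)) -PhiB PhiL; last by move=> j /Pst ->; rewrite subrr.
by rewrite (P0 i i) // subr0 /= eqxx bE subrK.
Qed.

Section PsField.
Variable K : diffField.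
Local Notation tofrac := (@FracField.tofrac (pseries K)).

Let d1P : is_der (@ps_deriv K) := @ps_deriv_der K.
Let d2P : is_der (ps_map (@dy K)) := ps_map_der (@is_der_df_y K).

Definition psf_morph (a : K) : {fraction pseries K} := tofrac (taylor a).

Lemma psf_morphB : GRing.zmod_morphism psf_morph.
Proof.
move=> a b; apply/eqP; rewrite eq_sym subr_eq; apply/eqP.
by rewrite /psf_morph -tofracD -taylorD subrK.
Qed.
Lemma psf_morphM : GRing.monoid_morphism psf_morph.
Proof.
split; first by rewrite /psf_morph taylor1 tofrac1.
by move=> a b; rewrite /psf_morph taylorM tofracM.
Qed.

HB.instance Definition _ := GRing.isZmodMorphism.Build _ _ psf_morph psf_morphB.
HB.instance Definition _ := GRing.isMonoidMorphism.Build _ _ psf_morph psf_morphM.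

Lemma psf_pchar : [pchar {fraction pseries K}] =i pred0.
Proof.
by move=> p; rewrite -(@df_pchar0 K p) -(fmorph_pchar (psf_morph : {rmorphism K -> {fraction pseries K}})).
Qed.

Lemma psf_comm x : frac_der (@ps_deriv K) (frac_der (ps_map (@dy K)) x) =
  frac_der (ps_map (@dy K)) (frac_der (@ps_deriv K) x).
Proof. by apply: frac_derC => // f; exact: ps_deriv_map. Qed.

Definition psf : diffField := @DiffField {fraction pseries K}
  (frac_der (@ps_deriv K)) (frac_der (ps_map (@dy K)))
  psf_pchar (frac_der_der d1P) (frac_der_der d2P) psf_comm.

Definition psf_embed : {rmorphism K -> psf} := (psf_morph : {rmorphism K -> {fraction pseries K}}).

Lemma psf_embed_diff : diff_morphism psf_embed.
Proof.
move=> a; split; apply: esym; rewrite /= /psf_morph frac_der_tofrac //.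
  by rewrite taylor_dx.
by rewrite taylor_dy.
Qed.

Variables (c : pseries K) (a : nat -> pseries K).
Let del (f : pseries K) := ps_deriv f - c * ps_map (@dy K) f.

Lemma ps_delB f g : del (f - g) = del f - del g.
Proof. by rewrite /del (derB d1P) (derB d2P); ring. Qed.

Lemma ps_iter_delB n f g : iter n del (f - g) = iter n del f - iter n del g.
Proof. by elim: n => //= n ->; exact: ps_delB. Qed.

(** Only the derivative in t lowers the order in t, since [dy] acts on coefficients. The leading
    coefficient is thus multiplied by the same falling factorial as under the pure derivative in
    t. *)
Lemma ps_iter_del_lead f i k : (forall j, (j < i)%N -> pscoef f j = 0) ->
  (forall j, (j + k < i)%N -> pscoef (iter k del f) j = 0) /\
  (forall j, (j + k)%N = i -> pscoef (iter k del f) j = pscoef f i *+ i ^_ k).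
Proof.
move=> f0; elim: k => [|k [IH1 IH2]].
  by split=> j; rewrite addn0 ?ffactn0 ?mulr1n; [exact: f0 | move=> ->].
have low j : (j + k.+1 <= i)%N -> pscoef (c * ps_map (@dy K) (iter k del f)) j = 0.
  move=> hj; rewrite pscoefM big1 // => m _ /=.
  by rewrite IH1 ?(der0 (@is_der_df_y K)) ?mulr0 //; lia.
split=> j hj; rewrite iterS pscoefB low ?subr0 /=; try lia.
  by rewrite IH1 ?mul0rn //; lia.
rewrite IH2; last lia.
by rewrite -mulrnA ffactnSr; congr (_ *+ (_ * _)); lia.
Qed.

(** A formal Cauchy problem with the first [n] coefficients equal to kappa, 0, ..., 0. The equation
    determines the coefficients from index [n] on, the falling factorials being invertible. *)
Lemma ps_ode n kappa (g : pseries K) : (0 < n)%N ->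
  exists2 f, iter n del f = \sum_(k < n) a k * iter k del f + g & pscoef f 0 = kappa.
Proof.
move=> n0; pose shift (h : nat -> K) : pseries K :=
  Pseries (fun m => if (m < n)%N then 0 else h (m - n)%N).
pose Phi f := iter n del f - \sum_(k < n) a k * iter k del f.
have PhiB f h : Phi (f - h) = Phi f - Phi h.
  rewrite /Phi ps_iter_delB.
  have -> : \sum_(k < n) a k * iter k del (f - h) =
      \sum_(k < n) a k * iter k del f - \sum_(k < n) a k * iter k del h.
    by rewrite -sumrB; apply: eq_bigr => k _; rewrite ps_iter_delB mulrBr.
  by ring.
have := @triangular_surj K (fun h => pscoef (Phi (shift h))) (fun i z => z *+ (i + n) ^_ n) _ _ _
  (pscoef (g - Phi (ps_const kappa))).
case.
- move=> f h i; rewrite -pscoefB -PhiB; congr (pscoef (Phi _) _).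
  by apply: psP => m /=; case: ifP; rewrite ?subr0.
- move=> i h h0.
  have f0 j : (j < i + n)%N -> pscoef (shift h) j = 0.
    by move=> hj /=; case: ifP => // hjn; apply: h0; lia.
  rewrite /Phi pscoefB pscoef_sum big1 ?subr0.
    have [_ ->] := @ps_iter_del_lead _ _ n f0; last by [].
    by rewrite /= ltnNge leq_addl addnK.
  move=> k _; rewrite pscoefM big1 // => m _.
  have [-> //] := @ps_iter_del_lead _ _ k f0; rewrite ?mulr0 //.
  have := ltn_ord k; have := ltn_ord m; lia.
- move=> i z; exists (z / ((i + n) ^_ n)%:R).
  rewrite -[LHS]mulr_natr divfK //.
  have : (0 < (i + n) ^_ n)%N by rewrite ffact_gt0 leq_addl.
  by case: (_ ^_ _) => // m _; exact: natr_neq0.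
move=> h hE; exists (shift h + ps_const kappa); last by rewrite /= n0 add0r.
suff : Phi (shift h + ps_const kappa) = g.
  by rewrite /Phi; move/eqP; rewrite subr_eq [g + _]addrC => /eqP.
have Phi0 : Phi 0 = 0 by have := PhiB 0 0; rewrite !subrr.
rewrite -[ps_const _]opprK PhiB -[in X in _ - X]sub0r PhiB Phi0 sub0r opprK.
by rewrite (_ : Phi (shift h) = g - Phi (ps_const kappa)) ?subrK //; exact: psP.
Qed.

End PsField.

Lemma diff_morphism_iter (K L : diffField) (v : {rmorphism K -> L}) (c : K) n h :
    diff_morphism v ->
  v (iter n (fun z => dx z - c * dy z) h) =
  iter n (fun z => dx z - v c * dy z) (v h).
Proof.
move=> vd; elim: n => //= n IH; rewrite rmorphB rmorphM.
by case: (vd (iter n (fun z => dx z - c * dy z) h)) => -> ->; rewrite IH.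
Qed.

(** [kappa] is the constant term of the power series solution, and [dy] acts on coefficients, so the
    non-vanishing of [kappa] and of [dy kappa] passes to the solution. The second conclusion is
    needed for the eikonal equation. *)
Lemma universal_ode (F : diffField) (kappa c : F) n (a : nat -> F) (g : F) :
    kolchin_universal F -> (0 < n)%N ->
  let del z := dx z - c * dy z in
  exists h, [/\ iter n del h = \sum_(k < n) a k * iter k del h + g,
                kappa != 0 -> h != 0 & dy kappa != 0 -> dy h != 0].
Proof.
move=> hF n0; pose S := [:: kappa, c, g & [seq a k | k <- iota 0 n]].
pose K := gen_subf (fun x => x \in S); pose j : {rmorphism K -> F} := gen_val _.
have [t tE] : exists t : seq K, map j t = S by exact: gen_lift_seq.
case: t tE => [|kappa' [|c' [|g' a']]] // [kE cE gE aE].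
have aE' k : (k < n)%N -> j a'`_k = a k.
  move=> lt_kn; rewrite -(nth_map 0 0) ?aE.
    by rewrite (nth_map 0%N) ?size_iota // nth_iota.
  by rewrite -(size_map j) aE size_map size_iota.
have [f fE f0] := @ps_ode K (taylor c') (fun k => taylor a'`_k) n kappa' (taylor g') n0.
pose phi := psf_embed K.
have [L [v [psi [vd psid hh hphi]]]] :=
  universal_extend hF (@psf_embed_diff K) [:: (FracField.tofrac f : psf K)].
have [h hE] := hh _ (mem_head _ _).
have jd : diff_morphism j by [].
have [c2 vc pc] := hphi c'; have [g2 vg pg] := hphi g'; have [k2 vk pk] := hphi kappa'.
have a2P k : exists a2, v a2 = phi a'`_k /\ psi a2 = j a'`_k.
  by have [a2] := hphi a'`_k; exists a2.
pose a2 k := projT1 (cid (a2P k)).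
have va k : v (a2 k) = phi a'`_k by rewrite /a2; case: cid => ? [].
have pa k : psi (a2 k) = j a'`_k by rewrite /a2; case: cid => ? [].
have iterE k : v (iter k (fun z => dx z - c2 * dy z) h) =
    FracField.tofrac (iter k (fun f => ps_deriv f - taylor c' * ps_map (@dy K) f) f).
  rewrite (diff_morphism_iter _ _ _ vd) hE vc.
  elim: k => //= k ->; rewrite tofracB tofracM.
  by rewrite (frac_der_tofrac (@ps_deriv_der K)) (frac_der_tofrac (ps_map_der (@is_der_df_y K))).
have hode : iter n (fun z => dx z - c2 * dy z) h =
    \sum_(k < n) a2 k * iter k (fun z => dx z - c2 * dy z) h + g2.
  apply: (fmorph_inj v); rewrite iterE fE tofracD rmorphD vg; congr (_ + _).
  rewrite !rmorph_sum; apply: eq_bigr => k _.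
  by rewrite [LHS]tofracM [RHS]rmorphM iterE va.
exists (psi h); split.
- have := congr1 psi hode; rewrite (diff_morphism_iter _ _ _ psid) pc [j c']cE => ->.
  rewrite rmorphD pg [j g']gE rmorph_sum; congr (_ + _); apply: eq_bigr => k _.
  by rewrite rmorphM pa aE' // (diff_morphism_iter _ _ _ psid) pc [j c']cE.
- rewrite -kE !fmorph_eq0; apply: contra_neq => h0.
  move: hE; rewrite h0 rmorph0 => /esym/eqP; rewrite tofrac_eq0 => /eqP ff.
  by rewrite -f0 ff.
rewrite -kE -(jd kappa').2 -(psid h).2 !fmorph_eq0.
apply: contra_neq => h0.
have := congr1 v h0; rewrite rmorph0 (vd h).2 hE /= (frac_der_tofrac (ps_map_der (@is_der_df_y K))).
by move/eqP; rewrite tofrac_eq0 => /eqP/(congr1 (fun f => pscoef f 0)) /=; rewrite f0.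
Qed.

(** After exchanging the derivations, the variable t of the power series ring has derivative 1, and
    universality brings it into [F]. *)
Lemma universal_nonconstant (F : diffField) : kolchin_universal F ->
  exists x : F, dy x != 0.
Proof.
move=> /universal_swap hF; pose K := gen_subf (fun x : swap_df F => x \in [::]).
pose t : pseries K := Pseries (fun n => (n == 1%N)%:R).
have [L [v [psi [vd psid hh _]]]] :=
  universal_extend hF (@psf_embed_diff K) [:: (FracField.tofrac t : psf K)].
have [h hE] := hh _ (mem_head _ _).
exists (psi h); rewrite -[dy _]/(@dx (swap_df F) (psi h)) -(psid h).1 fmorph_eq0.
rewrite -(fmorph_eq0 v) (vd h).1 hE /= (frac_der_tofrac (@ps_deriv_der K)).
rewrite tofrac_eq0; apply/eqP => /(congr1 (fun f => pscoef f 0)) /eqP /=.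
by rewrite mulr1n oner_eq0.
Qed.

(** * Algebraic extensions and roots of polynomials in a universal field *)

Lemma irreducible_factor (K : fieldType) (p : {poly K}) : (1 < size p)%N ->
  exists2 q, irreducible_poly q & q %| p.
Proof.
move=> p1.
have ex : exists n, `[< exists q : {poly K}, [/\ size q = n, (1 < size q)%N & q %| p] >].
  by exists (size p); apply/asboolP; exists p.
case: (ex_minnP ex) => n /asboolP[q [qn q1 qp]] nmin; exists q => //; split=> //.
move=> r r1 rq; rewrite -dvdp_size_eqp //; apply/eqP.
have q0 : q != 0 by rewrite -size_poly_gt0 ltnW.
have r0 : r != 0 by apply: contraTneq rq => ->; rewrite dvd0p.
apply/eqP; rewrite eqn_leq dvdp_leq //= qn; apply: nmin; apply/asboolP.
exists r; split=> //; last exact: dvdp_trans rq qp.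
by rewrite ltn_neqAle eq_sym r1 size_poly_gt0.
Qed.

Lemma comm_der (R : comNzRingType) (d e : R -> R) : is_der d -> is_der e ->
  is_der (fun x => d (e x) - e (d x)).
Proof.
move=> dP eP; split=> a b; first by rewrite !(derD eP) !(derD dP) (derD eP); ring.
by rewrite !(derM eP) !(derM dP) !(derD dP) !(derD eP) !(derM dP) !(derM eP); ring.
Qed.

Section AlgebraicExtension.
Variables (K : diffField) (E : fieldExtType K) (p : {poly K}) (z : E).
Hypotheses (p_irr : irreducible_poly p) (pz : root (map_poly (in_alg E) p) z).

Definition aev (q : {poly K}) : E := (map_poly (in_alg E) q).[z].
Hypothesis aev_onto : forall e, exists q, e = aev q.

Lemma aevD q r : aev (q + r) = aev q + aev r.
Proof. by rewrite /aev rmorphD hornerD. Qed.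
Lemma aevB q r : aev (q - r) = aev q - aev r.
Proof. by rewrite /aev rmorphB hornerD hornerN. Qed.
Lemma aevM q r : aev (q * r) = aev q * aev r.
Proof. by rewrite /aev rmorphM hornerM. Qed.
Lemma aevC a : aev a%:P = in_alg E a.
Proof. by rewrite /aev map_polyC hornerC. Qed.
Lemma aevX : aev 'X = z.
Proof. by rewrite /aev map_polyX hornerX. Qed.
Lemma aevp : aev p = 0. Proof. exact/eqP. Qed.

Lemma aev_dvd q : aev q = 0 -> p %| q.
Proof.
move=> q0; have [p1 pi] := p_irr.
case: (boolP (coprimep p q)) => [/Bezout_eq1_coprimepP[[u v] /= uv]|ncop].
  have /eqP := congr1 aev uv; rewrite aevD !aevM aevp q0 !mulr0 addr0.
  by rewrite -[1]/(1%:P) aevC rmorph1 eq_sym oner_eq0.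
have := pi (gcdp p q) ncop (dvdp_gcdl _ _) => /eqp_dvdl h.
by rewrite -h dvdp_gcdr.
Qed.

(** In characteristic 0 the derivative of [p] is a non-zero polynomial of smaller degree, which the
    irreducible [p] cannot divide. *)
Lemma aev_deriv_neq0 : aev p^`() != 0.
Proof.
have [p1 _] := p_irr; apply/eqP => /aev_dvd pdvd.
have p'0 : p^`() != 0.
  apply/eqP => /(congr1 (fun q : {poly K} => q`_(size p).-2)) /eqP.
  have e : ((size p).-2.+1 = (size p).-1)%N by case: (size p) p1 => [|[]].
  rewrite coef_deriv coef0 e -mulr_natr mulf_eq0 -/(lead_coef p) lead_coef_eq0.
  rewrite -size_poly_eq0; have /charf0P -> := @df_pchar0 K.
  by case: (size p) p1 => [|[]].
by have := dvdp_leq p'0 pdvd; rewrite leqNgt lt_size_deriv // -size_poly_gt0 ltnW.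
Qed.

Section Ext.
Variable d : K -> K.
Hypothesis dP : is_der d.

(** The value that differentiating p(z) = 0 forces on the derivative of [z]. *)
Definition adz : E := - aev (map_poly d p) / aev p^`().
Definition aext (e : E) : E :=
  let q := projT1 (cid (aev_onto e)) in aev (map_poly d q) + aev q^`() * adz.

Let mdP := map_poly_der dP.

Lemma aextE q : aext (aev q) = aev (map_poly d q) + aev q^`() * adz.
Proof.
rewrite /aext; case: cid => r /= qr.
have /aev_dvd/dvdpP[s rsE] : aev (q - r) = 0 by rewrite aevB qr subrr.
have {rsE}-> : q = r + s * p by rewrite -rsE addrC subrK.
have key : aev p^`() * adz = - aev (map_poly d p).
  by rewrite /adz mulrC (divfK aev_deriv_neq0).
rewrite (derD mdP) (derM mdP) derivD derivM !aevD !aevM aevp !mulr0 !add0r.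
by rewrite mulrDl -[X in _ = _ + (_ + X)]mulrA key; ring.
Qed.

Lemma aext_der : is_der aext.
Proof.
split=> a b; have [q ->] := aev_onto a; have [r ->] := aev_onto b.
  rewrite -aevD !aextE (derD mdP) derivD !aevD; ring.
rewrite -aevM !aextE (derM mdP) derivM !aevD !aevM; ring.
Qed.

Lemma aext_alg a : aext (in_alg E a) = in_alg E (d a).
Proof. by rewrite -aevC aextE (map_derC dP) derivC /aev map_poly0 horner0 mul0r addr0 -/(aev _) aevC. Qed.

End Ext.

Lemma der_aev (d : E -> E) : is_der d -> (forall a, d (in_alg E a) = 0) ->
  forall q, d (aev q) = aev q^`() * d z.
Proof.
move=> dP dK; elim/poly_ind => [|q c IH].
  by rewrite deriv0 (_ : 0 = 0%:P) // aevC dK rmorph0 mul0r.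
rewrite aevD aevM aevX aevC (derD dP) dK addr0 (derM dP) IH.
by rewrite derivD derivM derivC derivX addr0 mulr1 aevD aevM aevX; ring.
Qed.

(** The commutator is a derivation that vanishes on [K]. Applied to p(z) = 0 it gives p'(z) times
    its value at [z], so it vanishes at [z] and then everywhere. *)
Lemma aext_comm (d e : K -> K) : is_der d -> is_der e -> (forall a, d (e a) = e (d a)) ->
  forall x, aext d (aext e x) = aext e (aext d x).
Proof.
move=> dP eP dec x; have cP := comm_der (aext_der dP) (aext_der eP).
have c0 a : aext d (aext e (in_alg E a)) - aext e (aext d (in_alg E a)) = 0.
  by rewrite !aext_alg // dec subrr.
have cz := der_aev cP c0; have [q ->] := aev_onto x.
apply/eqP; rewrite -subr_eq0 cz mulf_eq0; apply/orP; right.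
have /eqP := cz p; rewrite aevp (der0 cP) eq_sym mulf_eq0.
by rewrite (negbTE aev_deriv_neq0).
Qed.

Lemma aext_pchar : [pchar E] =i pred0.
Proof. by move=> q; rewrite -(@df_pchar0 K q) -(fmorph_pchar (in_alg E)). Qed.

Definition alg_df : diffField := @DiffField E (aext (@dx K)) (aext (@dy K)) aext_pchar
  (aext_der (@is_der_df_x K)) (aext_der (@is_der_df_y K))
  (aext_comm (@is_der_df_x K) (@is_der_df_y K) (@dx_dy_comm K)).

Definition alg_embed : {rmorphism K -> alg_df} := in_alg E.

Lemma alg_embed_diff : diff_morphism alg_embed.
Proof. by move=> a; split; rewrite /= aext_alg. Qed.

End AlgebraicExtension.

Lemma universal_root (F : diffField) (p : {poly F}) : kolchin_universal F ->
  (1 < size p)%N -> exists x, root p x.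
Proof.
move=> hF p1; pose K := gen_subf (fun x => x \in (p : seq F)).
pose j : {rmorphism K -> F} := gen_val _.
have [t tE] : exists t : seq K, map j t = p by exact: gen_lift_seq.
have ptE : p = map_poly j (Poly t).
  by apply/polyP => i; rewrite map_Poly_id0 ?rmorph0 // tE polyseqK.
have {}p1 : (1 < size (Poly t))%N by rewrite ptE size_map_poly in p1.
have [q q_irr qp] := irreducible_factor p1.
have [E _ [z qz zgen]] := irredp_FAdjoin q_irr.
have onto e : exists r, e = aev z r.
  have : e \in <<1; z>>%VS by rewrite zgen memvf.
  case/Fadjoin_polyP => r /polyOver1P[s ->] ->.
  by exists s.
have [L [v [psi [vd psid hh hphi]]]] :=
  universal_extend hF (@alg_embed_diff K E q z q_irr qz onto) [:: (z : alg_df q_irr qz onto)].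
have [h hE] := hh _ (mem_head _ _).
have wP a : exists a', v a' = in_alg E a /\ psi a' = j a.
  by have [a'] := hphi a; exists a'.
pose w a := projT1 (cid (wP a)).
have vw a : v (w a) = in_alg E a by rewrite /w; case: cid => ? [].
have pw a : psi (w a) = j a by rewrite /w; case: cid => ? [].
have s0 : \sum_(i < size q) w q`_i * h ^+ i = 0.
  apply: (fmorph_inj v); rewrite rmorph0 rmorph_sum.
  rewrite -[RHS](eqP qz) horner_coef size_map_poly; apply: eq_bigr => i _.
  by rewrite rmorphM rmorphXn vw hE coef_map.
exists (psi h); rewrite ptE; have /dvdpP[s ->] := qp.
rewrite rmorphM rootM; apply/orP; right; apply/eqP.
rewrite horner_coef size_map_poly -[RHS](rmorph0 psi) -s0 rmorph_sum.
by apply: eq_bigr => i _; rewrite rmorphM rmorphXn pw coef_map.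
Qed.

(** * Weights and leading terms *)

Lemma sum_neq0 (V : zmodType) (I : finType) (G : I -> V) :
  \sum_i G i != 0 -> exists i, G i != 0.
Proof.
move=> h; apply/existsP; rewrite -negb_forall; apply: contraNN h => /forallP h.
by rewrite big1 // => i _; apply/eqP; rewrite -[_ == _]negbK h.
Qed.

Section Weights.
Variables (F : fieldType) (w a b : nat).
Local Notation R2 := {poly {poly {poly F}}}.
Implicit Types B C : R2.

(** The exponents belong to tau, d_x and d_y. The strict bound suits differences: [wlt N (B - C)]
    says that [B] and [C] agree in all weights from [N] on, while [wlt N.+1 B] says that [B] has
    weight at most [N]. *)
Definition wlt N B := forall e i j : nat, B`_e`_i`_j != 0 -> (w * e + a * i + b * j < N)%N.

Lemma wlt_leq M N B : (M <= N)%N -> wlt M B -> wlt N B.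
Proof. by move=> le_MN hB e i j /hB lt_M; exact: leq_trans lt_M le_MN. Qed.

Lemma wlt0 N : wlt N 0.
Proof. by move=> e i j; rewrite !coef0 eqxx. Qed.

Lemma wltD N B C : wlt N B -> wlt N C -> wlt N (B + C).
Proof.
move=> hB hC e i j; rewrite !coefD => h.
have [/hB //|B0] := boolP (B`_e`_i`_j != 0).
by apply: hC; move: h; rewrite (eqP (negbNE B0)) add0r.
Qed.

Lemma wltN N B : wlt N B -> wlt N (- B).
Proof. by move=> hB e i j; rewrite !coefN oppr_eq0; exact: hB. Qed.

Lemma wlt_sum N (I : Type) (r : seq I) (P : pred I) (G : I -> R2) :
  (forall i, P i -> wlt N (G i)) -> wlt N (\sum_(i <- r | P i) G i).
Proof. by move=> h; apply: (big_ind (wlt N)); [exact: wlt0 | exact: wltD | ]. Qed.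

Lemma wltM N M B C : wlt N.+1 B -> wlt M C -> wlt (N + M) (B * C).
Proof.
move=> hB hC e i j; rewrite coefM !coef_sum => /sum_neq0[e1].
rewrite coefM coef_sum => /sum_neq0[i1]; rewrite coefM => /sum_neq0[j1].
rewrite mulf_eq0 negb_or => /andP[/hB h1 /hC h2].
have := ltn_ord e1; have := ltn_ord i1; have := ltn_ord j1; nia.
Qed.

Lemma wltMr N M B C : wlt N B -> wlt M.+1 C -> wlt (N + M) (B * C).
Proof. by move=> hB hC; rewrite mulrC addnC; exact: wltM. Qed.

Lemma wltM1 N M B C : wlt N.+1 B -> wlt M.+1 C -> wlt (N + M).+1 (B * C).
Proof. by move=> hB hC; rewrite -addnS; exact: wltM. Qed.

Lemma wlt1 : wlt 1 1.
Proof.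
move=> [|e] [|i] [|j]; rewrite ?coef1 ?coef0 /= ?coef1 ?coef0 /= ?coef1 ?coef0 ?eqxx //.
by rewrite !muln0.
Qed.

Lemma wltX N B i : wlt N.+1 B -> wlt (i * N).+1 (B ^+ i).
Proof.
move=> hB; elim: i => [|i IH]; first by rewrite expr0 mul0n; exact: wlt1.
by rewrite exprS mulSn; exact: wltM1.
Qed.

Lemma wltC3 c : wlt 1 c%:P%:P%:P.
Proof.
move=> [|e] [|i] [|j]; rewrite ?coefC ?coef0 /= ?coefC ?coef0 /= ?coefC ?coef0 ?eqxx //.
by rewrite !muln0.
Qed.

Lemma wlt_scale N c B : wlt N B -> wlt N (c%:P%:P%:P * B).
Proof. by move=> hB; rewrite -[N]add0n; apply: wltM => //; exact: wltC3. Qed.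

Lemma wlt_tau : wlt w.+1 'X.
Proof.
move=> [|[|e]] i j; rewrite coefX /= ?coef0 ?eqxx //.
by case: i j => [|i] [|j]; rewrite coef1 /= ?coef0 ?coef1 ?eqxx //= ?eqxx //; lia.
Qed.

Lemma wlt_X : wlt a.+1 'X%:P.
Proof.
move=> [|e] i j; rewrite coefC /= ?coef0 ?eqxx //.
by case: i j => [|[|i]] [|j]; rewrite coefX /= ?coef0 ?coef1 ?eqxx //; lia.
Qed.

Lemma wlt_Y : wlt b.+1 'X%:P%:P.
Proof.
move=> [|e] i j; rewrite coefC /= ?coef0 ?eqxx //.
by case: i j => [|i] [|[|j]]; rewrite coefC /= ?coef0 ?coefX ?eqxx //; lia.
Qed.

Lemma wlt_map (d : F -> F) N B : is_der d -> wlt N B ->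
  wlt N (map_poly (map_poly (map_poly d)) B).
Proof.
move=> dP hB e i j; have mP := map_poly_der dP; have mmP := map_poly_der mP.
rewrite (coef_map_der mmP) (coef_map_der mP) (coef_map_der dP) => h; apply: hB.
by apply: contraNneq h => ->; rewrite (der0 dP).
Qed.

Lemma wlt_coef N B e i j : wlt N B -> (N <= w * e + a * i + b * j)%N -> B`_e`_i`_j = 0.
Proof.
by move=> hB le; apply/eqP; apply: contraTT le => /hB; rewrite ltnNge.
Qed.

End Weights.

(** * Operators act as their symbols up to lower weight *)

Section Estimate.
Variables (F : diffField) (w a b : nat).
Local Notation R2 := {poly {poly {poly F}}}.
Variables (x1 x2 : R2).

Definition const3 : {rmorphism F -> R2} := polyC \o (polyC \o polyC).
Definition der3 (d : F -> F) : R2 -> R2 := map_poly (map_poly (map_poly d)).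

Lemma der3_der (d : F -> F) : is_der d -> is_der (der3 d).
Proof. by move=> dP; do 3!apply: map_poly_der. Qed.

Lemma der3C (d : F -> F) : is_der d -> forall c, der3 d (const3 c) = const3 (d c).
Proof.
move=> dP c; have mP := map_poly_der dP; have mmP := map_poly_der mP.
by rewrite /der3 /= (map_derC mmP) (map_derC mP) (map_derC dP).
Qed.

Lemma der3_comm B : der3 (@dx F) (der3 (@dy F) B) = der3 (@dy F) (der3 (@dx F) B).
Proof.
by rewrite /der3; do 2!(apply: map_poly_derC; [by do ?apply: map_poly_der | by do ?apply: map_poly_der | move=> {}B]);
  apply: map_poly_derC => // ?; rewrite dx_dy_comm.
Qed.

Hypothesis x12 : der3 (@dx F) x2 = der3 (@dy F) x1.

Definition tmodule : dmodule F :=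
  ring_module (der3_der (@is_der_df_x F)) (der3_der (@is_der_df_y F))
    (der3C (@is_der_df_x F)) (der3C (@is_der_df_y F)) der3_comm x12.

(** The symbol of [p], with commuting [x1] and [x2] in the places of d_x and d_y. *)
Definition tev (p : diffop F) : R2 :=
  \sum_(i < size p) \sum_(j < size p`_i) const3 p`_i`_j * (x1 ^+ i * x2 ^+ j).

Variables (w1 w2 : nat).
Hypotheses (x1w : wlt w a b w1.+1 x1) (x2w : wlt w a b w2.+1 x2).
Hypotheses (w1_gt0 : (0 < w1)%N) (w2_gt0 : (0 < w2)%N).
Local Notation wl := (wlt w a b).

Lemma iter_estimate N (C : R2) i j : wl N.+1 C ->
  let P := iter i (@dm_x F tmodule) (iter j (@dm_y F tmodule) C) in
  wl (N + i * w1 + j * w2).+1 P /\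
  wl (N + i * w1 + j * w2) (P - x1 ^+ i * x2 ^+ j * C).
Proof.
move=> hC.
have step (x : R2) (v : nat) (d : F -> F) (M : nat) (P S : R2) : (0 < v)%N -> wl v.+1 x ->
    is_der d -> wl M.+1 P -> wl M (P - S) ->
    wl (M + v).+1 (der3 d P + x * P) /\ wl (M + v) (der3 d P + x * P - x * S).
  move=> v0 xv dP hP hPS.
  have hd : wl (M + v) (der3 d P).
    by apply: (@wlt_leq _ _ _ _ M.+1); [lia | exact: wlt_map].
  split; first by apply: wltD; [exact: wlt_leq hd | rewrite addnC; exact: wltM1].
  rewrite -addrA -mulrBr; apply: wltD => //; rewrite addnC; exact: wltM.
have hY : let P := iter j (@dm_y F tmodule) C in
    wl (N + j * w2).+1 P /\ wl (N + j * w2) (P - x2 ^+ j * C).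
  elim: j => [|j [IH1 IH2]] /=.
    by rewrite mul0n addn0 expr0 mul1r subrr; split=> //; exact: wlt0.
  rewrite mulSn addnCA addnC exprS -mulrA.
  exact: (step _ _ _ _ _ _ w2_gt0 x2w (@is_der_df_y F) IH1 IH2).
elim: i => [|i [IH1 IH2]] /=; first by rewrite mul0n addn0 expr0 mul1r.
rewrite mulSn exprS -!mulrA (_ : N + (w1 + i * w1) + j * w2 = (N + i * w1 + j * w2) + w1)%N; last by lia.
rewrite -mulrA in IH2.
exact: (step _ _ _ _ _ _ w1_gt0 x1w (@is_der_df_x F) IH1 IH2).
Qed.

(** Differentiating coefficients does not raise the weight, whereas multiplications by [x1] and [x2]
    are allotted the positive weights [w1] and [w2]. Dropping every derivative of a coefficient
    therefore changes nothing in the top weight. *)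
Lemma act_estimate N M (C : R2) (p : diffop F) : wl N.+1 C ->
    (forall i j, p`_i`_j != 0 -> (i * w1 + j * w2 <= M)%N) ->
  wl (N + M) (@act F tmodule p C - tev p * C).
Proof.
move=> hC hp; rewrite /act /tev mulr_suml -sumrB; apply: wlt_sum => i _.
rewrite mulr_suml -sumrB; apply: wlt_sum => j _.
have [p0|/hp pM] := eqVneq p`_i`_j 0.
  by rewrite p0 dm_sc0l rmorph0 !mul0r subrr; exact: wlt0.
have [_ h] := iter_estimate i j hC.
rewrite -mulrA -mulrBr; apply: wlt_scale; apply: wlt_leq h; lia.
Qed.

End Estimate.

(** * The module of operators over themselves and leading exponents *)

Section R1Module.
Variable F : diffField.
Local Notation R1 := {poly {poly F}}.

Definition const2 : {rmorphism F -> R1} := polyC \o polyC.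
Definition der2 (d : F -> F) : R1 -> R1 := map_poly (map_poly d).

Lemma der2_der (d : F -> F) : is_der d -> is_der (der2 d).
Proof. by move=> dP; do 2!apply: map_poly_der. Qed.

Lemma der2C (d : F -> F) : is_der d -> forall c, der2 d (const2 c) = const2 (d c).
Proof.
by move=> dP c; have mP := map_poly_der dP; rewrite /der2 /= (map_derC mP) (map_derC dP).
Qed.

Lemma der2_comm B : der2 (@dx F) (der2 (@dy F) B) = der2 (@dy F) (der2 (@dx F) B).
Proof.
rewrite /der2; apply: map_poly_derC; [by apply: map_poly_der | by apply: map_poly_der |].
by move=> {}B; apply: map_poly_derC => // ?; rewrite dx_dy_comm.
Qed.

Lemma der2X (d : F -> F) : is_der d -> der2 d 'X = 0.
Proof. by move=> dP; rewrite /der2 map_derX //; exact: map_poly_der. Qed.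

Lemma der2Y (d : F -> F) : is_der d -> der2 d 'X%:P = 0.
Proof.
by move=> dP; rewrite /der2 (map_derC (map_poly_der dP)) (map_derX dP).
Qed.

Section Twist.
Variables (x1 x2 : R1).
Hypothesis x12 : der2 (@dx F) x2 = der2 (@dy F) x1.

Definition r1module : dmodule F :=
  ring_module (der2_der (@is_der_df_x F)) (der2_der (@is_der_df_y F))
    (der2C (@is_der_df_x F)) (der2C (@is_der_df_y F)) der2_comm x12.

Definition ev1 (p : diffop F) : R1 :=
  \sum_(i < size p) \sum_(j < size p`_i) const2 p`_i`_j * (x1 ^+ i * x2 ^+ j).

Lemma x12_lift : der3 (@dx F) x2%:P = der3 (@dy F) x1%:P.
Proof.
rewrite /der3 (map_derC (der2_der (@is_der_df_x F))) (map_derC (der2_der (@is_der_df_y F))).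
by congr _%:P.
Qed.

(** Two-variable modules are the part of the three-variable ones that is constant in tau, which
    makes the weight estimate available for them. *)
Lemma act_lift p (C : R1) :
  (@act F r1module p C)%:P = @act F (tmodule x12_lift) p C%:P.
Proof.
apply: (@act_morph F r1module (tmodule x12_lift) polyC).
- exact: polyCD.
- by move=> c v; rewrite /= polyCM.
- move=> v; rewrite /= polyCD polyCM; congr (_ + _).
  by rewrite /der3 (map_derC (der2_der (@is_der_df_x F))).
move=> v; rewrite /= polyCD polyCM; congr (_ + _).
by rewrite /der3 (map_derC (der2_der (@is_der_df_y F))).
Qed.

Lemma tev_lift p : tev x1%:P x2%:P p = (ev1 p)%:P.
Proof.
rewrite /tev /ev1 rmorph_sum; apply: eq_bigr => i _.
rewrite rmorph_sum; apply: eq_bigr => j _.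
by rewrite /= !polyCM !polyC_exp.
Qed.

End Twist.

Lemma op_module_subproof : der2 (@dx F) 'X%:P = der2 (@dy F) 'X.
Proof. by rewrite der2X ?der2Y. Qed.

(** With coefficients on the left, multiplying an operator by d_x from the left differentiates its
    coefficients and adds a commutative multiplication by ['X]; d_y does the same with ['X%:P]. *)
Definition op_module : dmodule F := r1module op_module_subproof.

Lemma op_module_dx (p : op_module) : dm_x p = op_dx p.
Proof. by rewrite /op_dx mulrC. Qed.
Lemma op_module_dy (p : op_module) : dm_y p = op_dy p.
Proof. by rewrite /op_dy mulrC. Qed.
Lemma op_module_sc c (p : op_module) : dm_sc c p = op_scale c p.
Proof. by []. Qed.

Lemma opmulE (r p : diffop F) : opmul r p = @act F op_module r p.
Proof.
rewrite /opmul /act; apply: eq_bigr => i _; apply: eq_bigr => j _.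
rewrite op_module_sc; congr op_scale.
have -> : iter j (@dm_y F op_module) p = iter j (@op_dy F) p.
  by apply: eq_iter => q; exact: op_module_dy.
by apply: eq_iter => q; rewrite op_module_dx.
Qed.

Lemma ev1_id (p : diffop F) : ev1 'X 'X%:P p = p.
Proof.
rewrite /ev1 -[RHS]coefK poly_def; apply: eq_bigr => i _.
rewrite -mul_polyC -[in RHS](coefK p`_i) poly_def rmorph_sum mulr_suml.
apply: eq_bigr => j _.
by rewrite /= -mul_polyC polyCM polyC_exp; ring.
Qed.

Definition opmon (i j : nat) : diffop F := 'X%:P ^+ j * 'X^i.

Lemma opmonE i j : iter i (@op_dx F) (iter j (@op_dy F) 1) = opmon i j.
Proof.
rewrite /opmon; elim: i => [|i IH] /=; last first.
  rewrite IH /op_dx (derM (map_poly_der (map_poly_der (@is_der_df_x F)))).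
  rewrite (map_derXn (map_poly_der (@is_der_df_x F))) mulr0 addr0 -polyC_exp.
  rewrite (map_derC (map_poly_der (@is_der_df_x F))) (map_derXn (@is_der_df_x F)).
  by rewrite mul0r add0r -mulrA -exprSr.
rewrite mulr1; elim: j => [|j IH] //=; rewrite IH /op_dy -polyC_exp.
rewrite (map_derC (map_poly_der (@is_der_df_y F))) (map_derXn (@is_der_df_y F)).
by rewrite add0r -polyCM -exprSr polyC_exp.
Qed.

Lemma act_opmon (M : dmodule F) i j (v : M) :
  act (opmon i j) v = iter i (@dm_x F M) (iter j (@dm_y F M) v).
Proof. by rewrite -opmonE act_iter act1. Qed.

Lemma coef_opmon c i j i' j' :
  (op_scale c (opmon i j))`_i'`_j' = if (i' == i) && (j' == j) then c else 0.
Proof.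
rewrite /op_scale /opmon -polyC_exp !coefCM coefXn.
case: eqP => _; last by rewrite mulr0 coef0 mulr0.
by rewrite mulr1 coefXn; case: eqP; rewrite ?mulr1 ?mulr0.
Qed.

Lemma opmul_1r (p : diffop F) : opmul p 1 = p.
Proof.
rewrite -[RHS]ev1_id /opmul /ev1; apply: eq_bigr => i _; apply: eq_bigr => j _.
by rewrite opmonE /op_scale /opmon /= [in RHS]mulrC [in LHS]mulrC [_ * 'X^i]mulrC.
Qed.

(** The maximum of the weight is required to be strict, so that leading terms of products cannot
    cancel. *)
Definition topp (a b : nat) (p : diffop F) (i j : nat) : Prop :=
  p`_i`_j != 0 /\
  forall i' j', p`_i'`_j' != 0 -> (i', j') <> (i, j) -> (a * i' + b * j' < a * i + b * j)%N.

Lemma toppE a b p i j : topp a b p i j <->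
  p`_i`_j != 0 /\ wlt 0 a b (a * i + b * j) (p - op_scale p`_i`_j (opmon i j))%:P.
Proof.
split=> -[p0 hp]; split=> //.
  move=> [|e] i' j'; rewrite coefC /= ?coef0 ?eqxx // 2!coefB coef_opmon.
  case: ifP => [/andP[/eqP -> /eqP ->]|ne]; first by rewrite subrr eqxx.
  by rewrite subr0 mul0n => /hp; apply=> -[ei ej]; rewrite ei ej !eqxx in ne.
move=> i' j' p'0 ne; have := hp 0%N i' j'; rewrite mul0n add0n; apply.
rewrite coefC /= 2!coefB coef_opmon; case: ifP => [/andP[/eqP ei /eqP ej]|_].
  by rewrite ei ej in ne.
by rewrite subr0.
Qed.

(** By the weight estimate, [opmul S L] agrees in the top weight with the commutative product, where
    only the product of the two leading monomials survives. *)
Lemma topp_opmul a b (S L : diffop F) i1 j1 i2 j2 : (0 < a)%N -> (0 < b)%N ->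
  topp a b S i1 j1 -> topp a b L i2 j2 ->
  topp a b (opmul S L) (i1 + i2) (j1 + j2).
Proof.
move=> a0 b0 hS hL; have [S0 hS'] := (toppE _ _ _ _ _).1 hS.
have [L0 hL'] := (toppE _ _ _ _ _).1 hL.
set N := (a * i1 + b * j1)%N in hS'; set M := (a * i2 + b * j2)%N in hL'.
pose s := S`_i1`_j1; pose l := L`_i2`_j2.
have mw c i j : wlt 0 a b (a * i + b * j).+1 (op_scale c (opmon i j))%:P.
  move=> [|e] i' j'; rewrite coefC /= ?coef0 ?eqxx // coef_opmon.
  by case: ifP => [/andP[/eqP -> /eqP ->]|]; rewrite ?eqxx // mul0n.
have LM : wlt 0 a b M.+1 L%:P.
  rewrite -[L](subrK (op_scale l (opmon i2 j2))) polyCD.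
  by apply: wltD; [exact: wlt_leq hL' | exact: mw].
have est : wlt 0 a b (M + N) (opmul S L - S * L)%:P.
  have := @act_estimate F 0 a b _ _ (x12_lift op_module_subproof) a b
    (@wlt_X F 0 a b) (@wlt_Y F 0 a b) a0 b0 M N L%:P S LM.
  rewrite tev_lift ev1_id -act_lift -opmulE -polyCM -polyCB; apply.
  move=> i j p0; have [[-> ->]|/hS.2 h] := pselect ((i, j) = (i1, j1)).
    by rewrite /N; lia.
  by have := h p0; rewrite /N; lia.
have prod : S * L - op_scale (s * l) (opmon (i1 + i2) (j1 + j2)) =
    (S - op_scale s (opmon i1 j1)) * L + op_scale s (opmon i1 j1) * (L - op_scale l (opmon i2 j2)).
  rewrite /op_scale /opmon !exprD !polyCM; ring.
have tot : wlt 0 a b (M + N) (opmul S L - op_scale (s * l) (opmon (i1 + i2) (j1 + j2)))%:P.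
  rewrite -[opmul S L](subrK (S * L)) -addrA polyCD; apply: wltD; first exact: est.
  rewrite prod polyCD [X in _ + X]polyCM [X in X + _]polyCM addnC; apply: wltD.
    exact: wltMr hS' LM.
  exact: wltM (mw _ _ _) hL'.
have slE : (opmul S L)`_(i1 + i2)`_(j1 + j2) = s * l.
  have := @wlt_coef F 0 a b _ _ 0 (i1 + i2) (j1 + j2) tot.
  rewrite coefC /= 2!coefB coef_opmon !eqxx /= => h.
  by apply/eqP; rewrite -subr_eq0; apply/eqP; apply: h; rewrite /N /M; lia.
apply/toppE; rewrite slE mulf_neq0 //; split=> //.
by apply: wlt_leq tot; rewrite /N /M; lia.
Qed.

End R1Module.

(** * Change of commuting derivations *)

Section Transport.
Variables (F : diffField) (d e : F -> F) (dP : is_derivation d) (eP : is_derivation e).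
Hypothesis de : forall a, d (e a) = e (d a).
Variables (al be ga ep : F).
Hypotheses (dxE : forall a, dx a = al * d a + be * e a) (dyE : forall a, dy a = ga * d a + ep * e a).
Hypotheses (hX : dx ga = dy al) (hY : dx ep = dy be).

Definition cf : diffField := @DiffField F d e (@df_pchar0 F) dP eP de.

Definition tr_x : {poly {poly F}} := const2 F al * 'X + const2 F be * 'X%:P.
Definition tr_y : {poly {poly F}} := const2 F ga * 'X + const2 F ep * 'X%:P.

Lemma trans_subproof : der2 (@dx F) tr_y = der2 (@dy F) tr_x.
Proof.
have xP := der2_der (@is_der_df_x F); have yP := der2_der (@is_der_df_y F).
rewrite /tr_y /tr_x !(derD xP) !(derD yP) !(derM xP) !(derM yP).
rewrite !(der2C (@is_der_df_x F)) !(der2C (@is_der_df_y F)).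
rewrite !(der2X (@is_der_df_x F)) !(der2X (@is_der_df_y F)).
by rewrite !(der2Y (@is_der_df_x F)) !(der2Y (@is_der_df_y F)) hX hY !mulr0.
Qed.

Lemma tr_dx (B : {poly {poly F}}) : der2 (@dx F) B + tr_x * B =
    op_scale (al : cf) (op_dx (B : diffop cf)) + op_scale (be : cf) (op_dy (B : diffop cf)).
Proof.
rewrite /op_scale /op_dx /op_dy /= -/(der2 d B) -/(der2 e B).
have -> : der2 (@dx F) B = const2 F al * der2 d B + const2 F be * der2 e B.
  apply/polyP => i; apply/polyP => j; rewrite /= !(coefD, coefCM).
  rewrite /der2 (coef_map_der (map_poly_der (@is_der_df_x F))) (coef_map_der (@is_der_df_x F)).
  by rewrite !(coef_map_der (map_poly_der dP)) !(coef_map_der (map_poly_der eP)) (coef_map_der dP) (coef_map_der eP).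
by rewrite /tr_x /=; ring.
Qed.

Lemma tr_dy (B : {poly {poly F}}) : der2 (@dy F) B + tr_y * B =
    op_scale (ga : cf) (op_dx (B : diffop cf)) + op_scale (ep : cf) (op_dy (B : diffop cf)).
Proof.
rewrite /op_scale /op_dx /op_dy /= -/(der2 d B) -/(der2 e B).
have -> : der2 (@dy F) B = const2 F ga * der2 d B + const2 F ep * der2 e B.
  apply/polyP => i; apply/polyP => j; rewrite /= !(coefD, coefCM).
  rewrite /der2 (coef_map_der (map_poly_der (@is_der_df_y F))) (coef_map_der (@is_der_df_y F)).
  by rewrite !(coef_map_der (map_poly_der dP)) !(coef_map_der (map_poly_der eP)) (coef_map_der dP) (coef_map_der eP).
by rewrite /tr_y /=; ring.
Qed.

(** Substituting combinations of [d] and [e] for d_x and d_y amounts to acting on 1 in the ring of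
    operators in [d] and [e], as [tr_dx] and [tr_dy] show; [hX] and [hY] express that the two
    combinations commute. *)
Definition trans (p : diffop F) : diffop cf := @act F (r1module trans_subproof) p 1.

Lemma trans_act (M : dmodule F) (M' : dmodule cf) (h : M' -> M) p w :
    (forall u v, h (u + v) = h u + h v) ->
    (forall c v, h (dm_sc c v) = dm_sc (c : F) (h v)) ->
    (forall v, dm_x (h v) = h (dm_sc (al : cf) (dm_x v) + dm_sc (be : cf) (dm_y v))) ->
    (forall v, dm_y (h v) = h (dm_sc (ga : cf) (dm_x v) + dm_sc (ep : cf) (dm_y v))) ->
  @act F M p (h w) = h (@act cf M' (trans p) w).
Proof.
move=> hD hsc hx hy.
have := @act_morph F (r1module trans_subproof) M (fun B => h (@act cf M' B w)) p 1.
rewrite /= (@act1 cf M') => <- //.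
- by move=> u v; rewrite -hD -actDl.
- by move=> c v; rewrite -hsc -(@act_scale cf M').
- by move=> v; rewrite tr_dx (@actDl cf) !(@act_scale cf) act_dx act_dy hx.
by move=> v; rewrite tr_dy (@actDl cf) !(@act_scale cf) act_dx act_dy hy.
Qed.

Lemma transD p q : trans (p + q) = trans p + trans q.
Proof. exact: (@actDl F (r1module trans_subproof)). Qed.
Lemma trans0 : trans 0 = 0.
Proof. exact: (@act0l F (r1module trans_subproof)). Qed.
Lemma transB p q : trans (p - q) = trans p - trans q.
Proof. exact: (@actBl F (r1module trans_subproof)). Qed.
Lemma trans_scale c p : trans (op_scale c p) = op_scale (c : cf) (trans p).
Proof. exact: (@act_scale F (r1module trans_subproof)). Qed.

Lemma trans_op_dx p :
  trans (op_dx p) = op_scale (al : cf) (op_dx (trans p)) + op_scale (be : cf) (op_dy (trans p)).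
Proof. by rewrite /trans act_dx; exact: tr_dx. Qed.

Lemma trans_op_dy p :
  trans (op_dy p) = op_scale (ga : cf) (op_dx (trans p)) + op_scale (ep : cf) (op_dy (trans p)).
Proof. by rewrite /trans act_dy; exact: tr_dy. Qed.

Lemma trans_opmul r p : trans (opmul r p) = opmul (trans r) (trans p).
Proof.
rewrite {1}/trans act_opmul (@opmulE cf).
apply: (@trans_act (r1module trans_subproof) (op_module cf) id) => // v.
  by rewrite !op_module_dx !op_module_dy; exact: tr_dx.
by rewrite !op_module_dx !op_module_dy; exact: tr_dy.
Qed.

End Transport.

(** * Fractional-derivatives series *)

Section Series.
Variables (F : diffField) (m : nat) (s : m.-tuple rat) (f : m.+1.-tuple F).
Implicit Types (H K : rat -> F) (t : rat).

Local Notation ex j := (tnth [tuple of 1 :: s] j).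

Lemma series_derivD d H K : is_der d ->
  series_deriv s f d (H + K) = series_deriv s f d H + series_deriv s f d K.
Proof.
move=> dP; apply/funext => t; rewrite -[RHS]/(series_deriv s f d H t + series_deriv s f d K t).
rewrite /series_deriv -[(H + K) t]/(H t + K t) (derD dP) addrACA; congr (_ + _).
by rewrite -big_split; apply: eq_bigr => j _; rewrite /= -mulrDr.
Qed.

Lemma series_deriv_sc d c H : is_der d ->
  series_deriv s f d (fun t => c * H t) =
  (fun t => d c * H t) + (fun t => c * series_deriv s f d H t).
Proof.
move=> dP; apply/funext => t; rewrite -[RHS]/(d c * H t + c * series_deriv s f d H t).
rewrite /series_deriv (derM dP) [in RHS]mulrDr mulr_sumr addrA; congr (_ + _).
by apply: eq_bigr => j _; rewrite mulrCA.
Qed.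

Lemma series_derivC d e H : is_der d -> is_der e -> (forall a, d (e a) = e (d a)) ->
  series_deriv s f d (series_deriv s f e H) = series_deriv s f e (series_deriv s f d H).
Proof.
move=> dP eP dec; apply/funext => t.
have expand (u v : F -> F) : is_der u -> series_deriv s f u (series_deriv s f v H) t =
    u (v (H t)) + \sum_(j < m.+1) u (v (tnth f j)) * H (t - ex j) +
    (\sum_(j < m.+1) v (tnth f j) * u (H (t - ex j)) +
     \sum_(j < m.+1) u (tnth f j) * v (H (t - ex j))) +
    \sum_(i < m.+1) \sum_(j < m.+1) u (tnth f i) * (v (tnth f j) * H (t - ex i - ex j)).
  move=> uP; rewrite /series_deriv (derD uP) (der_sum uP).
  under eq_bigr => j _ do rewrite (derM uP).
  under [X in _ + X = _]eq_bigr => j _ do rewrite mulrDr mulr_sumr.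
  by rewrite !big_split /= !addrA.
rewrite !expand // dec; congr (_ + _ + _ + _).
- by apply: eq_bigr => j _; rewrite dec.
- by rewrite addrC.
rewrite exchange_big; apply: eq_bigr => i _; apply: eq_bigr => j _.
by rewrite mulrCA addrAC.
Qed.

Definition ser_module : dmodule F.
Proof.
refine (@Dmodule F (rat -> F) (fun c H t => c * H t) (series_deriv s f (@dx F))
  (series_deriv s f (@dy F)) _ _ _ _ _ _ _ _ _).
- by move=> a b w; apply/funext => t; rewrite /= mulrDl.
- by move=> a v w; apply/funext => t; rewrite /= mulrDr.
- by move=> a b w; apply/funext => t; rewrite mulrA.
- by move=> w; apply/funext => t; rewrite mul1r.
- by move=> v w; exact: series_derivD.
- by move=> v w; exact: series_derivD.
- by move=> a w; exact: series_deriv_sc.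
- by move=> a w; exact: series_deriv_sc.
by move=> w; apply: series_derivC => //; exact: dx_dy_comm.
Defined.

Lemma op_applyE p H : op_apply s f p H = @act F ser_module p H.
Proof.
apply/funext => t; rewrite /op_apply /act fct_sumE; apply: eq_bigr => i _.
by rewrite fct_sumE; apply: eq_bigr => j _.
Qed.

(** Together with [onlat] this describes [V_G] (see [V_GP]). The two conditions are kept apart
    because operators preserve the lattice of exponents but move the bound. *)
Definition bnd t H := forall t', t < t' -> H t' = 0.
Definition onlat (t0 : rat) H :=
  forall t, H t != 0 -> (t - t0) * (G_denominator s)%:R \is a Num.int.

Lemma bnd0 t : bnd t 0. Proof. by []. Qed.
Lemma bndD t H K : bnd t H -> bnd t K -> bnd t (H + K).
Proof. by move=> hH hK t' lt; rewrite -[LHS]/(H t' + K t') hH // hK // addr0. Qed.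
Lemma bnd_sc t c H : bnd t H -> bnd t (fun t => c * H t).
Proof. by move=> hH t' lt; rewrite hH // mulr0. Qed.
Lemma bnd_leq t u H : t <= u -> bnd t H -> bnd u H.
Proof. by move=> tu hH t' lt; apply: hH; exact: le_lt_trans lt. Qed.
Lemma onlat0 t : onlat t 0. Proof. by move=> u /eqP. Qed.
Lemma onlatD t H K : onlat t H -> onlat t K -> onlat t (H + K).
Proof.
move=> hH hK u; rewrite -[_ u]/(H u + K u) => h.
have [/hH //|/negPn/eqP H0] := boolP (H u != 0).
by apply: hK; rewrite H0 add0r in h.
Qed.
Lemma onlat_sc t c H : onlat t H -> onlat t (fun t => c * H t).
Proof. by move=> hH u; rewrite mulf_eq0 negb_or => /andP[_ /hH]. Qed.

Lemma G_denominator_gt0 : (0 < G_denominator s)%N.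
Proof.
rewrite /G_denominator; elim/big_ind: _ => // [a b a0 b0|i _].
  by rewrite lcmn_gt0 a0.
by rewrite absz_gt0 denq_neq0.
Qed.

Local Notation q := ((G_denominator s)%:R : rat).

Lemma q_gt0 : 0 < q. Proof. by rewrite ltr0n G_denominator_gt0. Qed.

Lemma exponent_int a : a \in (s : seq rat) -> a * q \is a Num.int.
Proof.
move=> sa; have : (`|denq a| %| G_denominator s)%N.
  rewrite /G_denominator; elim: (s : seq rat) sa => //= b r IH.
  rewrite inE big_cons => /orP[/eqP ->|/IH h]; first exact: dvdn_lcml.
  exact: dvdn_trans h (dvdn_lcmr _ _).
case/dvdnP => k ->; rewrite natrM mulrCA mulrC.
rewrite (_ : `|denq a|%N%:R = (denq a)%:~R); last by rewrite -absz_denq.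
by rewrite -numqE rpredM // ?intr_int // rpred_nat.
Qed.

Lemma ex_int j : ex j * q \is a Num.int.
Proof.
have := mem_tnth j [tuple of 1 :: s]; rewrite inE => /orP[/eqP ->|/exponent_int //].
by rewrite mul1r rpred_nat.
Qed.

Lemma onlat_deriv d t0 H : is_der d -> onlat t0 H -> onlat t0 (series_deriv s f d H).
Proof.
move=> dP hH t; rewrite /series_deriv => h.
have [/hH //|/negPn/eqP H0] := boolP (H t != 0).
move: h; rewrite H0 (der0 dP) add0r.
case: (boolP [exists j, H (t - ex j) != 0]) => [/existsP[j /hH]|/existsPn h].
  move=> hj _.
  have -> : (t - t0) * q = (t - ex j - t0) * q + ex j * q by rewrite -mulrDl; congr (_ * _); ring.
  exact: rpredD hj (ex_int j).
rewrite big1 ?eqxx // => j _; have /negPn/eqP -> := h j; exact: mulr0.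
Qed.

Lemma onlat_act p t0 H : onlat t0 H -> onlat t0 (@act F ser_module p H).
Proof.
move=> hH; apply: (@act_closed F ser_module (onlat t0)) => //.
- exact: onlat0.
- exact: onlatD.
- by move=> a v; exact: onlat_sc.
- by move=> v; apply: onlat_deriv.
by move=> v; apply: onlat_deriv.
Qed.

Lemma onlat_shift t0 t1 H : (t1 - t0) * q \is a Num.int -> onlat t0 H -> onlat t1 H.
Proof.
move=> h hH t /hH ht.
have -> : (t - t1) * q = (t - t0) * q - (t1 - t0) * q by rewrite -mulrBl; congr (_ * _); ring.
exact: rpredB.
Qed.

Lemma V_GP H : V_G s H <-> exists t0, [/\ t0 * q \is a Num.int, onlat t0 H & bnd t0 H].
Proof.
split=> [[t0 t0q hH]|[t0 [t0q hH hb]]].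
  exists t0; split=> //.
    by move=> t /hH[i ->]; rewrite addrAC subrr add0r mulNr divfK ?gt_eqF ?q_gt0 // rpredN rpred_nat.
  move=> t lt; apply/eqP; apply: contraTT lt => /hH[i ->]; rewrite -leNgt.
  by rewrite gerBl divr_ge0 // ler0n.
exists t0 => // t Ht.
have : (t0 - t) * q \is a Num.nat.
  rewrite natrEint; apply/andP; split; first by rewrite -opprB mulNr rpredN; exact: hH.
  apply: mulr_ge0; last exact: ler0n.
  by rewrite subr_ge0 leNgt; apply: contra Ht => /hb ->.
case/natrP => i iE; exists i; rewrite -iE mulfK ?gt_eqF ?q_gt0 //.
by rewrite opprB addrC subrK.
Qed.

Section Solve.
Variables (Phi : (rat -> F) -> rat -> F) (eps : rat) (B : F -> F).
Hypotheses (PhiB : forall H K, Phi (H - K) = Phi H - Phi K)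
  (Phi_lat : forall t0 H, onlat t0 H -> onlat t0 (Phi H))
  (eps_int : eps * q \is a Num.int)
  (Phi_lead : forall t H, bnd t H -> Phi H (t + eps) = B (H t) /\ bnd (t + eps) (Phi H))
  (B_surj : forall y, exists x, B x = y).

(** Numbering exponents downwards in steps of [1 / q] makes [Phi] triangular with diagonal [B], by
    [Phi_lead]. *)
Lemma series_solve t0 K : onlat t0 K -> bnd t0 K ->
  exists H, [/\ onlat (t0 - eps) H, bnd (t0 - eps) H & Phi H = K].
Proof.
move=> latK bK; have q0 := q_gt0; have qn0 : q != 0 by rewrite gt_eqF.
pose idx t := (t0 - eps - t) * q.
pose emb (h : nat -> F) t := if idx t \is a Num.nat then h (Num.Def.trunc (idx t)) else 0.
have embE h i : emb h (t0 - eps - i%:R / q) = h i.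
  by rewrite /emb /idx opprB addrCA subrr addr0 divfK // rpred_nat natrK.
have emb_lat h : onlat (t0 - eps) (emb h).
  move=> t; rewrite /emb /idx; case: ifP; rewrite ?eqxx // => hn _.
  by rewrite -opprB mulNr rpredN; move: hn; rewrite natrEint => /andP[].
have emb_bnd h i : (forall j, (j < i)%N -> h j = 0) -> bnd (t0 - eps - i%:R / q) (emb h).
  move=> h0 t lt; rewrite /emb; case: ifP => // /natrP[n nE].
  rewrite nE natrK h0 // -(ltr_nat rat) -nE /idx -ltr_pdivlMr //; lra.
have [||h hE] := @triangular_surj F (fun h i => Phi (emb h) (t0 - i%:R / q)) (fun _ => B) _ _ (fun _ => B_surj)
  (fun i => K (t0 - i%:R / q)).
- move=> h h' i; rewrite -[RHS]/((Phi (emb h) - Phi (emb h')) _) -PhiB; congr (Phi _ _).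
  apply/funext => t; rewrite -[RHS]/(emb h t - emb h' t) /emb; case: ifP => // _.
  by rewrite subrr.
- move=> i h h0; have [+ _] := Phi_lead (emb_bnd _ _ h0).
  by rewrite embE => <-; congr (Phi _ _); lra.
exists (emb h); have hb : bnd (t0 - eps) (emb h).
  by have := @emb_bnd h 0%N; rewrite mul0r subr0; apply.
split=> //; apply/funext => t.
(* The triangular system settles the exponents [t0 - i%:R / q]; at every other exponent both sides
   vanish, by the lattice and the bound. *)
have [+|nt] := boolP ((t0 - t) * q \is a Num.nat).
  by case/natrP => i iE; have := hE i; rewrite -iE mulfK // opprB addrC subrK.
have zero H : onlat t0 H -> bnd t0 H -> H t = 0.
  move=> hl hbd; apply/eqP; apply: contraNT nt => Ht.
  rewrite natrEint; apply/andP; split; first by rewrite -opprB mulNr rpredN; exact: hl.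
  apply: mulr_ge0; last exact: ler0n.
  by rewrite subr_ge0 leNgt; apply: contra Ht => /hbd ->.
rewrite !zero //; first by apply: Phi_lat; apply: onlat_shift (emb_lat h); rewrite opprB addrC subrK.
by have [_] := Phi_lead hb; rewrite subrK.
Qed.

Lemma series_solve_V K : V_G s K -> exists2 H, V_G s H & Phi H = K.
Proof.
move=> /V_GP[t0 [t0q latK bK]]; have [H [latH bH HE]] := series_solve latK bK.
by exists H => //; apply/V_GP; exists (t0 - eps); split=> //; rewrite mulrBl rpredB.
Qed.

(** The series with the single coefficient [x] at 0 has an image starting at least one lattice step
    below [eps], because [B x = 0]. That image is also reached from a series with negative
    exponents, and the difference of the two is the solution. *)
Lemma series_kernel x : x != 0 -> B x = 0 ->
  exists H, [/\ V_G s H, Phi H = 0 & exists t, H t != 0].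
Proof.
move=> x0 Bx; have q0 := q_gt0; have qn0 : q != 0 by rewrite gt_eqF.
pose H0 t := if t == 0 then x else 0.
have H0lat : onlat 0 H0.
  by move=> t; rewrite /H0; case: (t =P 0) => [->|_]; rewrite ?eqxx // subrr mul0r rpred0.
have H0b : bnd 0 H0 by move=> t t_gt0; rewrite /H0 gt_eqF.
have [lead hb] := Phi_lead H0b; rewrite add0r in lead hb.
have Klat : onlat (eps - 1 / q) (Phi H0).
  apply: (@onlat_shift 0); last exact: Phi_lat.
  by rewrite subr0 mulrBl divfK // rpredB // rpred1.
have Kb : bnd (eps - 1 / q) (Phi H0).
  move=> t lt; have [lte|] := ltrP eps t; first exact: hb.
  rewrite le_eqVlt => /orP[/eqP ->|lt_te]; first by rewrite lead /H0 eqxx.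
  (* No lattice point lies strictly between [eps - 1 / q] and [eps]. *)
  apply/eqP; apply: contraT => /Klat h; exfalso.
  have : 0 < (t - (eps - 1 / q)) * q < 1.
    rewrite mulr_gt0 ?subr_gt0 //= -ltr_pdivlMr //; lra.
  case/intrP: h => z ->; rewrite ltr0z ltrz1; lia.
have [H [latH bH HE]] := series_solve Klat Kb.
have e : eps - 1 / q - eps = - (1 / q) by lra.
rewrite e in latH bH; exists (H0 - H); split.
- apply/V_GP; exists 0; rewrite mul0r rpred0; split=> //.
    rewrite -[- H]/((fun t => - H t)); apply: onlatD => // t; rewrite oppr_eq0 => Ht.
    have := latH _ Ht; rewrite opprK mulrDl divfK // subr0 => h.
    by rewrite -(addrK 1 (t * q)) rpredB // rpred1.
  apply: bndD => // t t0; rewrite -[LHS]/(- H t) bH ?oppr0 //.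
  by apply: lt_trans t0; rewrite oppr_lt0 divr_gt0.
- by rewrite PhiB HE subrr.
exists 0; rewrite -[(H0 - H) 0]/(H0 0 - H 0) bH ?subr0 ?/H0 ?eqxx //.
by rewrite oppr_lt0 divr_gt0.
Qed.

End Solve.

End Series.

(** * Bijectivity of non-zero operators in d_y on series *)

Section PolyY.
Variables (F : diffField) (m : nat) (s : m.-tuple rat) (f : m.+1.-tuple F).
Hypothesis s_lt1 : forall a, a \in (s : seq rat) -> a < 1.
Local Notation M := (ser_module s f).
Local Notation v := (dy (tnth f ord0)).
Hypothesis v0 : v != 0.

(** The exponents after the first are below 1 and differentiation of coefficients shifts nothing, so
    only f_1 reaches [t + 1]. *)
Lemma series_deriv_lead d t H : is_der d -> bnd t H ->
  series_deriv s f d H (t + 1) = d (tnth f ord0) * H t /\ bnd (t + 1) (series_deriv s f d H).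
Proof.
move=> dP bH.
have other (j : 'I_m) t' : t + 1 <= t' -> H (t' - tnth [tuple of 1 :: s] (lift ord0 j)) = 0.
  move=> le; apply: bH; rewrite tnthS; have := s_lt1 (mem_tnth j s); lra.
have val t' : t + 1 <= t' -> series_deriv s f d H t' = d (tnth f ord0) * H (t' - 1).
  move=> le; rewrite /series_deriv bH ?(der0 dP) ?add0r; last by lra.
  by rewrite big_ord_recl tnth0 big1 ?addr0 // => j _; rewrite other ?mulr0.
split; first by rewrite val // addrK.
by move=> t' lt; rewrite val ?bH ?mulr0 //; lra.
Qed.

Lemma iter_dy_lead j t (H : M) : bnd t H ->
  iter j (@dm_y F M) H (t + j%:R) = v ^+ j * H t /\ bnd (t + j%:R) (iter j (@dm_y F M) H).
Proof.
move=> bH; elim: j => [|j [IH1 IH2]]; first by rewrite addr0 expr0 mul1r.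
have [h1 h2] := series_deriv_lead (@is_der_df_y F) IH2.
by rewrite iterS -natr1 addrA; split=> //; rewrite [LHS]h1 IH1 mulrA exprS.
Qed.

Lemma act_polyY (N : dmodule F) (b : {poly F}) (w : N) :
  act (b%:P : diffop F) w = \sum_(j < size b) dm_sc b`_j (iter j (@dm_y F N) w).
Proof.
rewrite (@act_box F N _ w 1 (size b)).
- by rewrite big_ord1 coefC.
- by rewrite size_polyC; case: eqP.
rewrite /ysize; apply/bigmax_leqP => i _.
by rewrite coefC; case: ifP => //; rewrite size_poly0.
Qed.

Lemma polyY_lead (b : {poly F}) t (H : M) : b != 0 -> bnd t H ->
  let n := (size b).-1 in
  act (b%:P : diffop F) H (t + n%:R) = lead_coef b * v ^+ n * H t /\
  bnd (t + n%:R) (act (b%:P : diffop F) H).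
Proof.
move=> b0 bH /=; rewrite act_polyY; have sb : size b = (size b).-1.+1.
  by rewrite prednK // size_poly_gt0.
have le (j : 'I_(size b)) : (j%:R : rat) <= (size b).-1%:R.
  by rewrite ler_nat -ltnS -sb.
split.
  rewrite fct_sumE sb big_ord_recr /= big1 ?add0r.
    by have [-> _] := iter_dy_lead (size b).-1 bH; rewrite mulrA.
  move=> j _; have [_ ->] := iter_dy_lead j bH; rewrite ?mulr0 //.
  by rewrite ltrD2l ltr_nat.
move=> t' lt; rewrite fct_sumE big1 // => j _ /=.
by have [_ ->] := iter_dy_lead j bH; rewrite ?mulr0 //; have := le j; lra.
Qed.

(** A non-zero series of [V_G] has a largest exponent, and its coefficient there is multiplied by
    the non-zero [lead_coef b * v ^+ (size b).-1]. *)
Lemma polyY_inj (b : {poly F}) (H : M) : b != 0 -> V_G s H ->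
  act (b%:P : diffop F) H = 0 -> H = 0.
Proof.
move=> b0 VH bH0; apply/funext => t1; apply/eqP; apply/negPn/negP => Ht1.
case: VH => t0 _ hH.
have ex : exists i, H (t0 - i%:R / (G_denominator s)%:R) != 0.
  by have [i iE] := hH _ Ht1; exists i; rewrite -iE.
case: (ex_minnP ex) => i Hi imin; pose t := t0 - i%:R / (G_denominator s)%:R.
have bH : bnd t H.
  move=> t' lt; apply/eqP; apply/negPn/negP => Ht'; have [k kE] := hH _ Ht'.
  have : (i <= k)%N by apply: imin; rewrite -kE.
  move: lt; rewrite /t kE ltrD2l ltrN2 ltr_pM2r ?invr_gt0 ?q_gt0 // ltr_nat; lia.
have [] := polyY_lead b0 bH; rewrite bH0 => /esym/eqP + _.
by rewrite !mulf_eq0 lead_coef_eq0 (negbTE b0) expf_eq0 (negbTE v0) andbF (negbTE Hi).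
Qed.

Lemma polyY_surj (b : {poly F}) (K : M) : b != 0 -> V_G s K ->
  exists2 H : M, V_G s H & act (b%:P : diffop F) H = K.
Proof.
move=> b0; apply: (@series_solve_V F m s _ (size b).-1%:R (fun x => lead_coef b * v ^+ (size b).-1 * x)).
- by move=> H H'; rewrite actDr actNr.
- by move=> t0 H; exact: onlat_act.
- by rewrite -natrM rpred_nat.
- by move=> t H bH; exact: polyY_lead.
have c0 : lead_coef b * v ^+ (size b).-1 != 0.
  by rewrite mulf_neq0 ?lead_coef_eq0 ?expf_neq0.
by move=> y; exists ((lead_coef b * v ^+ (size b).-1)^-1 * y); rewrite mulVKf.
Qed.

End PolyY.

Lemma G_exponents_lt1 m (s : m.-tuple rat) : G_exponents s ->
  forall a, a \in (s : seq rat) -> a < 1.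
Proof.
move=> hs a sa; have tr : transitive (fun a b : rat => b < a).
  by move=> y x z yx zy; exact: lt_trans zy yx.
have /allP h := order_path_min tr hs.
by apply: h; rewrite mem_rcons inE sa orbT.
Qed.

Section VGClosed.
Variables (F : diffField) (m : nat) (s : m.-tuple rat) (f : m.+1.-tuple F).
Local Notation M := (ser_module s f).

Lemma V_G0 : V_G s (0 : M).
Proof. by apply/V_GP; exists 0; rewrite mul0r rpred0; split=> //; exact: onlat0. Qed.

Lemma bnd_addmax (H K : M) t u : bnd t H -> bnd u K -> bnd (Num.max t u) (H + K).
Proof.
move=> hH hK; apply: bndD; apply: bnd_leq; try eassumption; by rewrite le_max lexx ?orbT.
Qed.

Lemma V_GD (H K : M) : V_G s H -> V_G s K -> V_G s (H + K).
Proof.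
move=> /V_GP[t [tq lH bH]] /V_GP[u [uq lK bK]]; apply/V_GP.
exists (Num.max t u); split; first by case: leP.
  apply: onlatD; [apply: onlat_shift lH | apply: onlat_shift lK];
  by rewrite mulrBl rpredB //; case: leP.
exact: bnd_addmax.
Qed.

Lemma V_G_act p (H : M) : (forall a, a \in (s : seq rat) -> a < 1) ->
  V_G s H -> V_G s (act p H).
Proof.
move=> s1 /V_GP[t [tq lH bH]].
have [n bn] : exists n : nat, bnd (t + n%:R) (act p H).
  apply: (@act_closed F M (fun K => exists n : nat, bnd (t + n%:R) K)).
  - by exists 0%N; exact: bnd0.
  - move=> K L [n bK] [k bL]; exists (maxn n k); apply: bndD.
      by apply: bnd_leq bK; rewrite lerD2l ler_nat leq_maxl.
    by apply: bnd_leq bL; rewrite lerD2l ler_nat leq_maxr.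
  - by move=> a K [n bK]; exists n; exact: bnd_sc.
  - move=> K [n bK]; exists n.+1; rewrite -natr1 addrA.
    by have [] := series_deriv_lead f s1 (@is_der_df_x F) bK.
  - move=> K [n bK]; exists n.+1; rewrite -natr1 addrA.
    by have [] := series_deriv_lead f s1 (@is_der_df_y F) bK.
  by exists 0%N; rewrite addr0.
apply/V_GP; exists (t + n%:R); split=> //.
  by rewrite mulrDl rpredD // -natrM rpred_nat.
apply: (@onlat_shift _ _ _ t); last exact: onlat_act.
by rewrite addrC addKr -natrM rpred_nat.
Qed.

End VGClosed.

(** * Conjugation by a phase *)

Lemma additive0 (U W : zmodType) (h : U -> W) : (forall u v, h (u + v) = h u + h v) -> h 0 = 0.
Proof. by move=> hD; apply: (addrI (h 0)); rewrite -hD !addr0. Qed.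

Lemma iter_swap (U : Type) (h T : U -> U) (k : nat) (u : U) :
  (forall v, h (T v) = T (h v)) -> iter k T (h u) = h (iter k T u).
Proof. by move=> hT; elim: k => //= k ->. Qed.

Section Ext.
Variables (F : fieldType) (V : zmodType) (T : V -> V) (phi : {poly {poly F}} -> V) (psi : F -> V -> V).
Hypotheses (TD : forall u v, T (u + v) = T u + T v)
  (phiD : forall p q, phi (p + q) = phi p + phi q)
  (psiD : forall c u v, psi c (u + v) = psi c u + psi c v)
  (psiT : forall c u, psi c (T u) = T (psi c u))
  (phi_psi : forall c p, phi (c%:P%:P * p) = psi c (phi p)).
Local Notation R2 := {poly {poly {poly F}}}.

(** The extension of [phi] to polynomials in tau, with tau acting as [T]. In one use [T] is
    multiplication by tau, in the other a shift of the exponents of a series. *)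
Definition ext (B : R2) : V := \sum_(e < size B) iter e T (phi B`_e).

Lemma iterTD k u v : iter k T (u + v) = iter k T u + iter k T v.
Proof. by elim: k => //= k ->. Qed.

Lemma ext_box k (B : R2) : (size B <= k)%N -> ext B = \sum_(e < k) iter e T (phi B`_e).
Proof.
move=> le; rewrite /ext (big_ord_widen k (fun e => iter e T (phi B`_e)) le) big_mkcond.
apply: eq_bigr => e _; case: ltnP => // h.
by rewrite nth_default // (additive0 phiD) (additive0 (iterTD e)).
Qed.

Lemma extD (B C : R2) : ext (B + C) = ext B + ext C.
Proof.
pose k := maxn (size (B + C)%R) (maxn (size B) (size C)).
rewrite !(@ext_box k) ?leq_max ?leqnn ?orbT //.
by rewrite -big_split; apply: eq_bigr => e _; rewrite coefD phiD iterTD.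
Qed.

Lemma ext_sum (I : Type) (r : seq I) (G : I -> R2) :
  ext (\sum_(i <- r) G i) = \sum_(i <- r) ext (G i).
Proof. exact: (big_morph ext extD (additive0 extD)). Qed.

Lemma extX (B : R2) : ext ('X * B) = T (ext B).
Proof.
rewrite (@ext_box (size B).+1); last first.
  apply: leq_trans (size_polyMleq _ _) _; rewrite size_polyX; lia.
rewrite big_ord_recl coefXM /= (additive0 phiD) add0r.
rewrite /ext (big_morph T TD (additive0 TD)); apply: eq_bigr => e _.
by rewrite coefXM.
Qed.

Lemma extXn n (B : R2) : ext ('X^n * B) = iter n T (ext B).
Proof.
elim: n => [|n IH] /=; first by rewrite expr0 mul1r.
by rewrite exprS -mulrA extX IH.
Qed.

Lemma ext_scale c (B : R2) : ext (c%:P%:P%:P * B) = psi c (ext B).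
Proof.
have psi0 : psi c 0 = 0 by apply: additive0; exact: psiD.
rewrite (@ext_box (size B)).
  rewrite /ext (big_morph (psi c) (psiD c) psi0); apply: eq_bigr => e _.
  by rewrite coefCM phi_psi; exact: iter_swap.
have [->|c0] := eqVneq c 0; first by rewrite !rmorph0 mul0r size_poly0.
by rewrite mul_polyC size_scale // !polyC_eq0.
Qed.

Lemma ext_comm (D1 : {poly {poly F}} -> {poly {poly F}}) (xi : V -> V) (B : R2) :
    (forall p q, D1 (p + q) = D1 p + D1 q) ->
    (forall u v, xi (u + v) = xi u + xi v) -> (forall u, xi (T u) = T (xi u)) ->
    (forall p, phi (D1 p) = xi (phi p)) ->
  ext (map_poly D1 B) = xi (ext B).
Proof.
move=> D1D xiD xiT phixi.
rewrite (@ext_box (size B)) ?size_poly //.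
rewrite /ext (big_morph xi xiD (additive0 xiD)); apply: eq_bigr => e _.
rewrite coef_map_id0; last exact: additive0.
by rewrite phixi; exact: iter_swap.
Qed.

Lemma extC p : ext p%:P = phi p.
Proof.
rewrite (@ext_box 1) ?big_ord1 ?coefC //.
by rewrite size_polyC; case: eqP.
Qed.

End Ext.

Section Phase.
Variable F : diffField.
Local Notation R1 := {poly {poly F}}.
Local Notation R2 := {poly {poly {poly F}}}.
Implicit Types (g : seq (nat * F)).

Definition phase (d : F -> F) g : R2 := \sum_(x <- g) const3 F (d x.2) * 'X^(x.1).

Lemma der3_phase (d e : F -> F) g : is_der d ->
  der3 d (phase e g) = phase (d \o e) g.
Proof.
move=> dP; rewrite /phase (der_sum (der3_der dP)); apply: eq_bigr => x _.
by rewrite (derM (der3_der dP)) (der3C dP) /der3 (map_derXn (der2_der dP)) mulr0 addr0.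
Qed.

Lemma der3X (d : F -> F) : is_der d -> der3 d 'X%:P = 0.
Proof.
move=> dP; rewrite /der3 (map_derC (der2_der dP)).
by rewrite -/(der2 d _) der2X.
Qed.

Lemma der3Y (d : F -> F) : is_der d -> der3 d 'X%:P%:P = 0.
Proof.
move=> dP; rewrite /der3 (map_derC (der2_der dP)).
by rewrite -/(der2 d _) der2Y.
Qed.

Lemma der3_XD (d : F -> F) B : is_der d -> der3 d ('X%:P + B) = der3 d B.
Proof. by move=> dP; rewrite (derD (der3_der dP)) (der3X dP) add0r. Qed.

Lemma der3_YD (d : F -> F) B : is_der d -> der3 d ('X%:P%:P + B) = der3 d B.
Proof. by move=> dP; rewrite (derD (der3_der dP)) (der3Y dP) add0r. Qed.

Lemma phase_subproof g : der3 (@dx F) ('X%:P%:P + phase (@dy F) g) = der3 (@dy F) ('X%:P + phase (@dx F) g).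
Proof.
apply: etrans (der3_YD _ (@is_der_df_x F)) _; apply: etrans (esym (der3_XD _ (@is_der_df_y F))).
rewrite (der3_phase _ _ (@is_der_df_x F)) (der3_phase _ _ (@is_der_df_y F)).
by apply: eq_bigr => x _ /=; rewrite dx_dy_comm.
Qed.

(* With [g] a list of pairs [(n, f)], [wkb g L] is exp(-Phi) L exp(Phi) for the phase
   Phi = \sum f tau^n; it is a polynomial in the outermost variable tau, with coefficients in
   F[d_x, d_y]. *)
Definition phase_module g : dmodule F := tmodule (phase_subproof g).
Definition wkb g (L : diffop F) : R2 := @act F (phase_module g) L 1.

Lemma phase_rcons d g x : phase d (rcons g x) = phase d g + const3 F (d x.2) * 'X^(x.1).
Proof. by rewrite /phase -cats1 big_cat big_seq1. Qed.

(** tau enters only through the phase. This divisibility is what keeps the slopes of the Newton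
    polygon integral. *)
Lemma wkb_dvd g L w : (forall x, x \in g -> (w %| x.1)%N) ->
  forall e, (wkb g L)`_e != 0 -> (w %| e)%N.
Proof.
move=> wg; pose P (B : R2) := forall e, B`_e != 0 -> (w %| e)%N.
have PD B C : P B -> P C -> P (B + C).
  move=> hB hC e; rewrite coefD => h; have [/hB //|/negPn/eqP B0] := boolP (B`_e != 0).
  by apply: hC; rewrite B0 add0r in h.
have Psc c B : P B -> P (const3 F c * B).
  by move=> hB e; rewrite /= coefCM mulf_eq0 negb_or => /andP[_ /hB].
have Pder d B : is_der d -> P B -> P (der3 d B).
  move=> dP hB e; rewrite /der3 (coef_map_der (der2_der dP)) => h; apply: hB.
  by apply: contraNneq h => ->; rewrite (der0 (der2_der dP)).
have Pc (c : R1) B : P B -> P (c%:P * B).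
  by move=> hB e; rewrite coefCM mulf_eq0 negb_or => /andP[_ /hB].
have Pphase d B : P B -> P (phase d g * B).
  move=> hB; rewrite /phase mulr_suml big_seq; apply: (big_ind P) => //.
    by move=> e; rewrite coef0 eqxx.
  move=> x xg; rewrite -mulrA; apply: Psc => e; rewrite coefXnM.
  case: ltnP => le; rewrite ?eqxx // => /hB he.
  by rewrite -(subnK le) dvdn_add // wg.
suff hP : P (wkb g L) by exact: hP.
apply: (@act_closed F (phase_module g) P).
- by move=> e; rewrite coef0 eqxx.
- exact: PD.
- exact: Psc.
- by move=> B hB /=; rewrite mulrDl; apply: (PD); [apply: Pder | apply: (PD); [apply: Pc | apply: Pphase]].
- by move=> B hB /=; rewrite mulrDl; apply: (PD); [apply: Pder | apply: (PD); [apply: Pc | apply: Pphase]].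
by move=> [|e]; rewrite coef1 ?eqxx.
Qed.

(** The commutator of [p] with the multiplication by [f]. *)
Definition ad (f : F) (p : R1) : R1 := @act F (op_module F) p (const2 F f) - const2 F f * p.

Lemma adD f p q : ad f (p + q) = ad f p + ad f q.
Proof. by rewrite /ad (@actDl F (op_module F)); ring. Qed.

Lemma ad_sc f c p : ad f (c%:P%:P * p) = c%:P%:P * ad f p.
Proof.
have := @act_scale F (op_module F) c p (const2 F f).
by rewrite /ad /op_scale => ->; rewrite /=; ring.
Qed.

Lemma ad_dx f p : ad f (op_dx p) = op_dx (ad f p) + const2 F (dx f) * p.
Proof.
have := @act_dx F (op_module F) p (const2 F f); rewrite op_module_dx /ad => ->.
have mP := map_poly_der (map_poly_der (@is_der_df_x F)).
have cE := der2C (@is_der_df_x F) f; rewrite /der2 in cE.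
by rewrite /op_dx (derB mP) (derM mP) cE; ring.
Qed.

Lemma ad_dy f p : ad f (op_dy p) = op_dy (ad f p) + const2 F (dy f) * p.
Proof.
have := @act_dy F (op_module F) p (const2 F f); rewrite op_module_dy /ad => ->.
have mP := map_poly_der (map_poly_der (@is_der_df_y F)).
have cE := der2C (@is_der_df_y F) f; rewrite /der2 in cE.
by rewrite /op_dy (derB mP) (derM mP) cE; ring.
Qed.

Lemma ad1 f : ad f 1 = 0.
Proof. by rewrite /ad (@act1 F (op_module F)) mulr1 subrr. Qed.

(** The products of [p] and [f] in either order have the same symbol in top order, so the commutator
    loses one order. *)
Lemma ad_order f (p : R1) i j : (forall i' j', p`_i'`_j' != 0 -> (i' + j' <= i + j)%N) ->
  (ad f p)`_i`_j = 0.
Proof.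
move=> hp; have := @act_estimate F 0 1 1 _ _ (x12_lift (op_module_subproof F)) 1 1
    (@wlt_X F 0 1 1) (@wlt_Y F 0 1 1) isT isT 0 (i + j) (const3 F f) p (@wltC3 F 0 1 1 f).
rewrite tev_lift ev1_id -[const3 F f]/((const2 F f)%:P) -act_lift -polyCM -polyCB.
rewrite [_ * const2 F f]mulrC -/(ad f p) => h.
have := wlt_coef (e := 0) (i := i) (j := j) (h _); rewrite coefC /=; apply; last lia.
by move=> i' j' /hp; lia.
Qed.

(** The commutator with the coordinate [y] is the formal derivative with respect to d_y; in
    characteristic 0 its coefficients therefore detect the presence of d_y. *)
Lemma ad_straight y (p : R1) : dx y = 0 -> dy y = 1 ->
  forall i j, (ad y p)`_i`_j = p`_i`_j.+1 *+ j.+1.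
Proof.
move=> dxy dyy; suff -> : ad y p = map_poly (@deriv F) p.
  by move=> i j; rewrite coef_map_id0 ?deriv0 // coef_deriv.
pose D (p : R1) : R1 := map_poly (@deriv F) p.
have DD u v : D (u + v) = D u + D v.
  by apply/polyP => i; rewrite /D coefD !coef_map_id0 ?deriv0 // coefD derivD.
suff : @act F (op_module F) p (const2 F y) = const2 F y * p + D p by rewrite /ad => ->; ring.
have D1 : D 1 = 0.
  by apply/polyP => i; rewrite /D coef_map_id0 ?deriv0 // coef1 coef0; case: i => [|i]; rewrite ?derivC ?deriv0 //= -polyC1 derivC.
pose Th (u : R1) : R1 := const2 F y * u + D u.
have Th1 : Th 1 = const2 F y by rewrite /Th D1 mulr1 addr0.
have DderC (d : F -> F) u : is_der d -> D (der2 d u) = der2 d (D u).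
  move=> dP; apply/polyP => i; apply/polyP => j.
  rewrite /D coef_map_id0 ?deriv0 // coef_deriv /der2 !(coef_map_der (map_poly_der dP)).
  by rewrite !(coef_map_der dP) coef_map_id0 ?deriv0 // coef_deriv (derMn dP).
have p1 : @act F (op_module F) p (1 : R1) = p by rewrite -opmulE opmul_1r.
rewrite -[in LHS]Th1; transitivity (Th (@act F (op_module F) p (1 : R1))); last by rewrite p1.
apply: esym; apply: (@act_morph F (op_module F) (op_module F) Th).
- by move=> u v; rewrite /Th DD; ring.
- move=> c u; rewrite /Th /= mulrDr; congr (_ + _); first by ring.
  apply/polyP => i; rewrite /D coefCM !coef_map_id0 ?deriv0 // coefCM derivM derivC.
  by rewrite mul0r add0r.
- move=> u; rewrite /Th /= (derD (der2_der (@is_der_df_x F))) (derM (der2_der (@is_der_df_x F))).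
  rewrite (der2C (@is_der_df_x F)) dxy /= mul0r add0r DD DderC //.
  have -> : D ('X * u) = 'X * D u.
    apply/polyP => i; rewrite /D coef_map_id0 ?deriv0 // !coefXM.
    by case: eqP => _; rewrite ?deriv0 // coef_map_id0 ?deriv0.
  by ring.
move=> u; rewrite /Th /= (derD (der2_der (@is_der_df_y F))) (derM (der2_der (@is_der_df_y F))).
rewrite (der2C (@is_der_df_y F)) dyy DD DderC //=.
have -> : D ('X%:P * u) = 'X%:P * D u + u.
  apply/polyP => i; rewrite /D coefD coef_map_id0 ?deriv0 // !coefCM coef_map_id0 ?deriv0 //.
  by rewrite derivM derivX mul1r addrC.
by ring.
Qed.

Definition ad2 (f : F) (B : R2) : R2 := map_poly (ad f) B.

Lemma ad0 f : ad f 0 = 0.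
Proof. by apply: (addrI (ad f 0)); rewrite -adD !addr0. Qed.

Lemma coef_ad2 f B e : (ad2 f B)`_e = ad f B`_e.
Proof. by rewrite /ad2 coef_map_id0 // ad0. Qed.

Lemma ad2D f B C : ad2 f (B + C) = ad2 f B + ad2 f C.
Proof. by apply/polyP => e; rewrite coefD !coef_ad2 coefD adD. Qed.

Lemma ad2_sum f (I : Type) (r : seq I) (G : I -> R2) :
  ad2 f (\sum_(i <- r) G i) = \sum_(i <- r) ad2 f (G i).
Proof.
by apply: (big_morph (ad2 f) (ad2D f)); apply/polyP => e; rewrite coef_ad2 !coef0 ad0.
Qed.

Lemma ad2_mono f c n B : ad2 f (const3 F c * 'X^n * B) = const3 F c * 'X^n * ad2 f B.
Proof.
apply/polyP => e; rewrite -!mulrA coef_ad2 /= !coefCM !coefXnM ad_sc.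
by case: ltnP; rewrite ?ad0 // coef_ad2.
Qed.

Lemma ad2_phase f d g B : ad2 f (phase d g * B) = phase d g * ad2 f B.
Proof.
by rewrite /phase !mulr_suml ad2_sum; apply: eq_bigr => x _; exact: ad2_mono.
Qed.

Lemma coef_dx3 (B : R2) e : (der3 (@dx F) B + 'X%:P * B)`_e = op_dx B`_e.
Proof. by rewrite coefD coefCM /der3 (coef_map_der (der2_der (@is_der_df_x F))) mulrC. Qed.

Lemma coef_dy3 (B : R2) e : (der3 (@dy F) B + 'X%:P%:P * B)`_e = op_dy B`_e.
Proof. by rewrite coefD coefCM /der3 (coef_map_der (der2_der (@is_der_df_y F))) mulrC. Qed.

Lemma ad2_dx3 f (B : R2) : ad2 f (der3 (@dx F) B + 'X%:P * B) =
  (der3 (@dx F) (ad2 f B) + 'X%:P * ad2 f B) + const3 F (dx f) * B.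
Proof.
apply/polyP => e; apply: etrans (coef_ad2 _ _ _) _; rewrite coef_dx3 ad_dx.
apply: esym; apply: etrans (coefD _ _ _) _; rewrite coef_dx3 coef_ad2; congr (_ + _).
exact: coefCM.
Qed.

Lemma ad2_dmx f g (B : R2) : let x := 'X%:P + phase (@dx F) g in
  ad2 f (der3 (@dx F) B + x * B) = der3 (@dx F) (ad2 f B) + x * ad2 f B + const3 F (dx f) * B.
Proof.
rewrite /= !mulrDl !addrA; apply: etrans (ad2D _ _ _) _; rewrite ad2_phase ad2_dx3.
by rewrite -!addrA; do 2!congr (_ + _); rewrite addrC.
Qed.

Lemma ad2_dy3 f (B : R2) : ad2 f (der3 (@dy F) B + 'X%:P%:P * B) =
  (der3 (@dy F) (ad2 f B) + 'X%:P%:P * ad2 f B) + const3 F (dy f) * B.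
Proof.
apply/polyP => e; apply: etrans (coef_ad2 _ _ _) _; rewrite coef_dy3 ad_dy.
apply: esym; apply: etrans (coefD _ _ _) _; rewrite coef_dy3 coef_ad2; congr (_ + _).
exact: coefCM.
Qed.

Lemma ad2_dmy f g (B : R2) : let x := 'X%:P%:P + phase (@dy F) g in
  ad2 f (der3 (@dy F) B + x * B) = der3 (@dy F) (ad2 f B) + x * ad2 f B + const3 F (dy f) * B.
Proof.
rewrite /= !mulrDl !addrA; apply: etrans (ad2D _ _ _) _; rewrite ad2_phase ad2_dy3.
by rewrite -!addrA; do 2!congr (_ + _); rewrite addrC.
Qed.

(* Euler's identity: A = exp(-g) L exp(g) satisfies tau dA/dtau = [A, tau dg/dtau]. *)
Definition euler g (B : R2) : R2 :=
  'X * B^`() - \sum_(x <- g) ('X^(x.1) * ad2 x.2 B) *+ x.1.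

Lemma der3_deriv (d : F -> F) (B : R2) : is_der d -> der3 d B^`() = (der3 d B)^`().
Proof.
move=> dP; apply/polyP => e.
by rewrite /der3 coef_deriv !(coef_map_der (der2_der dP)) coef_deriv (derMn (der2_der dP)).
Qed.

Lemma deriv_const3 c (B : R2) : (const3 F c * B)^`() = const3 F c * B^`().
Proof.
have c0 : (const3 F c)^`() * B = 0 by apply: etrans (congr1 ( *%R^~ B) (derivC c%:P%:P)) (mul0r B).
exact: etrans (derivM _ _) (etrans (congr1 (+%R^~ _) c0) (add0r _)).
Qed.

Lemma der3_tau (d : F -> F) n : is_der d -> der3 d 'X^n = 0.
Proof. by move=> dP; rewrite /der3 (map_derXn (der2_der dP)). Qed.

Lemma der3_tau_mul (d : F -> F) n (C : R2) : is_der d ->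
  der3 d ('X^n * C) = 'X^n * der3 d C.
Proof.
move=> dP; apply: etrans (derM (der3_der dP) _ _) _.
exact: etrans (congr1 (fun z => z * C + 'X^n * der3 d C) (der3_tau n dP))
  (etrans (congr1 (+%R^~ _) (mul0r C)) (add0r _)).
Qed.

Lemma deriv_phase d g : 'X * (phase d g)^`() = \sum_(x <- g) (const3 F (d x.2) * 'X^(x.1)) *+ x.1.
Proof.
rewrite /phase (big_morph (@deriv _) (@derivD _) (@deriv0 _)) mulr_sumr.
apply: eq_bigr => x _.
rewrite deriv_const3 derivXn !mulrnAr mulrCA.
by case: x.1 => [|n] //; rewrite -exprS.
Qed.

Lemma euler_comm g (d : F -> F) (x0 : R1) (B : R2) : is_der d ->
    (forall f B, ad2 f (der3 d B + (x0%:P + phase d g) * B) =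
       der3 d (ad2 f B) + (x0%:P + phase d g) * ad2 f B + const3 F (d f) * B) ->
  euler g (der3 d B + (x0%:P + phase d g) * B) =
  der3 d (euler g B) + (x0%:P + phase d g) * euler g B.
Proof.
move=> dP adx; have D3 := der3_der dP; rewrite /euler.
rewrite derivD derivM derivD derivC add0r (derB D3) (derM D3) -der3_deriv //.
rewrite (der3_tau 1 dP : der3 d 'X = 0) mul0r add0r.
under eq_bigr => x _ do rewrite adx.
rewrite (der_sum D3) mulrBr mulr_sumr.
have -> : \sum_(x <- g) ('X^(x.1) * (der3 d (ad2 x.2 B) + (x0%:P + phase d g) * ad2 x.2 B +
     const3 F (d x.2) * B)) *+ x.1 =
   \sum_(x <- g) der3 d (('X^(x.1) * ad2 x.2 B) *+ x.1) +
   \sum_(x <- g) (x0%:P + phase d g) * (('X^(x.1) * ad2 x.2 B) *+ x.1) +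
   'X * (phase d g)^`() * B.
  rewrite deriv_phase mulr_suml -!big_split; apply: eq_bigr => x _ /=.
  rewrite (derMn D3) der3_tau_mul // mulrnAr mulrnAl -!mulrnDl; congr (_ *+ _); ring.
by ring.
Qed.

(** [euler g] commutes with the action of every operator on [phase_module g] and kills 1, from which
    [wkb g L] is obtained by applying [L]. *)
Lemma euler_wkb g L : euler g (wkb g L) = 0.
Proof.
have E1 : euler g 1 = 0.
  rewrite /euler -polyC1 derivC mulr0 big1 ?subrr // => x _.
  rewrite (_ : ad2 _ _ = 0) ?mulr0 ?mul0rn //.
  apply/polyP => e; apply: etrans (coef_ad2 _ _ _) _; apply: etrans (esym (coef0 _ e)).
  by case: e => [|e]; rewrite [X in ad _ X]coefC; [exact: ad1 | exact: ad0].
rewrite /wkb -(act0r (phase_module g) L) -[in RHS]E1.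
apply: (@act_morph F (phase_module g) (phase_module g) (euler g)).
- move=> B C; rewrite /euler derivD mulrDr addrACA -opprD -big_split /=.
  by congr (_ - _); apply: eq_bigr => x _; rewrite ad2D mulrDr mulrnDl.
- move=> c B; rewrite -[RHS]/(const3 F c * euler g B) -[dm_sc c B]/(const3 F c * B).
  rewrite /euler deriv_const3 mulrBr mulr_sumr mulrCA.
  congr (_ - _); apply: eq_bigr => x _.
  by have := ad2_mono x.2 c 0 B; rewrite expr0 !mulr1 => ->; rewrite mulrnAr mulrCA.
- by move=> B; apply: euler_comm => // f C; exact: ad2_dmx.
by move=> B; apply: euler_comm => // f C; exact: ad2_dmy.
Qed.

End Phase.

Section Twist.
Variable F : diffField.
Local Notation R1 := {poly {poly F}}.
Local Notation R2 := {poly {poly {poly F}}}.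

Lemma ext_phase (V : zmodType) (T : V -> V) (phi : R1 -> V) (psi : F -> V -> V) d g (B : R2) :
    (forall u v, T (u + v) = T u + T v) ->
    (forall p q, phi (p + q) = phi p + phi q) ->
    (forall c u v, psi c (u + v) = psi c u + psi c v) ->
    (forall c u, psi c (T u) = T (psi c u)) ->
    (forall c p, phi (c%:P%:P * p) = psi c (phi p)) ->
  ext T phi (phase d g * B) = \sum_(x <- g) psi (d x.2) (iter x.1 T (ext T phi B)).
Proof.
move=> TD phiD psiD psiT phipsi; rewrite /phase mulr_suml (ext_sum TD phiD).
apply: eq_bigr => x _; rewrite -mulrA (ext_scale TD phiD psiD psiT phipsi).
by rewrite (extXn TD phiD).
Qed.

Lemma map_op_dx (B : R2) : der3 (@dx F) B + 'X%:P * B = map_poly (@op_dx F) B.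
Proof.
apply/polyP => e; rewrite coef_dx3 coef_map_id0 //.
by rewrite /op_dx (der0 (map_poly_der (map_poly_der (@is_der_df_x F)))) mul0r addr0.
Qed.

Lemma map_op_dy (B : R2) : der3 (@dy F) B + 'X%:P%:P * B = map_poly (@op_dy F) B.
Proof.
apply/polyP => e; rewrite coef_dy3 coef_map_id0 //.
by rewrite /op_dy (der0 (map_poly_der (map_poly_der (@is_der_df_y F)))) mul0r addr0.
Qed.

Lemma op_dxD (p q : R1) : op_dx (p + q) = op_dx p + op_dx q :> R1.
Proof. by rewrite -!op_module_dx; exact: (@dm_xD F (op_module F)). Qed.
Lemma op_dyD (p q : R1) : op_dy (p + q) = op_dy p + op_dy q :> R1.
Proof. by rewrite -!op_module_dy; exact: (@dm_yD F (op_module F)). Qed.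

Section Rcons.
Variables (x : nat * F).
Local Notation V := (phase_module [:: x]).
Let phi (p : R1) : R2 := @act F V p (1 : R2).
Let T (u : R2) : R2 := 'X * u.
Let psi (c : F) (u : R2) : R2 := const3 F c * u.

Let TD u v : T (u + v) = T u + T v. Proof. exact: mulrDr. Qed.
Let phiD p q : phi (p + q) = phi p + phi q. Proof. exact: (@actDl F V). Qed.
Let psiD c u v : psi c (u + v) = psi c u + psi c v. Proof. exact: mulrDr. Qed.
Let psiT c u : psi c (T u) = T (psi c u). Proof. exact: mulrCA. Qed.
Let phi_psi c p : phi (c%:P%:P * p) = psi c (phi p). Proof. exact: (@act_scale F V). Qed.

Lemma phase1 d : phase d [:: x] = const3 F (d x.2) * 'X^(x.1).
Proof. by rewrite /phase big_seq1. Qed.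

Lemma iter_mulX n (u : R2) : iter n T u = 'X^n * u.
Proof. by elim: n => [|n IH]; rewrite ?expr0 ?mul1r //= IH /T exprS mulrA. Qed.

Lemma dm_x_tau n (u : V) : dm_x ('X^n * u : V) = 'X^n * (dm_x u : R2).
Proof.
apply: etrans (esym (mulrDr _ _ _)); congr (_ + _); last exact: mulrCA.
exact: (der3_tau_mul n u (@is_der_df_x F)).
Qed.
Lemma dm_y_tau n (u : V) : dm_y ('X^n * u : V) = 'X^n * (dm_y u : R2).
Proof.
apply: etrans (esym (mulrDr _ _ _)); congr (_ + _); last exact: mulrCA.
exact: (der3_tau_mul n u (@is_der_df_y F)).
Qed.

(** Conjugation in two stages: by [g] first, then by the last term of the phase, coefficient by
    coefficient in tau, which is a constant. *)
Lemma wkb_rcons g L : wkb (rcons g x) L = \sum_(e < size (wkb g L)) 'X^e * phi (wkb g L)`_e.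
Proof.
transitivity (ext T phi (wkb g L)); last first.
  by rewrite /ext; apply: eq_bigr => e _; rewrite iter_mulX.
have E1 : ext T phi 1 = 1.
  by apply: etrans (extC TD phiD 1) _; exact: (@act1 F V).
rewrite {1}/wkb -{1}E1; apply: esym.
apply: (@act_morph F (phase_module g) (phase_module (rcons g x)) (ext T phi) L (1 : R2)).
- exact: (extD TD phiD).
- move=> c B; exact: (ext_scale TD phiD psiD psiT phi_psi).
- move=> B /=; rewrite mulrDl addrA (extD TD phiD) map_op_dx.
  rewrite (@ext_comm _ _ _ _ TD phiD _ (@dm_x F V)).
  + rewrite (ext_phase _ _ _ TD phiD psiD psiT phi_psi) /= phase1 phase_rcons.
    set E := ext _ _ _.
    have -> : \sum_(z <- g) psi (dx z.2) (iter z.1 T E) = phase (@dx F) g * E.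
      by rewrite /phase mulr_suml; apply: eq_bigr => z _; rewrite iter_mulX /psi mulrA.
    by rewrite !mulrDl !addrA [RHS]addrAC.
  + exact: op_dxD.
  + exact: (@dm_xD F V).
  + by move=> u; have := dm_x_tau 1 u; rewrite expr1.
  by move=> p; exact: (@act_dx F V p (1 : R2)).
move=> B /=; rewrite mulrDl addrA (extD TD phiD) map_op_dy.
rewrite (@ext_comm _ _ _ _ TD phiD _ (@dm_y F V)).
+ rewrite (ext_phase _ _ _ TD phiD psiD psiT phi_psi) /= phase1 phase_rcons.
  set E := ext _ _ _.
  have -> : \sum_(z <- g) psi (dy z.2) (iter z.1 T E) = phase (@dy F) g * E.
    by rewrite /phase mulr_suml; apply: eq_bigr => z _; rewrite iter_mulX /psi mulrA.
  by rewrite !mulrDl !addrA [RHS]addrAC.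
+ exact: op_dyD.
+ exact: (@dm_yD F V).
+ by move=> u; have := dm_y_tau 1 u; rewrite expr1.
by move=> p; exact: (@act_dy F V p (1 : R2)).
Qed.

End Rcons.

End Twist.

(** * Newton-Puiseux iteration *)

Section Edge.
Variable F : diffField.
Local Notation R1 := {poly {poly F}}.
Local Notation R2 := {poly {poly {poly F}}}.

Lemma mulrn_eq0_df (a : F) n : (0 < n)%N -> a *+ n = 0 -> a = 0.
Proof.
case: n => // n _; rewrite -mulr_natr => /eqP; rewrite mulf_eq0 => /orP[/eqP //|].
by have /charf0P -> := @df_pchar0 F.
Qed.

Lemma euler_coef g (B : R2) e : euler g B = 0 ->
  B`_e *+ e = \sum_(x <- g) (if (e < x.1)%N then 0 else ad x.2 B`_(e - x.1)) *+ x.1.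
Proof.
move=> /(congr1 (fun C : R2 => C`_e)); rewrite /euler coefB coef0 => /eqP.
rewrite subr_eq0 coefXM coef_deriv => /eqP h.
transitivity ((\sum_(x <- g) ('X^(x.1) * ad2 x.2 B) *+ x.1)`_e).
  by rewrite -h; case: e {h} => // e; rewrite mulr0n.
rewrite coef_sum; apply: eq_bigr => x _; rewrite coefMn coefXnM.
by congr (_ *+ _); case: ifP => // _; exact: coef_ad2.
Qed.

(** Euler's identity is read at tau^(e + Q), with the exponent of d_y lowered by one. The left side
    vanishes by weight, as [n < Q]. A term of [g] has tau exponent below [Q], so the operator in its
    commutator has order too small to survive [ad_order]. The commutator with [y] remains, a
    positive multiple of the coefficient in question. *)
Lemma yfree y g n N Q (B : R2) : dx y = 0 -> dy y = 1 ->
    euler ((Q, y) :: g) B = 0 -> (n < Q)%N -> (forall x, x \in g -> (x.1 < Q)%N) ->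
    (forall e i j, B`_e`_i`_j != 0 -> (e + n * (i + j) <= N)%N) ->
  forall e i j, B`_e`_i`_j != 0 -> (e + n * (i + j))%N = N -> j = 0%N.
Proof.
move=> dxy dyy hE nQ gQ hN e i [//|j] Be hw; exfalso; move/negP: Be; apply; apply/eqP.
have := euler_coef (e + Q) hE; rewrite big_cons /= ltnNge leq_addl /= addnK.
move=> /(congr1 (fun p : R1 => p`_i`_j)); rewrite coefMn coefMn.
have hw' : (e + n * (i + j) + n)%N = N by rewrite -hw addnS mulnS; lia.
have -> : B`_(e + Q)`_i`_j = 0 by apply/eqP; apply: contraT => /hN; lia.
rewrite mul0rn coefD coefMn coefD coefMn (ad_straight _ dxy dyy).
rewrite coef_sum coef_sum big_seq big1 ?addr0.
  move=> /esym/mulrn_eq0_df h; apply: (@mulrn_eq0_df _ j.+1) => //; apply: h.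
  exact: leq_ltn_trans nQ.
move=> [k fk] /gQ /= xQ; rewrite coefMn coefMn.
case: ifP => _; first by rewrite !coef0 mul0rn.
rewrite ad_order ?mul0rn // => i' j' /hN h.
have : (n * (i' + j') < n * (i + j).+1)%N by rewrite mulnS; lia.
by rewrite ltn_mul2l => /andP[_].
Qed.

Section TwistCoef.
Variables (g : seq (nat * F)) (L : diffop F) (n N : nat) (f : F).
Hypothesis n_gt0 : (0 < n)%N.
Local Notation A := (wkb g L).
Local Notation A' := (wkb (rcons g (n, f)) L).
Local Notation r := (dx f).
Hypotheses (AN : forall e i j, A`_e`_i`_j != 0 -> (e + n * (i + j) <= N)%N)
  (A0 : forall e i j, A`_e`_i`_j != 0 -> (e + n * (i + j))%N = N -> j = 0%N).

(** The part of top weight [N] as a polynomial in d_x: the monomial tau^(N - n k) d_x^k has this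
    weight, and by [A0] no d_y occurs there. *)
Definition edge_poly : {poly F} :=
  \poly_(k < N.+1) (if (n * k <= N)%N then A`_(N - n * k)`_k`_0 else 0).

Local Notation V := (phase_module [:: (n, f)]).
Local Notation x1 := ('X%:P + const3 F r * 'X^n : R2).
Local Notation wl := (wlt 1 n n).

Let phi (p : R1) : R2 := @act F V p (1 : R2).
Let Tm e i : R2 := if (e + n * i == N)%N then const3 F A`_e`_i`_0 * ('X^e * x1 ^+ i) else 0.

Lemma const3_mul0 (B : R2) : const3 F 0 * B = 0.
Proof. by rewrite rmorph0 mul0r. Qed.

Lemma wlt_taun e : wl e.+1 ('X^e : R2).
Proof. by have := @wltX F 1 n n 1 'X e (@wlt_tau F 1 n n); rewrite muln1. Qed.

Lemma wlt_x1 (h : F) : wl n.+1 (const3 F h * 'X^n : R2).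
Proof. by apply: wlt_scale; exact: wlt_taun. Qed.

Lemma wlt_phase_x : wl n.+1 ('X%:P + phase (@dx F) [:: (n, f)]).
Proof. by rewrite phase1; apply: wltD; [exact: wlt_X | exact: wlt_x1]. Qed.
Lemma wlt_phase_y : wl n.+1 ('X%:P%:P + phase (@dy F) [:: (n, f)]).
Proof. by rewrite phase1; apply: wltD; [exact: wlt_Y | exact: wlt_x1]. Qed.

Lemma coefA0 e i j : (N < e + n * (i + j))%N -> A`_e`_i`_j = 0.
Proof. by move=> h; apply/eqP; apply: contraT => /AN; rewrite leqNgt h. Qed.

Lemma size_A : (size A <= N.+1)%N.
Proof.
apply/leq_sizeP => e le; apply/polyP => i; apply/polyP => j; rewrite !coef0.
by apply: coefA0; lia.
Qed.

Lemma size_Ae e : (size (A`_e)%R <= N.+1)%N.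
Proof.
apply/leq_sizeP => i le; apply/polyP => j; rewrite coef0.
by apply: coefA0; nia.
Qed.

(** Two reductions modulo weights below [N]: the operator is replaced by its symbol, and then its
    monomials off the edge are dropped. *)
Lemma phi_estimate e : wl N ('X^e * phi A`_e - \sum_(i < N.+1) Tm e i).
Proof.
have [A_e0|A_e] := eqVneq A`_e 0.
  rewrite A_e0 /phi (@act0l F V) mulr0 sub0r; apply: wltN; apply: wlt_sum => i _.
  by rewrite /Tm A_e0 !coef0 rmorph0 mul0r; case: ifP => _; exact: wlt0.
have eN : (e <= N)%N.
  apply: contraR A_e; rewrite -ltnNge => lt; apply/eqP/polyP => i; apply/polyP => j.
  by rewrite !coef0; apply: coefA0; lia.
have est : wl N ('X^e * phi A`_e - 'X^e * tev ('X%:P + phase (@dx F) [:: (n, f)])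
    ('X%:P%:P + phase (@dy F) [:: (n, f)]) A`_e).
  rewrite -mulrBr -[X in wl X](subnKC eN); apply: wltM; first exact: wlt_taun.
  have := @act_estimate F 1 n n _ _ (phase_subproof [:: (n, f)]) n n wlt_phase_x wlt_phase_y
    n_gt0 n_gt0 0 (N - e)%N 1 A`_e (@wlt1 F 1 n n).
  by rewrite mulr1 add0n; apply=> i j /AN; nia.
rewrite -[X in wl N (X - _)](subrK ('X^e * tev ('X%:P + phase (@dx F) [:: (n, f)])
    ('X%:P%:P + phase (@dy F) [:: (n, f)]) A`_e)) -addrA.
apply: wltD; first exact: est.
have Tm0 i : (size (A`_e)%R <= i)%N -> Tm e i = 0.
  by move=> le; rewrite /Tm (nth_default _ le) coef0 rmorph0 mul0r; case: ifP.
have -> : \sum_(i < N.+1) Tm e i = \sum_(i < size A`_e) Tm e i.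
  rewrite (big_ord_widen N.+1 (Tm e) (size_Ae e)) [RHS]big_mkcond; apply: eq_bigr => i _.
  by case: ltnP => // /Tm0.
rewrite /tev mulr_sumr -sumrB; apply: wlt_sum => -[i /= _] _.
have term (j : nat) : A`_e`_i`_j != 0 -> (e + n * (i + j) < N)%N ->
    wl N ('X^e * (const3 F A`_e`_i`_j * (('X%:P + phase (@dx F) [:: (n, f)]) ^+ i *
      ('X%:P%:P + phase (@dy F) [:: (n, f)]) ^+ j))).
  move=> _ lt; rewrite mulrCA; apply: wlt_scale.
  apply: (@wlt_leq _ _ _ _ (e + (i * n + j * n)).+1); first by nia.
  apply: wltM1; first exact: wlt_taun.
  by apply: wltM1; apply: wltX; [exact: wlt_phase_x | exact: wlt_phase_y].
case sz : (size A`_e`_i) => [|k].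
  rewrite big_ord0 mulr0 sub0r; apply: wltN.
  rewrite /Tm [A`_e`_i`_0]nth_default ?sz // rmorph0 mul0r; case: ifP => _; exact: wlt0.
rewrite big_ord_recl mulrDr addrAC; apply: wltD.
  rewrite /Tm phase1 expr0 mulr1; have := AN (e := e) (i := i) (j := 0%N).
  have := @term 0%N; rewrite addn0 phase1 expr0 mulr1.
  case: eqVneq => [A00|_].
    by rewrite A00 !const3_mul0 mulr0; case: ifP => _ _ _; rewrite subrr; exact: wlt0.
  move=> /(_ isT) h1 /(_ isT); rewrite leq_eqVlt; case: eqP => [_ _|_ /= lt].
    by rewrite mulrCA subrr; exact: wlt0.
  by rewrite subr0; exact: h1.
rewrite mulr_sumr; apply: wlt_sum => j _.
have [->|Aj] := eqVneq A`_e`_i`_(lift ord0 j) 0; first by rewrite rmorph0 mul0r mulr0; exact: wlt0.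
apply: term => //; have := AN Aj; rewrite leq_eqVlt => /orP[/eqP/(A0 Aj)|//].
by [].
Qed.

Lemma twist_estimate :
  wl N (A' - \sum_(k < N.+1) const3 F edge_poly`_k * ('X^(N - n * k) * x1 ^+ k)).
Proof.
have -> : \sum_(k < N.+1) const3 F edge_poly`_k * ('X^(N - n * k) * x1 ^+ k) =
    \sum_(e < N.+1) \sum_(i < N.+1) Tm e i.
  rewrite exchange_big; apply: eq_bigr => k _; rewrite /edge_poly coef_poly ltn_ord.
  case: leqP => [le|lt]; last first.
    rewrite rmorph0 mul0r big1 // => e _; rewrite /Tm; case: eqP => // h; lia.
  have lt : (N - n * k < N.+1)%N by rewrite ltnS leq_subr.
  rewrite (bigD1 (Ordinal lt)) //= {1}/Tm subnK // eqxx big1 ?addr0 // => e.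
  rewrite -val_eqE /= => ne; rewrite /Tm; case: eqP => // h; case/eqP: ne; lia.
rewrite wkb_rcons (big_ord_widen N.+1 (fun e => 'X^e * @act F V A`_e (1 : R2)) size_A).
rewrite big_mkcond -sumrB; apply: wlt_sum => e _.
case: ltnP => le; first exact: phi_estimate.
have := @phi_estimate e; rewrite nth_default // /phi.
by rewrite (@act0l F V) mulr0.
Qed.

Lemma coef_mono3 (c : F) a b e i j :
  (const3 F c * ('X^a * ('X^b)%:P) : R2)`_e`_i`_j = c *+ [&& e == a, i == b & j == 0%N].
Proof.
rewrite coefCM coefMC coefXn coefCM.
case: (e == a); rewrite ?mul1r ?mul0r ?coef0 ?mulr0 ?coef0 //.
rewrite coefXn; case: (i == b); rewrite ?mulr0 ?coef0 //.
rewrite mulr1 coefC; by case: (j == 0%N).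
Qed.

Lemma coef_twist_sum e i j : (e + n * (i + j))%N = N ->
  (\sum_(k < N.+1) const3 F edge_poly`_k * ('X^(N - n * k) * x1 ^+ k))`_e`_i`_j =
  if j == 0%N then (edge_poly \Po ('X + r%:P))`_i else 0.
Proof.
move=> hw.
have expand k : x1 ^+ k = \sum_(l < k.+1) const3 F (r ^+ l *+ 'C(k, l)) * ('X^(n * l) * ('X^(k - l))%:P).
  rewrite exprDn; apply: eq_bigr => l _.
  rewrite exprMn -exprM rmorphMn rmorphXn /= polyC_exp mulrnAl; congr (_ *+ _).
  by rewrite mulrC -mulrA.
rewrite coef_sum coef_sum coef_sum comp_polyE coef_sum.
have -> : (if j == 0%N then \sum_(k < size edge_poly) (edge_poly`_k *: ('X + r%:P) ^+ k)`_i else 0) =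
    \sum_(k < N.+1) (edge_poly`_k * (('X + r%:P) ^+ k)`_i) *+ (j == 0%N).
  case: (j == 0%N); last by rewrite big1 // => k _; rewrite mulr0n.
  rewrite (big_ord_widen N.+1 (fun k => (edge_poly`_k *: ('X + r%:P) ^+ k)`_i)); last first.
    exact: size_poly.
  rewrite big_mkcond; apply: eq_bigr => k _; rewrite mulr1n coefZ.
  by case: ltnP => // le; rewrite nth_default // mul0r.
apply: eq_bigr => k _; have [->|P0] := eqVneq edge_poly`_k 0.
  by rewrite rmorph0 !mul0r !coef0 mul0rn.
have le : (n * k <= N)%N.
  by apply: contraR P0; rewrite /edge_poly coef_poly ltn_ord => /negbTE ->.
rewrite expand mulr_sumr mulr_sumr coef_sum coef_sum coef_sum.
rewrite exprDn coef_sum mulr_sumr -sumrMnl; apply: eq_bigr => l _.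
have -> : const3 F edge_poly`_k * ('X^(N - n * k) * (const3 F (r ^+ l *+ 'C(k, l)) * ('X^(n * l) * ('X^(k - l))%:P))) =
   const3 F (edge_poly`_k * (r ^+ l *+ 'C(k, l))) * ('X^(N - n * k + n * l) * ('X^(k - l))%:P).
  by rewrite rmorphM exprD; ring.
rewrite coef_mono3 coefMn -polyC_exp coefMC coefXn.
have -> : [&& e == (N - n * k + n * l)%N, i == (k - l)%N & j == 0%N] = (i == (k - l)%N) && (j == 0%N).
  case: (i =P (k - l)%N) => [ik|_]; last by rewrite andbF.
  case: (j =P 0%N) => [j0|_]; last by rewrite !andbF.
  rewrite !andbT; apply/eqP; have := ltn_ord l; nia.
by case: (i == _); case: (j == _); rewrite ?mulr0n ?mulr1n ?mul0r ?mul0rn ?mulr0 ?mul1r.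
Qed.

(** In the top weight the new phase term replaces d_x by d_x + r tau^n, which translates the edge
    polynomial by [r]. The accompanying change of d_y does not show, because the edge has no d_y. *)
Lemma twist_coef :
  (forall e i j, A'`_e`_i`_j != 0 -> (e + n * (i + j) <= N)%N) /\
  (forall e i j, (e + n * (i + j))%N = N ->
    A'`_e`_i`_j = if j == 0%N then (edge_poly \Po ('X + r%:P))`_i else 0).
Proof.
set S := \sum_(k < N.+1) const3 F edge_poly`_k * ('X^(N - n * k) * x1 ^+ k).
have est : wl N (A' - S) by exact: twist_estimate.
have wS : wl N.+1 S.
  apply: wlt_sum => k _; have [->|P0] := eqVneq edge_poly`_k 0.
    by rewrite rmorph0 mul0r; exact: wlt0.
  have le : (n * k <= N)%N.
    by apply: contraR P0; rewrite /edge_poly coef_poly ltn_ord => /negbTE ->.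
  apply: wlt_scale; apply: (@wlt_leq _ _ _ _ (N - n * k + k * n).+1); first by lia.
  apply: wltM1; first exact: wlt_taun.
  by apply: wltX; apply: wltD; [exact: wlt_X | exact: wlt_x1].
split.
  have wA : wl N.+1 A' by rewrite -(subrK S A'); apply: wltD => //; apply: wlt_leq est.
  by move=> e i j /wA; lia.
move=> e i j hw; rewrite -(coef_twist_sum hw) -/S; apply/eqP; rewrite -subr_eq0 -!coefB.
by rewrite (wlt_coef est) //; lia.
Qed.

End TwistCoef.

End Edge.

Lemma comp_shift_coef (K : comNzRingType) (c r : K) m k :
  ((c *: ('X + r%:P) ^+ m)`_k) = if (k <= m)%N then c * (r ^+ (m - k) *+ 'C(m, k)) else 0.
Proof.
rewrite coefZ exprDn coef_sum.
have term (l : 'I_m.+1) : ('X^(m - l) * r%:P ^+ l *+ 'C(m, l))`_k =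
    if k == (m - l)%N then r ^+ l *+ 'C(m, l) else 0.
  rewrite coefMn -polyC_exp coefMC coefXn.
  by case: eqP; rewrite ?mul1r ?mul0r ?mul0rn.
rewrite (eq_bigr _ (fun l _ => term l)).
case: leqP => [le|lt].
  have lt : (m - k < m.+1)%N by rewrite ltnS leq_subr.
  rewrite (bigD1 (Ordinal lt)) //= subKn // eqxx big1 ?addr0; last first.
    move=> l; rewrite -val_eqE /= => ne; case: eqP => // h; case/eqP: ne.
    have := ltn_ord l; lia.
  by rewrite bin_sub.
by rewrite big1 ?mulr0 // => l _; case: eqP => // h; lia.
Qed.

(** Here [P] is a multiple of (X - r)^mu. A further non-zero coefficient excludes r = 0, and then
    the coefficient of degree mu - 1 is a non-zero multiple of mu r in characteristic 0. *)
Lemma shift_full_multiplicity (F : diffField) (P : {poly F}) (r : F) mu k1 :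
    size P = mu.+1 -> (forall k, (k < mu)%N -> (P \Po ('X + r%:P))`_k = 0) ->
    (k1 < mu)%N -> P`_k1 != 0 -> P`_mu.-1 != 0.
Proof.
move=> sP P0 lt_k1 Pk1; set P' := P \Po ('X + r%:P) in P0.
have P'E : P' = P'`_mu *: 'X^mu.
  apply/polyP => k; rewrite coefZ coefXn; case: (ltngtP k mu) => [/P0 ->|lt|->].
  - by rewrite mulr0.
  - by rewrite mulr0 nth_default // /P' size_comp_poly2 ?sP // size_XaddC.
  by rewrite mulr1.
have PE : P = P'`_mu *: ('X + (- r)%:P) ^+ mu.
  transitivity (P' \Po ('X + (- r)%:P)); last by rewrite [in LHS]P'E comp_polyZ comp_Xn_poly.
  rewrite /P' -comp_polyA comp_polyD comp_polyX comp_polyC -addrA -polyCD addNr addr0.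
  by rewrite comp_polyXr.
have r0 : r != 0.
  apply: contraNneq Pk1 => r0; rewrite PE comp_shift_coef (ltnW lt_k1) r0 oppr0 expr0n.
  by rewrite subn_eq0 leqNgt lt_k1 /= mul0rn mulr0.
have c0 : P'`_mu != 0.
  by apply: contraNneq Pk1 => c0; rewrite PE c0 scale0r coef0.
rewrite PE comp_shift_coef leq_pred mulf_neq0 //.
have -> : (mu - mu.-1 = 1)%N by lia.
have -> : 'C(mu, mu.-1) = mu by rewrite -[mu in 'C(mu, _)]prednK ?bin_sub1 ?binSn; lia.
apply/eqP => /mulrn_eq0_df h; case/eqP: r0; apply/eqP.
by rewrite -oppr_eq0 -[X in X == _]expr1 h //; lia.
Qed.

(** The slope (e1 - E) / (mu - k) is an integer greater than n - 1 and at most n. *)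
Lemma slope_tight e1 E n k mu : (k < mu)%N -> (0 < n)%N -> (mu - k %| e1 - E)%N ->
    (E + n.-1 * mu < e1 + n.-1 * k)%N -> (e1 + n * k <= E + n * mu)%N ->
  (e1 + n * k)%N = (E + n * mu)%N.
Proof.
case: n => // n lt _ /dvdnP[c cE] /=; have := subnKC (ltnW lt).
have : (0 < mu - k)%N by rewrite subn_gt0.
move: (mu - k)%N cE => d cE d0 <-; rewrite !mulnDr !mulSn => h1 h2.
have cn : (n < c)%N by rewrite -(ltn_pmul2r d0) -cE; lia.
have : (c <= n.+1)%N by rewrite -(leq_pmul2r d0) -cE mulSn; lia.
move=> cn'; have {cn cn'}cn : c = n.+1 by apply/eqP; rewrite eqn_leq cn cn'.
by move: cE; rewrite cn mulSn; lia.
Qed.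

(** To the right of the vertex, points below the line of slope [n] stay below the flatter line
    through the same vertex, strictly so off the vertex abscissa. *)
Lemma slope_drop e E n' n k mu : (n' < n)%N -> (mu <= k)%N -> (e + n * k <= E + n * mu)%N ->
  (e + n' * k <= E + n' * mu)%N /\ ((mu < k)%N -> (e + n' * k < E + n' * mu)%N).
Proof.
move=> lt /subnKC <-; move: (k - mu)%N => t; rewrite !mulnDr => h.
have le_t : (n' * t <= n * t)%N by rewrite leq_mul2r (ltnW lt) orbT.
split; first by lia.
rewrite -[X in (X < _)%N -> _]addn0 ltn_add2l => t0.
have lt_t : (n' * t < n * t)%N by rewrite ltn_pmul2r.
lia.
Qed.

Section Newton.
Variables (F : diffField) (L : diffop F) (y : F) (M Q : nat).
Hypotheses (dxy : dx y = 0) (dyy : dy y = 1).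
Hypothesis closed : forall p : {poly F}, (1 < size p)%N -> exists x, root p x.
Hypothesis prim : forall r : F, exists f, dx f = r.

Local Notation gs g := ((Q, y) :: g).
Local Notation A g := (wkb (gs g) L).

(* The phase is final when the top coefficient in tau is an operator in [dx] alone. *)
Definition final_phase g := exists E mu, [/\ (0 < mu)%N,
  forall e, (E < e)%N -> (A g)`_e = 0,
  forall i j, (A g)`_E`_i`_j != 0 -> j = 0%N /\ (i <= mu)%N
  & (A g)`_E`_mu`_0 != 0].

Definition phase_ok (g : seq (nat * F)) := path gtn Q [seq x.1 | x <- g] /\
  (forall x, x \in g -> (0 < x.1)%N).

(* The slope [n'] decreases at each step. Divisibility of all exponents by [M`! ^ mu] keeps the
   slopes integral: a root of the edge polynomial of full multiplicity [mu] forces the coefficient of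
   degree [mu - 1] to be non-zero, and otherwise [mu] drops. *)
Lemma newton n : forall g mu N,
    phase_ok g -> last Q [seq x.1 | x <- g] = n -> (0 < n)%N -> (0 < mu <= M)%N ->
    (forall x, x \in gs g -> (M`! ^ mu %| x.1)%N) ->
    (forall e i j, (A g)`_e`_i`_j != 0 -> (e + n * (i + j) <= N)%N) ->
    (forall e i j, (A g)`_e`_i`_j != 0 -> (e + n * (i + j))%N = N -> (mu <= i + j)%N) ->
    (exists e i j, [/\ (A g)`_e`_i`_j != 0, (e + n * (i + j))%N = N & (i + j)%N = mu]) ->
  exists2 g', phase_ok g' & final_phase g'.
Proof.
elim/ltn_ind: n => n IH g mu N gok gn n0 /andP[mu0 muM] gdvd AN Amu [E [i0 [j0 [A0 NE mu_ij]]]].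
have gQ x : x \in g -> (x.1 < Q)%N.
  case: gok => + _; move=> /(order_path_min (rev_trans ltn_trans))/allP h xg.
  by apply: h; exact: map_f.
have nQ : (n <= Q)%N.
  rewrite -gn; case/lastP: (g) gQ => // g1 x h; rewrite map_rcons last_rcons ltnW // h //.
  by rewrite mem_rcons mem_head.
have eul := euler_wkb (gs g) L.
have Advd e i j : (A g)`_e`_i`_j != 0 -> (M`! ^ mu %| e)%N.
  move=> h; apply: (wkb_dvd gdvd (L := L)); apply: contraNneq h => ->.
  by rewrite !coef0.
(* [Pm m]: all points of order less than [mu] lie on or below the line of slope [m] through the
   vertex [(mu, E)]. The least such [m] is the next slope. *)
pose Pm m := forall e i j, (A g)`_e`_i`_j != 0 -> (i + j < mu)%N -> (e + m * (i + j) <= E + m * mu)%N.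
have Pn : Pm n by move=> e i j /AN h _; rewrite -mu_ij NE.
have exP : exists m, `[< Pm m >] by exists n; apply/asboolP.
case: (ex_minnP exP) => n' /asboolP Pn' n'min.
have n'n : (n' <= n)%N by apply: n'min; apply/asboolP.
(* At slope 0 no tau exponent exceeds [E], and [yfree] with [n = 0] removes d_y from the coefficient
   of tau^E: the phase is final. *)
have [n'0|n'0] := posnP n'.
  exists g => //; exists E, mu.
  have AE e i j : (A g)`_e`_i`_j != 0 -> (e <= E)%N.
    move=> h; case: (ltnP (i + j) mu) => [/(Pn' _ _ _ h)|le]; first by rewrite n'0; lia.
    have := AN _ _ _ h; have : (n * mu <= n * (i + j))%N by rewrite leq_mul2l le orbT.
    by rewrite -NE mu_ij; lia.
  have Ay i j : (A g)`_E`_i`_j != 0 -> j = 0%N.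
    move=> h; apply: (@yfree _ y g 0 E Q _ dxy dyy eul _ gQ _ E i j) => //.
    - exact: leq_trans n0 nQ.
    - by move=> e i' j' /AE; rewrite mul0n addn0.
    by rewrite mul0n addn0.
  split=> //.
  - move=> e lt; apply/polyP => i; apply/polyP => j; rewrite !coef0.
    by apply/eqP; apply: contraT => /AE; rewrite leqNgt lt.
  - move=> i j h; split; first exact: Ay h.
    have := AN _ _ _ h; rewrite (Ay _ _ h) -NE mu_ij addn0 leq_add2l leq_pmul2l //.
  have j00 := Ay _ _ A0; have i0mu : i0 = mu by rewrite -mu_ij j00 addn0.
  by move: A0; rewrite j00 i0mu.
have [e1 [i1 [j1 [A1 lt1 tight]]]] : exists e1 i1 j1, [/\ (A g)`_e1`_i1`_j1 != 0, (i1 + j1 < mu)%N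
    & (e1 + n' * (i1 + j1))%N = (E + n' * mu)%N].
  have : ~ Pm n'.-1 by move=> /asboolP/n'min; rewrite leqNgt prednK // leqnn.
  move=> /existsNP[e1] /existsNP[i1] /existsNP[j1] /not_implyP[A1 /not_implyP[lt1 /negP]].
  rewrite -ltnNge => big; exists e1, i1, j1; split=> //.
  have up := Pn' _ _ _ A1 lt1.
  have dvE := Advd _ _ _ A0; have dv1 := Advd _ _ _ A1.
  apply: (slope_tight lt1 n'0 _ big up); apply: (@dvdn_trans (M`! ^ mu)); last exact: dvdn_sub.
  by apply: dvdn_exp => //; apply: dvdn_fact; rewrite subn_gt0 lt1 (leq_trans (leq_subr _ _)).
(* With equal slopes the tight point would lie on the old edge with order below [mu], against
   [Amu]. *)
have lt_n'n : (n' < n)%N.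
  rewrite ltn_neqAle n'n andbT; apply/eqP => nn'; have := Amu _ _ _ A1.
  by rewrite -nn' tight nn' -mu_ij NE => /(_ erefl); rewrite mu_ij leqNgt lt1.
pose N' := (E + n' * mu)%N.
have AN' e i j : (A g)`_e`_i`_j != 0 -> (e + n' * (i + j) <= N')%N /\
    ((mu < i + j)%N -> (e + n' * (i + j) < N')%N).
  move=> h; have [lt|le] := ltnP (i + j) mu.
    by split; [exact: (Pn' _ _ _ h lt) | rewrite ltnNge (ltnW lt)].
  by apply: (slope_drop lt_n'n le); rewrite -mu_ij NE; exact: AN h.
have n'Q : (n' < Q)%N by exact: leq_trans lt_n'n nQ.
have Ay' := @yfree _ y g n' N' Q _ dxy dyy eul n'Q gQ (fun e i j h => (AN' e i j h).1).
have j10 := Ay' _ _ _ A1 tight.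
have j00 : j0 = 0%N by apply: (Ay' _ _ _ A0); rewrite mu_ij.
rewrite j00 addn0 in mu_ij A0; rewrite j10 addn0 in A1 lt1 tight.
have [nu_N AE'] : (n' * mu <= N')%N /\ (N' - n' * mu = E)%N by rewrite /N'; split; lia.
have PE k : (edge_poly (gs g) L n' N')`_k = if (n' * k <= N')%N then (A g)`_(N' - n' * k)`_k`_0 else 0.
  rewrite coef_poly; case: ltnP => // lt; case: leqP => // le; exfalso.
  by have : (1 * k <= n' * k)%N; [rewrite leq_mul2r n'0 orbT | lia].
set P := edge_poly (gs g) L n' N' in PE.
have Pmu : P`_mu != 0 by rewrite PE nu_N AE' -mu_ij.
have Pk1 : P`_i1 != 0.
  have le1 : (n' * i1 <= N')%N by rewrite /N' -tight leq_addl.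
  rewrite PE le1; have -> : (N' - n' * i1)%N = e1 by rewrite /N' -tight addnK.
  exact: A1.
have Pbig k : (mu < k)%N -> P`_k = 0.
  move=> lt; rewrite PE; case: leqP => // le; apply/eqP; apply: contraT => /AN'[_].
  by rewrite addn0 subnK // => /(_ lt); rewrite ltnn.
have sP : size P = mu.+1.
  apply/eqP; rewrite eqn_leq; apply/andP; split; first by apply/leq_sizeP => k /Pbig.
  by rewrite ltnNge; apply: contra Pmu => /leq_sizeP ->.
have [r rP] : exists r, root P r by apply: closed; rewrite sP.
have [f fr] := prim r; set P' := P \Po ('X + r%:P).
have P'0 : P'`_0 = 0 by rewrite -horner_coef0 /P' horner_comp !hornerE (eqP rP).
have sP' : size P' = mu.+1 by rewrite /P' size_comp_poly2 // size_XaddC.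
have P'mu : P'`_mu != 0.
  have : lead_coef P' != 0 by rewrite lead_coef_eq0 -size_poly_eq0 sP'.
  by rewrite /lead_coef sP'.
(* The next vertex [mu'] is the multiplicity of the root [r] of [P]. *)
have exmu : exists k, P'`_k != 0 by exists mu.
case: (ex_minnP exmu) => mu' P'mu' mu'min.
have mu'0 : (0 < mu')%N by case: (mu') P'mu' => //; rewrite P'0 eqxx.
have mu'mu : (mu' <= mu)%N by exact: mu'min.
have P'lt k : (k < mu')%N -> P'`_k = 0.
  by move=> lt; apply/eqP; apply: contraTT lt => /mu'min; rewrite leqNgt.
have [B1 B2] := @twist_coef F (gs g) L n' N' f n'0 (fun e i j h => (AN' e i j h).1) Ay'.
rewrite fr -/P -/P' in B2.
(* At full multiplicity the coefficient of degree mu - 1 sits at tau exponent [E + n'], so [n']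
   inherits the whole divisibility. Otherwise [n' * (mu - i1)] has it, and cancelling [mu - i1], a
   divisor of the factorial of [M], costs one factor while [mu] has dropped. *)
have dvd_n' : (M`! ^ mu' %| n')%N.
  move: mu'mu; rewrite leq_eqVlt => /orP[/eqP mm|lt].
    have Pm1 : P`_mu.-1 != 0.
      by apply: (shift_full_multiplicity sP _ lt1 Pk1) => k; rewrite -mm; exact: P'lt.
    move: Pm1; rewrite PE; case: ifP => [le h|]; last by rewrite eqxx.
    have := Advd _ _ _ h; have -> : (N' - n' * mu.-1 = E + n')%N.
      have e : (n' * mu = n' + n' * mu.-1)%N by rewrite -mulnS prednK.
      by rewrite /N' e addnA addnK.
    by rewrite mm dvdn_addr //; exact: Advd A0.
  have le : (mu' <= mu.-1)%N by rewrite -ltnS prednK.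
  apply: (@dvdn_trans (M`! ^ mu.-1)); first exact: dvdn_exp2l.
  have k0 : (0 < mu - i1)%N by rewrite subn_gt0.
  have kM : (mu - i1 <= M)%N by exact: leq_trans (leq_subr _ _) muM.
  have /dvdnP[c cE] : (mu - i1 %| M`!)%N by rewrite dvdn_fact // k0.
  have h : (M`! ^ mu %| n' * (mu - i1))%N.
    have -> : (n' * (mu - i1) = e1 - E)%N.
      by rewrite mulnBr; clear -tight lt1; have := leq_mul (leqnn n') (ltnW lt1); lia.
    by apply: dvdn_sub; [exact: Advd A1 | exact: Advd A0].
  move: h; rewrite -{1}(prednK mu0) expnSr {2}cE mulnA dvdn_pmul2r //.
  exact/dvdn_trans/dvdn_mulr.
apply: (IH n' lt_n'n (rcons g (n', f)) mu' N').
- split.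
    by rewrite map_rcons rcons_path gok.1 gn.
  by move=> x; rewrite mem_rcons inE => /orP[/eqP -> //|]; exact: gok.2.
- by rewrite map_rcons last_rcons.
- by [].
- by rewrite mu'0 (leq_trans mu'mu).
- move=> x; rewrite -rcons_cons mem_rcons inE => /orP[/eqP -> //|xg].
  by apply: dvdn_trans (gdvd _ xg); exact: dvdn_exp2l.
- by rewrite -rcons_cons.
- move=> e i j; rewrite -rcons_cons => h hw; move: h; rewrite B2 //.
  case: (j =P 0%N) => [->|_]; last by rewrite eqxx.
  by rewrite addn0 leqNgt => h; apply: contraNN h => /P'lt ->.
have lemu : (n' * mu' <= N')%N by apply: leq_trans nu_N; rewrite leq_mul2l mu'mu orbT.
exists (N' - n' * mu')%N, mu', 0%N; rewrite -rcons_cons addn0 subnK //; split=> //.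
by rewrite B2 ?addn0 ?subnK.
Qed.

End Newton.

(** * The initial edge, given by the phase y tau^Q *)

Section Start.
Variables (F : diffField) (y : F) (L : diffop F) (N0 Q : nat).
Hypotheses (dxy : dx y = 0) (dyy : dy y = 1) (Q0 : (0 < Q)%N).
Hypothesis ordL : forall i j, L`_i`_j != 0 -> (i + j <= N0)%N.
Local Notation R2 := {poly {poly {poly F}}}.
Local Notation x2 := ('X%:P%:P + 'X^Q : R2).

Lemma wkb_start_expand j : x2 ^+ j = \sum_(l < j.+1) const3 F ('C(j, l)%:R) * ('X^(Q * (j - l)) * ('X^l)%:P%:P).
Proof.
rewrite exprDn (reindex_inj rev_ord_inj); apply: eq_bigr => l _ /=.
rewrite subSS subKn -1?ltnS // bin_sub -1?ltnS // -exprM !polyC_exp.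
rewrite -[LHS]mulr_natl; congr (_ * _); last exact: mulrC.
exact: esym (rmorph_nat (const3 F) _).
Qed.

Lemma wkb_start :
  wlt 1 Q Q (Q * N0) (wkb [:: (Q, y)] L - tev 'X%:P x2 L).
Proof.
have px : 'X%:P + phase (@dx F) [:: (Q, y)] = 'X%:P :> R2.
  by rewrite phase1 dxy const3_mul0 addr0.
have py : 'X%:P%:P + phase (@dy F) [:: (Q, y)] = x2.
  by rewrite phase1 dyy rmorph1 mul1r.
have -> : tev 'X%:P x2 L = tev ('X%:P + phase (@dx F) [:: (Q, y)])
    ('X%:P%:P + phase (@dy F) [:: (Q, y)]) L by rewrite px py.
have := @act_estimate F 1 Q Q _ _ (phase_subproof [:: (Q, y)]) Q Q (@wlt_phase_x F Q y)
   (@wlt_phase_y F Q y) Q0 Q0 0 (Q * N0)%N 1 L (@wlt1 F 1 Q Q).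
by rewrite mulr1 add0n; apply=> i j /ordL; rewrite -mulnDl mulnC leq_mul2l => ->; rewrite orbT.
Qed.

(** In the top weight the conjugate is the symbol of [L] with d_y + tau^Q for d_y, expanded by the
    binomial theorem. The total order [N0] forces the original exponent of d_y to be [N0 - i]. *)
Lemma wkb_start_coef e i j : (e + Q * (i + j))%N = (Q * N0)%N ->
  (wkb [:: (Q, y)] L)`_e`_i`_j = L`_i`_(N0 - i) *+ 'C(N0 - i, j).
Proof.
move=> hw.
have -> : (wkb [:: (Q, y)] L)`_e`_i`_j = (tev 'X%:P x2 L)`_e`_i`_j.
  apply/eqP; rewrite -subr_eq0 -!coefB (wlt_coef wkb_start) //; lia.
have ijN : (i + j <= N0)%N by rewrite -(leq_pmul2l Q0); lia.
have term i1 j1 : (const3 F L`_i1`_j1 * ('X%:P ^+ i1 * x2 ^+ j1))`_e`_i`_j =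
    if (i == i1) && (j <= j1)%N && (e == Q * (j1 - j))%N then L`_i1`_j1 *+ 'C(j1, j) else 0.
  rewrite wkb_start_expand mulr_sumr mulr_sumr !coef_sum.
  have sub (l : 'I_j1.+1) : (const3 F L`_i1`_j1 * ('X%:P ^+ i1 * (const3 F 'C(j1, l)%:R *
      ('X^(Q * (j1 - l)) * ('X^l)%:P%:P))))`_e`_i`_j =
      L`_i1`_j1 *+ 'C(j1, l) *+ [&& e == (Q * (j1 - l))%N, i == i1 & j == l].
    have -> : const3 F L`_i1`_j1 * ('X%:P ^+ i1 * (const3 F 'C(j1, l)%:R *
      ('X^(Q * (j1 - l)) * ('X^l)%:P%:P))) =
      ((L`_i1`_j1 * 'C(j1, l)%:R)%:P * 'X^l)%:P%:P * ('X^i1)%:P * 'X^(Q * (j1 - l)).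
      by rewrite !polyCM !polyC_exp /=; ring.
    rewrite -polyCM coefCM coefXn.
    case: (e == _); rewrite ?mulr1 ?mulr0 ?coef0 //.
    rewrite coefCM coefXn; case: (i == i1); rewrite ?mulr1 ?mulr0 ?coef0 //.
    rewrite coefCM coefXn -[X in _ = X *+ _]mulr_natr.
    by case: (j == l); rewrite ?mulr1 ?mulr0 ?mulr1n ?mulr0n.
  rewrite (eq_bigr _ (fun l _ => sub l)).
  case: (leqP j j1) => [le|lt]; last first.
    rewrite andbF /= big1 // => l _.
    have -> : (j == l) = false by apply/eqP => h; have := ltn_ord l; lia.
    by rewrite !andbF.
  have lt : (j < j1.+1)%N by [].
  rewrite (bigD1 (Ordinal lt)) //= eqxx andbT big1 ?addr0.
    by rewrite andbC; case: (i == i1); case: (e == _); rewrite ?mulr1n ?mulr0n.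
  move=> l; rewrite -val_eqE /= => ne.
  by rewrite [j == _]eq_sym (negbTE ne) !andbF.
rewrite /tev !coef_sum.
have big i1 j1 : L`_i1`_j1 != 0 -> (i == i1) && (j <= j1)%N && (e == Q * (j1 - j))%N ->
    i1 = i /\ j1 = (N0 - i)%N.
  move=> _ /andP[/andP[/eqP <- le] /eqP eE]; split=> //.
  have : (Q * (j1 + i) = Q * N0)%N by rewrite -hw eE -mulnDr; congr (_ * _)%N; lia.
  by move/eqP; rewrite eqn_pmul2l // => /eqP <-; rewrite addnK.
have [L0|Li] := eqVneq L`_i`_(N0 - i) 0.
  rewrite L0 mul0rn big1 // => -[i1 /= lt_i1] _; rewrite !coef_sum big1 // => -[j1 /= lt_j1] _.
  rewrite term; case: ifP => // h; have [->|nz] := eqVneq L`_i1`_j1 0; first by rewrite mul0rn.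
  have [e1 e2] := big _ _ nz h; move: nz; rewrite e1 e2 L0 eqxx.
  by [].
have i_lt : (i < size L)%N.
  by rewrite ltnNge; apply: contra Li => le; rewrite (nth_default _ le) coef0.
have j_lt : (N0 - i < size (L`_i)%R)%N.
  by rewrite ltnNge; apply: contra Li => le; rewrite (nth_default _ le).
rewrite (bigD1 (Ordinal i_lt)) //= [X in _ + X]big1 ?addr0; last first.
  move=> i1; rewrite -val_eqE /= => ne; rewrite !coef_sum big1 // => j1 _; rewrite term.
  by rewrite [i == _]eq_sym (negbTE ne).
rewrite !coef_sum (bigD1 (Ordinal j_lt)) //= term eqxx /= [X in _ + X]big1 ?addr0; last first.
  move=> j1; rewrite -val_eqE /= => ne; rewrite term; case: ifP => // h.
  have [->|nz] := eqVneq L`_i`_j1 0; first by rewrite mul0rn.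
  by have [_ e2] := big _ _ nz h; rewrite e2 eqxx in ne.
have -> : (j <= N0 - i)%N by lia.
rewrite (_ : e == _) //; apply/eqP.
have : (Q * (i + j) + Q * (N0 - i - j) = Q * N0)%N by rewrite -mulnDr; congr (_ * _)%N; lia.
lia.
Qed.

Lemma wkb_start_le e i j : (wkb [:: (Q, y)] L)`_e`_i`_j != 0 -> (e + Q * (i + j) <= Q * N0)%N.
Proof.
have w : wlt 1 Q Q (Q * N0).+1 (wkb [:: (Q, y)] L).
  rewrite -(subrK (tev 'X%:P x2 L) (wkb _ L)); apply: wltD.
    by apply: wlt_leq wkb_start.
  rewrite /tev; apply: wlt_sum => i1 _; apply: wlt_sum => j1 _.
  have [->|/ordL le] := eqVneq L`_i1`_j1 0; first by rewrite const3_mul0; exact: wlt0.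
  apply: wlt_scale; apply: (@wlt_leq _ _ _ _ (i1 * Q + j1 * Q).+1); first by nia.
  apply: wltM1; apply: wltX; first exact: wlt_X.
  by apply: wltD; [exact: wlt_Y | exact: wlt_taun].
by move=> /w; lia.
Qed.

End Start.

Lemma newton_start (F : diffField) (y : F) (L : diffop F) (N0 : nat) :
    dx y = 0 -> dy y = 1 ->
    (forall p : {poly F}, (1 < size p)%N -> exists x, root p x) ->
    (forall r : F, exists f, dx f = r) ->
    (forall i j, L`_i`_j != 0 -> (i + j <= N0)%N) ->
    L`_0`_N0 = 0 -> (exists i j, L`_i`_j != 0 /\ (i + j)%N = N0) ->
  exists Q g, [/\ (0 < Q)%N, phase_ok Q g & final_phase L y Q g].
Proof.
move=> dxy dyy closed prim ordL L0 [i0 [j0 [Li0 ij0]]].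
(* The first vertex has [mu <= N0], so this [Q] has the divisibility that [newton] asks for with
   [M = N0]. *)
pose Q := (N0`! ^ N0)%N; have Q0 : (0 < Q)%N by rewrite expn_gt0 fact_gt0.
(* The first vertex is the least power of d_x in the top-order part of [L]; it is positive because
   the coefficient of d_y^N0 vanishes. *)
have exi : exists i, L`_i`_(N0 - i) != 0 by exists i0; rewrite -ij0 addKn.
case: (ex_minnP exi) => mu Lmu mumin.
have muN : (mu <= N0)%N by have := mumin i0; rewrite -ij0 addKn => /(_ Li0); lia.
have mu0 : (0 < mu)%N.
  by case: posnP Lmu => // ->; rewrite subn0 L0 eqxx.
have [||||||||g gok gfin] := @newton F L y N0 Q dxy dyy closed prim Q [::] mu (Q * N0).
- by split.
- by [].
- exact: Q0.
- by rewrite mu0.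
- by move=> x; rewrite inE => /eqP -> /=; exact: dvdn_exp2l.
- exact: wkb_start_le.
- move=> e i j h hw; rewrite (wkb_start_coef dxy dyy Q0 ordL hw) in h.
  apply: leq_trans (leq_addr _ _); apply: mumin.
  by apply: contraNneq h => ->; rewrite mul0rn.
- have hw : (Q * (N0 - mu) + Q * (mu + 0) = Q * N0)%N by rewrite addn0 -mulnDr subnK.
  exists (Q * (N0 - mu))%N, mu, 0%N; rewrite (wkb_start_coef dxy dyy Q0 ordL hw) bin0 mulr1n.
  by rewrite addn0 in hw *.
by exists Q, g.
Qed.

(** * From a final phase to a series solution *)

Section FieldModule.
Variable F : diffField.

Definition field_module : dmodule F.
Proof.
refine (@Dmodule F F (fun c a => c * a) (@dx F) (@dy F) _ _ _ _ _ _ _ _ _).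
- by move=> a b w; rewrite mulrDl.
- by move=> a v w; rewrite mulrDr.
- by move=> a b w; rewrite mulrA.
- exact: mul1r.
- exact: (derD (@is_der_df_x F)).
- exact: (derD (@is_der_df_y F)).
- exact: (derM (@is_der_df_x F)).
- exact: (derM (@is_der_df_y F)).
exact: dx_dy_comm.
Defined.

End FieldModule.

Section Realize.
Variables (F : diffField) (y : F) (Q : nat) (g : seq (nat * F)).
Hypotheses (Q0 : (0 < Q)%N) (gok : phase_ok Q g).
Local Notation R1 := {poly {poly F}}.
Local Notation R2 := {poly {poly {poly F}}}.

(** tau stands for T^(1/Q), so a phase term with tau^n has exponent n/Q; the term y tau^Q accounts
    for the implicit exponent 1. *)
Definition wkb_exponents : (size g).-tuple rat :=
  [tuple of [seq x.1%:R / Q%:R | x <- in_tuple g]].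
Definition wkb_phases : (size g).+1.-tuple F := [tuple of y :: [seq x.2 | x <- in_tuple g]].

Local Notation s := wkb_exponents.
Local Notation f := wkb_phases.
Local Notation S := (ser_module s f).

Lemma Qn0 : (Q%:R : rat) != 0. Proof. by rewrite pnatr_eq0 -lt0n. Qed.

Lemma wkb_exponentsP : G_exponents s.
Proof.
case: gok => gp g0; rewrite /G_exponents /= rcons_path; apply/andP; split.
  pose h (n : nat) : rat := n%:R / Q%:R.
  have h1 : h Q = 1 by rewrite /h divff ?Qn0.
  rewrite -[X in path _ X _]h1.
  have -> : [seq x.1%:R / Q%:R | x <- g] = [seq h n | n <- [seq x.1 | x <- g]].
    by rewrite -map_comp.
  rewrite path_map; apply: sub_path gp => a b /= lt.
  by rewrite /h ltr_pM2r ?ltr_nat // invr_gt0 ltr0n.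
case/lastP: g g0 => [//|g1 x] g0; rewrite map_rcons last_rcons.
by rewrite divr_gt0 // ltr0n // g0 // mem_rcons mem_head.
Qed.

Lemma series_deriv_wkb d (H : rat -> F) t :
  series_deriv s f d H t = d (H t) + \sum_(x <- (Q, y) :: g) d x.2 * H (t - x.1%:R / Q%:R).
Proof.
rewrite /series_deriv big_ord_recl big_cons /= !tnth0 divff ?Qn0 //; congr (_ + (_ + _)).
by rewrite [RHS]big_tnth; apply: eq_bigr => j _; rewrite !tnthS !tnth_map.
Qed.

Let T (K : rat -> F) : rat -> F := fun t => K (t - 1 / Q%:R).
Let psi (c : F) (K : rat -> F) : rat -> F := fun t => c * K t.

Lemma iter_shift n K t : iter n T K t = K (t - n%:R / Q%:R).
Proof.
elim: n t => [|n IH] t; first by rewrite mul0r subr0.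
by rewrite /= /T IH; congr K; rewrite -natr1 mulrDl; ring.
Qed.

(** The coefficient function of a series sees the conjugated operator: tau shifts exponents by 1/Q,
    and the coefficients of its powers act on [F]. *)
Lemma act_wkb L (H : rat -> F) t :
  @act F S L H t = \sum_(e < size (wkb ((Q, y) :: g) L))
     @act F (field_module F) (wkb ((Q, y) :: g) L)`_e (H (t - e%:R / Q%:R)).
Proof.
pose phi (p : R1) : rat -> F := fun t => @act F (field_module F) p (H t).
have TD u v : T (u + v) = T u + T v by [].
have phiD p q : phi (p + q) = phi p + phi q.
  by apply/funext => u; exact: (@actDl F (field_module F)).
have psiD c u v : psi c (u + v) = psi c u + psi c v.
  by apply/funext => w; exact: mulrDr.
have psiT c u : psi c (T u) = T (psi c u) by [].
have phi_psi c p : phi (c%:P%:P * p) = psi c (phi p).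
  by apply/funext => u; exact: (@act_scale F (field_module F)).
transitivity (ext T phi (wkb ((Q, y) :: g) L) t); last first.
  rewrite /ext fct_sumE; apply: eq_bigr => e _; exact: iter_shift.
congr (_ t); apply: esym.
have E1 : ext T phi 1 = H.
  apply: etrans (extC TD phiD 1) _; apply/funext => u; exact: (@act1 F (field_module F)).
rewrite /wkb -[in RHS]E1.
apply: (@act_morph F (phase_module ((Q, y) :: g)) S (ext T phi) L (1 : R2)).
- exact: (extD TD phiD).
- by move=> c B; exact: (ext_scale TD phiD psiD psiT phi_psi).
- move=> B; apply/funext => u; rewrite [RHS]series_deriv_wkb /= mulrDl addrA (extD TD phiD) map_op_dx.
  rewrite (@ext_comm _ _ _ _ TD phiD _ (fun K t => dx (K t))).
  + rewrite (ext_phase _ _ _ TD phiD psiD psiT phi_psi).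
    rewrite -[LHS]/(dx (ext T phi B u) + _ u) fct_sumE; congr (_ + _).
    by apply: eq_bigr => x _; rewrite /psi iter_shift.
  + exact: op_dxD.
  + by move=> K K'; apply/funext => w; exact: (derD (@is_der_df_x F)).
  + by [].
  by move=> p; apply/funext => w; exact: (@act_dx F (field_module F)).
move=> B; apply/funext => u; rewrite [RHS]series_deriv_wkb /= mulrDl addrA (extD TD phiD) map_op_dy.
rewrite (@ext_comm _ _ _ _ TD phiD _ (fun K t => dy (K t))).
+ rewrite (ext_phase _ _ _ TD phiD psiD psiT phi_psi).
  rewrite -[LHS]/(dy (ext T phi B u) + _ u) fct_sumE; congr (_ + _).
  by apply: eq_bigr => x _; rewrite /psi iter_shift.
+ exact: op_dyD.
+ by move=> K K'; apply/funext => w; exact: (derD (@is_der_df_y F)).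
+ by [].
by move=> p; apply/funext => w; exact: (@act_dy F (field_module F)).
Qed.

Hypothesis ode : forall n (a : nat -> F) z, (0 < n)%N ->
  exists2 h, h != 0 & iter n (@dx F) h = \sum_(k < n) a k * iter k (@dx F) h + z.

(** On leading coefficients [L] acts as the ordinary operator [B] of order [mu > 0], which is onto
    and has a non-zero kernel, and it raises exponents by [E / Q]. This is the situation of
    [series_kernel]. *)
Lemma realize_final L : final_phase L y Q g ->
  exists H, [/\ V_G s H, act L (H : S) = 0 & exists t, H t != 0].
Proof.
move=> [E [mu [mu0 AE Aj Amu]]]; set A := wkb ((Q, y) :: g) L in AE Aj Amu.
have sA : (size A <= E.+1)%N by apply/leq_sizeP => e; exact: AE.
pose B x := @act F (field_module F) A`_E x.
have actE (H : S) t : act L H t = \sum_(e < E.+1) @act F (field_module F) A`_e (H (t - e%:R / Q%:R)).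
  rewrite act_wkb -/A (big_ord_widen E.+1
    (fun e => @act F (field_module F) A`_e (H (t - e%:R / Q%:R))) sA) big_mkcond.
  by apply: eq_bigr => e _; case: ltnP => // le; rewrite nth_default // act0l.
have lead t H : bnd t H -> @act F S L H (t + E%:R / Q%:R) = B (H t) /\ bnd (t + E%:R / Q%:R) (@act F S L H).
  move=> bH; split.
    rewrite actE big_ord_recr /= addrK big1 ?add0r // => e _.
    rewrite bH ?act0r //= -addrA -mulrBl ltrDl divr_gt0 ?ltr0n // subr_gt0 ltr_nat.
    exact: ltn_ord.
  move=> t' lt; rewrite actE big1 // => e _; rewrite bH ?act0r //.
  have : (e%:R / Q%:R : rat) <= E%:R / Q%:R.
    by rewrite ler_pM2r ?ler_nat ?invr_gt0 ?ltr0n // -ltnS.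
  lra.
have BE x : B x = \sum_(k < mu.+1) A`_E`_k`_0 * iter k (@dx F) x.
  rewrite /B (@act_box F (field_module F) _ x mu.+1 (maxn 1 (ysize (A`_E : diffop F)))) ?leq_maxr //; last first.
    apply/leq_sizeP => i lt; apply/polyP => j; rewrite coef0; apply/eqP.
    by apply: contraT => /Aj[_]; rewrite leqNgt lt.
  apply: eq_bigr => k _; rewrite (bigD1 (Ordinal (leq_maxl 1 (ysize (A`_E : diffop F))))) //= big1 ?addr0 // => j.
  rewrite -val_eqE /= => j0; suff -> : A`_E`_k`_j = 0 by rewrite mul0r.
  by apply/eqP; apply: contraT => /Aj[]; move/eqP: j0.
have Bsol (z : F) : exists2 x : F, x != 0 & B x = z.
  have [x x0 xE] := ode (fun k => - (A`_E`_k`_0 / A`_E`_mu`_0)) (z / A`_E`_mu`_0) mu0.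
  exists x => //; rewrite BE big_ord_recr /= xE mulrDr mulr_sumr addrA -big_split /=.
  rewrite big1 ?add0r; last first.
    by move=> k _; rewrite mulNr mulrN mulrA mulrCA (divff Amu) mulr1 subrr.
  by rewrite mulrCA (divff Amu) mulr1.
have PhiB (H K : S) : act L (H - K) = act L H - act L K by rewrite actDr actNr.
(* [L] preserves the lattice, and it sends the series with single coefficient [x] at 0, where
   [B x = 1], to one with coefficient 1 at [E / Q]. *)
have epsq : (E%:R / Q%:R : rat) * (G_denominator s)%:R \is a Num.int.
  have [x _ Bx] := Bsol 1.
  pose H0 (t : rat) : F := if t == 0 then x else 0.
  have H0lat : onlat s 0 H0.
    by move=> t; rewrite /H0; case: (t =P 0) => [->|_]; rewrite ?eqxx // subrr mul0r rpred0.
  have H0b : bnd 0 H0 by move=> t t_gt0; rewrite /H0 gt_eqF.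
  have [h _] := lead _ _ H0b; rewrite /H0 eqxx Bx add0r in h.
  have := onlat_act (f := f) (p := L) H0lat (t := E%:R / Q%:R); rewrite h oner_eq0 subr0.
  by apply.
have [x x0 Bx] := Bsol 0.
have [] := @series_kernel F _ s _ (E%:R / Q%:R) B PhiB (fun t0 H => @onlat_act F _ s f L t0 H) epsq lead _ x x0 Bx.
  by move=> z; have [x' _ <-] := Bsol z; exists x'.
by move=> H [VH LH ex]; exists H.
Qed.

End Realize.

Theorem newton_puiseux (F : diffField) (y : F) (L : diffop F) (N0 : nat) :
    dx y = 0 -> dy y = 1 ->
    (forall p : {poly F}, (1 < size p)%N -> exists x, root p x) ->
    (forall n (a : nat -> F) z, (0 < n)%N ->
      exists2 h, h != 0 & iter n (@dx F) h = \sum_(k < n) a k * iter k (@dx F) h + z) ->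
    (forall i j, L`_i`_j != 0 -> (i + j <= N0)%N) ->
    L`_0`_N0 = 0 -> (exists i j, L`_i`_j != 0 /\ (i + j)%N = N0) ->
  exists m (s : m.-tuple rat) (f : m.+1.-tuple F),
    [/\ G_exponents s, tnth f ord0 = y &
      exists H, [/\ V_G s H, act L (H : ser_module s f) = 0 & exists t, H t != 0]].
Proof.
move=> dxy dyy closed ode ordL L0 exL.
have prim (r : F) : exists f, dx f = r.
  have [h _ hE] := ode 1%N (fun _ => 0) r isT.
  by exists h; move: hE; rewrite /= big_ord1 mul0r add0r.
have [Q [g [Q0 gok gfin]]] := newton_start dxy dyy closed prim ordL L0 exL.
exists (size g), (wkb_exponents Q g), (wkb_phases y g); split.
- exact: wkb_exponentsP.
- by [].
exact: realize_final.
Qed.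

(** * Submodules of finite codimension *)

Lemma lin_dep (F : fieldType) (S T : finType) (A : S -> T -> F) : (#|T| < #|S|)%N ->
  exists2 c : S -> F, exists x, c x != 0 & forall y, \sum_x c x * A x y = 0.
Proof.
move=> ltTS; pose M : 'M[F]_(#|S|, #|T|) := \matrix_(i, j) A (enum_val i) (enum_val j).
have : kermx M != 0.
  rewrite -mxrank_eq0 mxrank_ker subn_eq0 -ltnNge.
  exact: leq_ltn_trans (rank_leq_col _) ltTS.
case/rowV0Pn => v /sub_kermxP vM v0.
exists (fun x => v 0 (enum_rank x)).
  case/rV0Pn: v0 => i vi; exists (enum_val i); by rewrite enum_valK.
move=> y; have /rowP/(_ (enum_rank y)) := vM; rewrite !mxE => e; apply: etrans e.
rewrite (reindex (@enum_val S S)) /=; last first.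
  by exists enum_rank => x _; rewrite ?enum_valK ?enum_rankK.
by apply: eq_bigr => i _; rewrite !mxE enum_valK enum_rankK.
Qed.

(** The scalar action is a parameter because linear algebra modulo [P] is needed for operators with
    [op_scale] and for vectors with [vscale]. *)
Record scalar_subspace (F : fieldType) (W : zmodType) (sc : F -> W -> W) (P : W -> Prop) :
    Prop := ScalarSubspace {
  ss_Dl : forall a b w, sc (a + b) w = sc a w + sc b w;
  ss_Dr : forall a v w, sc a (v + w) = sc a v + sc a w;
  ss_A : forall a b w, sc (a * b) w = sc a (sc b w);
  ss_1 : forall w, sc 1 w = w;
  ss_P0 : P 0;
  ss_PD : forall u v, P u -> P v -> P (u + v);
  ss_Psc : forall a v, P v -> P (sc a v)
}.

Section SpanMod.
Variables (F : fieldType) (W : zmodType) (sc : F -> W -> W) (P : W -> Prop).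
Hypothesis lin : scalar_subspace sc P.

Local Notation scDl := (ss_Dl lin).
Local Notation scDr := (ss_Dr lin).
Local Notation scA := (ss_A lin).
Local Notation sc1 := (ss_1 lin).
Local Notation P0 := (ss_P0 lin).
Local Notation PD := (ss_PD lin).
Local Notation Psc := (ss_Psc lin).

Definition spanmod (E : seq W) (w : W) : Prop :=
  exists c : nat -> F, P (w - \sum_(k < size E) sc (c k) E`_k).

Definition cofinite := exists E, forall w, spanmod E w.

Lemma sc0l w : sc 0 w = 0.
Proof. by apply: (addrI (sc 0 w)); rewrite -scDl !addr0. Qed.
Lemma sc0r a : sc a 0 = 0.
Proof. by apply: (addrI (sc a 0)); rewrite -scDr !addr0. Qed.
Lemma scNl a w : sc (- a) w = - sc a w.
Proof. by apply: (addrI (sc a w)); rewrite -scDl !subrr sc0l. Qed.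
Lemma scNr a w : sc a (- w) = - sc a w.
Proof. by apply: (addrI (sc a w)); rewrite -scDr !subrr sc0r. Qed.
Lemma sc_sumr a (I : Type) (s : seq I) (G : I -> W) :
  sc a (\sum_(i <- s) G i) = \sum_(i <- s) sc a (G i).
Proof. exact: (big_morph (sc a) (scDr a) (sc0r a)). Qed.
Lemma sc_suml (I : Type) (s : seq I) (G : I -> F) w :
  sc (\sum_(i <- s) G i) w = \sum_(i <- s) sc (G i) w.
Proof. exact: (big_morph (sc^~ w) (fun a b => scDl a b w) (sc0l w)). Qed.
Lemma PN w : P w -> P (- w).
Proof. by move=> Pw; rewrite -(sc1 w) -scNl; exact: (Psc). Qed.
Lemma P_sum (I : Type) (s : seq I) (Q : pred I) (G : I -> W) :
  (forall i, Q i -> P (G i)) -> P (\sum_(i <- s | Q i) G i).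
Proof. by move=> h; apply: big_ind => //; [exact: P0 | exact: (PD)]. Qed.

Lemma spanmod_P E w : P w -> spanmod E w.
Proof.
move=> Pw; exists (fun _ => 0); rewrite big1 ?subr0 // => k _; exact: sc0l.
Qed.

Lemma spanmodD E v w : spanmod E v -> spanmod E w -> spanmod E (v + w).
Proof.
move=> [c hc] [d hd]; exists (fun k => c k + d k).
under eq_bigr => k _ do rewrite scDl.
by rewrite big_split /= opprD addrACA; exact: (PD).
Qed.

Lemma spanmod_sc E a w : spanmod E w -> spanmod E (sc a w).
Proof.
move=> [c hc]; exists (fun k => a * c k); have := Psc a hc.
rewrite scDr scNr sc_sumr; congr (P (_ - _)).
by apply: eq_bigr => k _; rewrite scA.
Qed.

Lemma spanmod_mem E w : w \in E -> spanmod E w.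
Proof.
move=> wE; exists (fun k => if k == index w E then 1 else 0).
have lt : (index w E < size E)%N by rewrite index_mem.
rewrite (bigD1 (Ordinal lt)) //= eqxx sc1 nth_index // big1 ?addr0 ?subrr; first exact: P0.
move=> k.
by rewrite -val_eqE /= => /negbTE ->; rewrite sc0l.
Qed.

Lemma spanmod_sum E (I : Type) (s : seq I) (Q : pred I) (G : I -> W) :
  (forall i, Q i -> spanmod E (G i)) -> spanmod E (\sum_(i <- s | Q i) G i).
Proof. by move=> h; apply: big_ind => //; [apply: spanmod_P; exact: P0 | exact: spanmodD]. Qed.

Lemma spanmod_trans E E' w : spanmod E w -> (forall e, e \in E -> spanmod E' e) -> spanmod E' w.
Proof.
move=> [c hc] hE; rewrite -(subrK (\sum_(k < size E) sc (c k) E`_k) w).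
apply: spanmodD; first exact: spanmod_P.
by apply: spanmod_sum => k _; apply: spanmod_sc; apply: hE; exact: mem_nth.
Qed.

Lemma spanmod_cat E E' w : spanmod E w -> spanmod (E ++ E') w.
Proof. by move/spanmod_trans; apply=> e eE; apply: spanmod_mem; rewrite mem_cat eE. Qed.

Lemma spanmod_dep E (n : nat) (v : nat -> W) : (size E < n)%N -> (forall k, spanmod E (v k)) ->
  exists2 c : 'I_n -> F, exists k, c k != 0 & P (\sum_(k < n) sc (c k) (v k)).
Proof.
move=> lt hv; pose a k := projT1 (cid (hv k)).
have aP k : P (v k - \sum_(j < size E) sc (a k j) E`_j) by rewrite /a; case: cid.
have [c c0 cA] := @lin_dep F 'I_n 'I_(size E) (fun k j => a k j) ltac:(by rewrite !card_ord).
exists c => //.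
have -> : \sum_(k < n) sc (c k) (v k) =
    \sum_(k < n) sc (c k) (v k - \sum_(j < size E) sc (a k j) E`_j).
  under [RHS]eq_bigr => k _ do rewrite scDr.
  rewrite big_split /= [X in _ = _ + X](_ : _ = 0) ?addr0 //.
  have -> : \sum_(k < n) sc (c k) (- \sum_(j < size E) sc (a k j) E`_j) =
     - \sum_(j < size E) sc (\sum_(k < n) c k * a k j) E`_j.
    under [in RHS]eq_bigr => j _ do rewrite sc_suml.
    rewrite exchange_big -sumrN; apply: eq_bigr => k _.
    by rewrite scNr sc_sumr; congr (- _); apply: eq_bigr => j _; rewrite scA.
  by rewrite big1 ?oppr0 // => j _; rewrite cA sc0l.
by apply: P_sum => k _; exact: (Psc).
Qed.

End SpanMod.

Section OpScale.
Variable F : diffField.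

Lemma op_scaleDl (a b : F) (w : diffop F) : op_scale (a + b) w = op_scale a w + op_scale b w.
Proof. exact: (@dm_scDl F (op_module F)). Qed.
Lemma op_scaleDr (a : F) (v w : diffop F) : op_scale a (v + w) = op_scale a v + op_scale a w.
Proof. exact: (@dm_scDr F (op_module F)). Qed.
Lemma op_scaleA (a b : F) (w : diffop F) : op_scale (a * b) w = op_scale a (op_scale b w).
Proof. exact: (@dm_scA F (op_module F)). Qed.
Lemma op_scale1 (w : diffop F) : op_scale 1 w = w.
Proof. exact: (@dm_sc1 F (op_module F)). Qed.

Variable l : nat.
Local Notation V := 'rV[diffop F]_l.

Definition vscale (a : F) (u : V) : V := map_mx (op_scale a) u.

Lemma vscaleDl a b w : vscale (a + b) w = vscale a w + vscale b w.
Proof. by apply/rowP => i; rewrite !mxE op_scaleDl. Qed.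
Lemma vscaleDr a v w : vscale a (v + w) = vscale a v + vscale a w.
Proof. by apply/rowP => i; rewrite !mxE op_scaleDr. Qed.
Lemma vscaleA a b w : vscale (a * b) w = vscale a (vscale b w).
Proof. by apply/rowP => i; rewrite !mxE op_scaleA. Qed.
Lemma vscale1 w : vscale 1 w = w.
Proof. by apply/rowP => i; rewrite !mxE op_scale1. Qed.

Lemma opmul_const (a : F) (p : diffop F) : opmul (a%:P%:P : diffop F) p = op_scale a p.
Proof.
rewrite opmulE (_ : a%:P%:P = op_scale a 1) ?(@act_scale F) ?(@act1 F) //.
by rewrite /op_scale mulr1.
Qed.

Lemma submodule_vscale (U : V -> Prop) : left_submodule U -> forall a u, U u -> U (vscale a u).
Proof.
move=> [_ _ Um] a u /(Um (a%:P%:P)); congr U; apply/rowP => i; rewrite !mxE.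
exact: opmul_const.
Qed.

(** At every large integer one of the finitely many [P - j] vanishes, so their product has too many
    roots and one factor is zero. *)
Lemma poly_nat_const (P : {poly rat}) (C z0 : nat) :
    (forall z, (z0 <= z)%N -> exists2 n, (n <= C)%N & P.[z%:R] = n%:R) ->
  (size P <= 1)%N.
Proof.
move=> hP; pose Q := \prod_(j < C.+1) (P - (j%:R : rat)%:P).
have Q0 : Q = 0.
  apply/eqP/negPn/negP => Q0.
  pose rs := [seq (z%:R : rat) | z <- iota z0 (size Q)].
  have := @max_poly_roots _ Q rs Q0.
  rewrite size_map size_iota ltnn; move=> h; suff : false by []; apply: h.
    apply/allP => _ /mapP[z + ->]; rewrite mem_iota => /andP[hz _].
    have [n nC Pn] := hP z hz; apply/rootP; rewrite horner_prod.
    apply/eqP/prodf_eq0; exists (Ordinal (nC : (n < C.+1)%N)) => //.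
    by rewrite !hornerE Pn subrr.
  rewrite map_inj_in_uniq ?iota_uniq // => x y _ _ /eqP.
  by rewrite eqr_nat => /eqP.
have /prodf_eq0[j _] : Q == 0 by rewrite Q0.
rewrite subr_eq0 => /eqP ->; exact: size_polyC_leq1.
Qed.

(** A finite spanning set modulo [U] bounds all dimensions counted by the Hilbert-Kolchin
    polynomial, which would then be constant. *)
Lemma type_not_cofinite (U : V -> Prop) tau : left_submodule U ->
  differential_type U tau -> (1 <= tau)%N -> ~ cofinite vscale U.
Proof.
move=> Us [P [z0 hP] sP] tau1 [E hE].
have [U0 UD _] := Us.
have lin : scalar_subspace vscale U := ScalarSubspace vscaleDl vscaleDr vscaleA vscale1 U0 UD
  (submodule_vscale Us).
suff : (size P <= 1)%N by rewrite sP; lia.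
apply: (@poly_nat_const P (size E) z0) => z /hP[n [e [_ ind _]] Pn]; exists n => //.
rewrite leqNgt; apply/negP => lt.
pose v k : V := if insub k is Some i then e i else 0.
have [c [k ck] Uc] := @spanmod_dep F V vscale U lin E n v lt (fun k => hE _).
move/eqP: ck; apply; apply: (ind c); move: Uc; congr U.
by apply: eq_bigr => i _; rewrite /v valK.
Qed.

End OpScale.

(** * Leading exponents and pseudo-division of operators *)

Section OperatorRing.
Variable F : diffField.
Implicit Types p q r P Q S L : diffop F.

Lemma opmul0l p : opmul 0 p = 0.
Proof. by rewrite opmulE act0l. Qed.
Lemma opmul0r p : opmul p 0 = 0.
Proof. by rewrite opmulE act0r. Qed.
Lemma opmulNl p q : opmul (- p) q = - opmul p q.
Proof. by rewrite !opmulE actNl. Qed.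
Lemma opmul_suml (I : Type) (s : seq I) (A : pred I) (G : I -> diffop F) q :
  opmul (\sum_(i <- s | A i) G i) q = \sum_(i <- s | A i) opmul (G i) q.
Proof. by rewrite opmulE act_suml; apply: eq_bigr => i _; rewrite opmulE. Qed.
Lemma opmul_scale c p q : opmul (op_scale c p) q = op_scale c (opmul p q).
Proof. by rewrite !opmulE (@act_scale F (op_module F)). Qed.
Lemma opmul1l p : opmul 1 p = p.
Proof. by rewrite opmulE act1. Qed.

Lemma opmul_opmon i j p : opmul (opmon F i j) p = iter i (@op_dx F) (iter j (@op_dy F) p).
Proof.
rewrite opmulE act_opmon; have -> : iter j (@dm_y F (op_module F)) p = iter j (@op_dy F) p.
  by apply: eq_iter => q; exact: op_module_dy.
by apply: eq_iter => q; rewrite op_module_dx.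
Qed.

Lemma op_monomials p m n : (size p <= m)%N -> (ysize p <= n)%N ->
  p = \sum_(i < m) \sum_(j < n) op_scale p`_i`_j (opmon F i j).
Proof.
move=> hm hn; rewrite -{1}[p]opmul_1r opmulE (act_box _ hm hn).
apply: eq_bigr => i _; apply: eq_bigr => j _; rewrite op_module_sc; congr op_scale.
by rewrite -act_opmon -opmulE opmul_1r.
Qed.

Lemma polyC_opmon (b : {poly F}) n : (size b <= n)%N ->
  (b%:P : diffop F) = \sum_(j < n) op_scale b`_j (opmon F 0 j).
Proof.
move=> hn; rewrite [LHS](@op_monomials _ 1 n) ?size_polyC_leq1 //; last first.
  by apply/bigmax_leqP => i _; rewrite coefC; case: ifP => // _; rewrite size_poly0.
by rewrite big_ord1; apply: eq_bigr => j _; rewrite coefC.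
Qed.

Lemma coef_neq0_lt p i j : p`_i`_j != 0 -> (i < size p)%N && (j < ysize p)%N.
Proof.
move=> h; apply/andP; split; rewrite ltnNge; apply/negP => le.
  by rewrite (nth_default _ le) coef0 eqxx in h.
by rewrite (nth_default _ (leq_trans (size_coef_ysize _ _) le)) eqxx in h.
Qed.

Lemma topp_uniq a b p i j i' j' : topp a b p i j -> topp a b p i' j' -> i = i' /\ j = j'.
Proof.
move=> [p0 hp] [p'0 hp']; have [[-> ->] //|ne] := pselect ((i, j) = (i', j')).
have := hp' _ _ p0 ne; have := hp _ _ p'0 (fun e => ne (esym e)); lia.
Qed.

Lemma topp_exists a b p : p != 0 ->
    (forall i j i' j', p`_i`_j != 0 -> p`_i'`_j' != 0 ->
       (a * i + b * j = a * i' + b * j')%N -> (i, j) = (i', j')) ->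
  exists i j, topp a b p i j.
Proof.
move=> p0 inj.
have lp0 : lead_coef p != 0 by rewrite lead_coef_eq0.
have c0 : p`_(size p).-1`_(size (lead_coef p)).-1 != 0 by rewrite -/(lead_coef p) -lead_coefE lead_coef_eq0.
have /andP[h1 h2] := coef_neq0_lt c0.
pose A (x : 'I_(size p) * 'I_(ysize p)) := p`_(x.1)`_(x.2) != 0.
pose w (x : 'I_(size p) * 'I_(ysize p)) := (a * x.1 + b * x.2)%N.
have A0 : A (Ordinal h1, Ordinal h2) by [].
have [[i j] Aij hmax] := arg_maxnP w A0.
exists i, j; split=> // i' j' p'0 ne.
have /andP[h1' h2'] := coef_neq0_lt p'0.
have := hmax (Ordinal h1', Ordinal h2') p'0; rewrite /w /= leq_eqVlt => /orP[/eqP e|//].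
by case: ne; apply: inj.
Qed.

(** A weight [B] of d_x above every exponent of d_y in [p] compares powers of d_x first. *)
Lemma topp_lex B p : p != 0 -> (ysize p <= B)%N -> exists j, topp B 1 p (size p).-1 j.
Proof.
move=> p0 hB.
have [|i [j tp]] := @topp_exists B 1 p p0.
  move=> i j i' j' /coef_neq0_lt/andP[_ h1] /coef_neq0_lt/andP[_ h2] e.
  have eij : i = i' by nia.
  by rewrite eij in e *; congr pair; lia.
exists j; suff <- : i = (size p).-1 by [].
have c0 : p`_(size p).-1`_(size (lead_coef p)).-1 != 0.
  by rewrite -/(lead_coef p) -lead_coefE lead_coef_eq0 lead_coef_eq0.
have [pij hp] := tp; have /andP[h1 h2] := coef_neq0_lt pij.
have [[-> _] //|ne] := pselect (((size p).-1, (size (lead_coef p)).-1) = (i, j)).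
by have := hp _ _ c0 ne; nia.
Qed.

(** Leading exponents add for a lexicographic weight that suits all three operators at once. *)
Lemma size_opmul S L : S != 0 -> L != 0 -> size (opmul S L) = (size S + size L).-1.
Proof.
move=> S0 L0.
pose B := (maxn (ysize S) (maxn (ysize L) (ysize (opmul S L))).+1).
have [|j1 t1] := @topp_lex B S S0; first by rewrite /B; lia.
have [|j2 t2] := @topp_lex B L L0; first by rewrite /B; lia.
have t := @topp_opmul F B 1 S L _ _ _ _ ltac:(by rewrite /B; lia) isT t1 t2.
have n0 : opmul S L != 0 by apply: contraNneq t.1 => ->; rewrite !coef0.
have [|j3 t3] := @topp_lex B _ n0; first by rewrite /B; lia.
have [e _] := topp_uniq t t3.
have : (0 < size S)%N by rewrite lt0n size_poly_eq0.
have : (0 < size L)%N by rewrite lt0n size_poly_eq0.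
have : (0 < size (opmul S L))%N by rewrite lt0n size_poly_eq0.
lia.
Qed.

Lemma opmul_neq0 S L : S != 0 -> L != 0 -> opmul S L != 0.
Proof.
move=> S0 L0; rewrite -size_poly_gt0 size_opmul //.
by move: S0 L0; rewrite -!size_poly_gt0; lia.
Qed.

(* The weights [(B + 1, B)] compare monomials by total order first and by [dx]-order next. *)
Lemma topp_grlex B p : p != 0 -> (size p <= B)%N -> exists i j, topp B.+1 B p i j.
Proof.
move=> p0 hB; apply: topp_exists => // i j i' j' /coef_neq0_lt/andP[h1 _] /coef_neq0_lt/andP[h2 _] e.
have e' : (B * (i + j) + i = B * (i' + j') + i')%N by nia.
have eij : (i + j = i' + j')%N by nia.
by rewrite eij in e'; congr pair; lia.
Qed.

Lemma topp_grlex_order B p i j i' j' : (size p <= B)%N -> topp B.+1 B p i j ->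
  p`_i'`_j' != 0 -> (i' + j' <= i + j)%N.
Proof.
move=> hB [pij hp] p'0; have [[-> ->] //|ne] := pselect ((i', j') = (i, j)).
have := hp _ _ p'0 ne; have /andP[h1 _] := coef_neq0_lt pij; nia.
Qed.

Lemma topp_good B P n : (0 < B)%N -> op_order_le n P -> P`_n`_0 != 0 -> topp B.+1 B P n 0.
Proof.
move=> B0 hP Pn; split=> // i j /hP le ne.
have : (i + j < n)%N \/ (i + j = n /\ i < n)%N.
  have [e|e] := eqVneq (i + j)%N n; last by left; lia.
  right; split=> //; have [e2|] := eqVneq i n; last by lia.
  by case: ne; congr pair; lia.
nia.
Qed.

Lemma topp_polyC a b (c : {poly F}) : (0 < b)%N -> c != 0 ->
  topp a b (c%:P : diffop F) 0 (size c).-1.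
Proof.
move=> b0 c0; split; first by rewrite coefC /= -lead_coefE lead_coef_eq0.
move=> i j; rewrite coefC; case: (i =P 0%N) => [->|_]; last by rewrite coef0 eqxx.
move=> cj ne; have lt : (j < size c)%N.
  by rewrite ltnNge; apply/negP => h; rewrite nth_default ?eqxx in cj.
have [e|] := eqVneq j (size c).-1; last by nia.
by rewrite e in ne.
Qed.

Lemma topp_opmon a b i j : topp a b (opmon F i j) i j.
Proof.
have cE i' j' : (opmon F i j)`_i'`_j' = if (i' == i) && (j' == j) then 1 else 0.
  by rewrite -[opmon F i j](op_scale1 (opmon F i j)) coef_opmon.
split; first by rewrite cE !eqxx oner_neq0.
move=> i' j'; rewrite cE; case: ifP => [/andP[/eqP -> /eqP ->]|]; last by rewrite eqxx.
by move=> _ [].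
Qed.

Lemma size_iter_op i j p :
  (size (iter i (@op_dx F) (iter j (@op_dy F) p)) <= size p + i)%N /\
  (ysize (iter i (@op_dx F) (iter j (@op_dy F) p)) <= ysize p + j)%N.
Proof.
pose inbox m n (q : diffop F) := forall i j, q`_i`_j != 0 -> (i < m)%N && (j < n)%N.
have sz m n q : inbox m n q -> (size q <= m)%N /\ (ysize q <= n)%N.
  move=> h; split.
    apply/leq_sizeP => k hk; apply/polyP => k'; rewrite coef0; apply/eqP/negPn/negP => /h; lia.
  apply/bigmax_leqP => k _; apply/leq_sizeP => k' hk; apply/eqP/negPn/negP => /h; lia.
apply: sz.
have x0 := der0 (@is_der_df_x F); have y0 := der0 (@is_der_df_y F).
elim: i => [|i IH] /=.
  elim: j => [|j IH] /= a b; first by rewrite !addn0; exact: coef_neq0_lt.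
  rewrite coef_op_dy => h.
  have [e|/IH] := eqVneq (iter j (@op_dy F) p)`_a`_b 0; last by lia.
  move: h; rewrite e y0 add0r; case: b {e} => [|b]; rewrite ?eqxx //= => /IH; lia.
move=> a b; rewrite coef_op_dx => h.
have [e|/IH] := eqVneq (iter i (@op_dx F) (iter j (@op_dy F) p))`_a`_b 0; last first.
  by case/andP=> u v; rewrite v andbT addnS ltnS ltnW.
move: h; rewrite e x0 add0r; case: a {e} => [|a]; rewrite ?eqxx //= => /IH.
by case/andP=> u v; rewrite v andbT addnS ltnS.
Qed.

(* Counting dimensions: [b] and [S] of order at most [J] in [dy] depend on more coefficients than the
   coefficients of [dx]-order at least [n1] to be cancelled, once [J] is large. *)
Lemma pseudo_division Q L n1 : size L = n1.+1 ->
  exists2 b : {poly F}, b != 0 &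
    exists S, (size (opmul (b%:P : diffop F) Q - opmul S L)%R <= n1)%N.
Proof.
move=> sL; have L0 : L != 0 by rewrite -size_poly_gt0 sL.
case: (leqP (size Q) n1) => [le|lt].
  by exists 1; [exact: oner_neq0 | exists 0; rewrite opmul0l subr0 opmul1l].
pose e := (size Q - n1)%N; have eE : (n1 + e)%N = size Q by rewrite subnKC // ltnW.
(* There are [(e + 1) * J] unknown coefficients of [b] and [S] and [e * (J + D)] coefficients to
   cancel; [J > e * D] makes the unknowns more numerous. *)
pose D := maxn (ysize Q) (ysize L); pose J := (e * D).+1.
pose vec (x : option 'I_e * 'I_J) : diffop F :=
  if x.1 is Some i then opmul (opmon F i x.2) L else opmul (opmon F 0 x.2) Q.
have [|c [x0 cx0] hc] := @lin_dep F _ _ (fun x (y : 'I_e * 'I_(J + D)) => (vec x)`_(n1 + y.1)`_(y.2)).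
  by rewrite !card_prod card_option !card_ord /J /e; nia.
pose b : {poly F} := \poly_(j < J) (if insub j is Some j' then c (None, j') else 0).
have bE (j : 'I_J) : b`_j = c (None, j) by rewrite coef_poly ltn_ord valK.
pose S : diffop F := - \sum_(i < e) \sum_(j < J) op_scale (c (Some i, j)) (opmon F i j).
have RE : opmul (b%:P : diffop F) Q - opmul S L = \sum_x op_scale (c x) (vec x).
  rewrite (@polyC_opmon b J) ?size_poly // opmul_suml opmulNl opprK opmul_suml.
  transitivity (\sum_i \sum_j op_scale (c (i, j)) (vec (i, j))); last first.
    by rewrite pair_big /=; apply: eq_bigr => -[].
  rewrite (bigD1 None) //=; congr (_ + _).
    by apply: eq_bigr => j _; rewrite opmul_scale bE.
  rewrite (reindex_omap Some id) //=; last by case.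
  apply: eq_big => [i|i _]; first by rewrite eqxx.
  by rewrite opmul_suml; apply: eq_bigr => j _; rewrite opmul_scale.
have vbox x i j : (vec x)`_i`_j != 0 -> (i < size Q)%N && (j < J + D)%N.
  move/coef_neq0_lt => /andP[hi hj]; rewrite /vec in hi hj.
  case: x hi hj => -[k|] k' /=; rewrite opmul_opmon => hi hj; apply/andP; split.
  - apply: leq_trans hi (leq_trans (size_iter_op _ _ _).1 _).
    by rewrite sL -eE; have := ltn_ord k; lia.
  - apply: leq_trans hj (leq_trans (size_iter_op _ _ _).2 _).
    by rewrite addnC leq_add ?leq_maxr // ltnW.
  - by apply: leq_trans hi (leq_trans (size_iter_op 0 _ _).1 _); rewrite addn0.
  apply: leq_trans hj (leq_trans (size_iter_op 0 _ _).2 _).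
  by rewrite addnC leq_add ?leq_maxl // ltnW.
have sR : (size (opmul (b%:P : diffop F) Q - opmul S L)%R <= n1)%N.
  rewrite RE; apply/leq_sizeP => i hi; apply/polyP => j; rewrite coef0 !coef_sum.
  have coefE x : (op_scale (c x) (vec x))`_i`_j = c x * (vec x)`_i`_j.
    by rewrite /op_scale !coefCM.
  have [ltj|gej] := ltnP j (J + D); last first.
    apply: big1 => x _; rewrite coefE; have [->|/vbox] := eqVneq (vec x)`_i`_j 0; first by rewrite mulr0.
    by lia.
  have [lti|gei] := ltnP i (size Q); last first.
    apply: big1 => x _; rewrite coefE; have [->|/vbox] := eqVneq (vec x)`_i`_j 0; first by rewrite mulr0.
    by lia.
  have lt' : (i - n1 < e)%N by rewrite /e; lia.
  rewrite -[RHS](hc (Ordinal lt', Ordinal ltj)) /= subnKC //.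
  by apply: eq_bigr => x _; rewrite coefE.
exists b; last by exists S.
(* If [b] were zero, [opmul S L] would have smaller d_x-order than [L], hence [S = 0], and all the
   unknowns would vanish. *)
apply/eqP => b0; move: sR; rewrite b0 opmul0l add0r size_polyN.
have [S0|S0] := eqVneq S 0; last first.
  by rewrite size_opmul // sL; move: S0; rewrite -size_poly_gt0; lia.
move=> _; move/eqP: cx0; apply; case: x0 => -[i|] j; last by rewrite -bE b0 coef0.
move/eqP: S0; rewrite oppr_eq0 => /eqP/(congr1 (fun p : {poly {poly F}} => p`_i`_j)).
rewrite !coef0 coef_sum coef_sum (bigD1 i) //= !coef_sum (bigD1 j) //= coef_opmon !eqxx /=.
rewrite [X in _ + X]big1 => [|i' ne].
  rewrite [X in _ + X + _]big1 ?addr0 // => j' ne; rewrite coef_opmon eqxx /=.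
  by case: eqP => // h; rewrite (val_inj h) eqxx in ne.
rewrite !coef_sum big1 // => j' _; rewrite coef_opmon.
by case: eqP => //= h; rewrite (val_inj h) eqxx in ne.
Qed.

End OperatorRing.

(** * Left ideals of finite codimension and generators of the others *)

Section LeftIdeals.
Variable F : diffField.
Implicit Types p q r P Q S L : diffop F.

Definition left_ideal (I : diffop F -> Prop) : Prop :=
  [/\ I 0, forall p q, I p -> I q -> I (p + q) & forall r p, I p -> I (opmul r p)].

Variables (I : diffop F -> Prop) (idI : left_ideal I).

Lemma left_ideal_scale c p : I p -> I (op_scale c p).
Proof. by rewrite -opmul_const; case: idI => _ _; apply. Qed.

Lemma left_idealB p q : I p -> I q -> I (p - q).
Proof.
move=> Ip /(left_ideal_scale (- 1)) Iq; have [_ ID _] := idI.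
have := ID _ _ Ip Iq; congr (I (_ + _)).
by have := @dm_scNl F (op_module F) 1 q; rewrite (@dm_sc1 F (op_module F)).
Qed.

Lemma left_ideal_subspace : scalar_subspace (@op_scale F) I.
Proof.
have [I0 ID _] := idI.
exact: ScalarSubspace (@op_scaleDl F) (@op_scaleDr F) (@op_scaleA F) (@op_scale1 F) I0 ID
  left_ideal_scale.
Qed.

(** In finite codimension the powers of d_y are linearly dependent modulo [I]. *)
Lemma cofinite_const : cofinite (@op_scale F) I -> exists2 b : {poly F}, b != 0 & I b%:P.
Proof.
move=> [E hE].
have [c [k ck] Ic] := spanmod_dep left_ideal_subspace (leqnn (size E).+1) (fun k => hE (opmon F 0 k)).
pose b : {poly F} := \poly_(j < (size E).+1) (if insub j is Some j' then c j' else 0).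
have bE (j : 'I_(size E).+1) : b`_j = c j by rewrite coef_poly ltn_ord valK.
exists b; first by apply: contraNneq ck => b0; rewrite -bE b0 coef0.
rewrite (@polyC_opmon F b (size E).+1) ?size_poly //; move: Ic; congr I.
by apply: eq_bigr => j _; rewrite bE.
Qed.

Lemma spanmod_support E q :
  (forall i j, q`_i`_j != 0 -> spanmod (@op_scale F) I E (opmon F i j)) ->
  spanmod (@op_scale F) I E q.
Proof.
move=> h; rewrite (@op_monomials F q _ _ (leqnn _) (leqnn _)).
have lin := left_ideal_subspace.
apply: (spanmod_sum lin) => i _; apply: (spanmod_sum lin) => j _.
have [->|/h] := eqVneq (q : {poly {poly F}})`_i`_j 0; last exact: spanmod_sc.
apply: (spanmod_P lin); rewrite /op_scale /= mul0r; exact: ss_P0 lin.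
Qed.

Lemma spanmod_topp E (W : diffop F) i j : I W -> W`_i`_j != 0 ->
  (forall i' j', W`_i'`_j' != 0 -> (i', j') <> (i, j) -> spanmod (@op_scale F) I E (opmon F i' j')) ->
  spanmod (@op_scale F) I E (opmon F i j).
Proof.
move=> IW W0 h; have lin := left_ideal_subspace.
pose V := op_scale (W`_i`_j)^-1 W.
have IV : I V by exact: left_ideal_scale.
rewrite -[opmon F i j](subrK V); apply: (spanmodD lin); last exact: (spanmod_P lin).
apply: spanmod_support => i' j'.
rewrite -[opmon F i j](op_scale1 (opmon F i j)) 2!coefB coef_opmon /V /op_scale !coefCM.
case: ifP => [/andP[/eqP -> /eqP ->]|ne]; first by rewrite mulVf // subrr eqxx.
rewrite sub0r oppr_eq0 mulf_eq0 negb_or => /andP[_ W'0].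
by apply: h => // -[ei ej]; rewrite ei ej !eqxx in ne.
Qed.

(** [P] rewrites the multiples of d_x^n and [b] those of d_y^m, where m is the degree of [b]; every
    monomial of order at least n + m is one or the other. *)
Lemma cofinite_good n P (b : {poly F}) : I P -> op_order_le n P -> P`_n`_0 != 0 ->
  b != 0 -> I b%:P -> cofinite (@op_scale F) I.
Proof.
move=> IP hP Pn b0 Ib; have [_ _ IM] := idI; have lin := left_ideal_subspace.
pose m := (size b).-1; pose E := [seq opmon F i j | i <- iota 0 (n + m), j <- iota 0 (n + m)].
exists E => w; apply: spanmod_support => i j _ {w}.
(* The outer induction is on the order, the inner one on the power of d_x: [P] may keep the order
   but then lowers the power of d_x, while [b] always lowers the order. *)
have [d] := ubnP (i + j); elim: d i j => // d IHd i j.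
have [e] := ubnP i; elim: e i j => // e IHe i j lte ltd.
have [small|big] := ltnP (i + j) (n + m).
  apply: (spanmod_mem lin); apply/allpairsP; exists (i, j); split=> //; rewrite mem_iota /=; lia.
have [ni|lt_in] := leqP n i.
  have B0 : (0 < i.+1)%N by [].
  have := topp_opmul (isT : (0 < i.+2)%N) B0 (topp_opmon F i.+2 i.+1 (i - n) j) (topp_good B0 hP Pn).
  rewrite subnK // addn0 => -[W0 hW].
  apply: (spanmod_topp (IM _ _ IP) W0) => i' j' W'0 ne.
  have := hW _ _ W'0 ne => lt.
  have [lt'|ge] := ltnP (i' + j') d; first exact: IHd.
  apply: IHe; nia.
have jm : (m <= j)%N by lia.
have := topp_opmul (isT : (0 < 1)%N) (isT : (0 < 1)%N) (topp_opmon F 1 1 i (j - m)) (@topp_polyC F 1 1 b isT b0).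
rewrite subnK // addn0 => -[W0 hW].
apply: (spanmod_topp (IM _ _ Ib) W0) => i' j' W'0 ne.
by have := hW _ _ W'0 ne => lt; apply: IHd; lia.
Qed.

(** [L] has least d_x-order in [I], so pseudo-division by it leaves no remainder. Its highest power
    of d_x occurs in the top total order because of b P = S L: the leading monomial of b P contains
    d_x^n, leading exponents add, and the d_x-orders of [S] and [L] sum to exactly [n]. *)
Lemma ideal_generator n P : I P -> op_order_le n P -> P`_n`_0 != 0 ->
    (forall b : {poly F}, I b%:P -> b = 0) ->
  exists L n1 a, [/\ (0 < n1)%N,
    forall i j, L`_i`_j != 0 -> (i <= n1)%N /\ (i + j <= n1 + a)%N, L`_n1`_a != 0 &
    forall Q, I Q -> exists2 b : {poly F}, b != 0 & exists S,
      opmul (b%:P : diffop F) Q = opmul S L].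
Proof.
move=> IP hP Pn noconst; have [_ _ IM] := idI.
have P0 : P != 0 by apply: contraNneq Pn => ->; rewrite !coef0.
have [k [L [IL L0 sL] kmin]] : exists2 k, (exists L, [/\ I L, L != 0 & size L = k]) &
    forall L, I L -> L != 0 -> (k <= size L)%N.
  have ex : exists k, `[< exists L, [/\ I L, L != 0 & size L = k] >].
    by exists (size P); apply/asboolP; exists P.
  case: (ex_minnP ex) => k /asboolP hk kmin; exists k => // L IL L0.
  by apply: kmin; apply/asboolP; exists L.
have k1 : (1 < k)%N.
  rewrite ltnNge; apply/negP => le; move: L0.
  have LE : L = (L`_0)%:P by apply: size1_polyC; rewrite sL.
  by rewrite LE (noconst L`_0) ?polyC0 ?eqxx // -LE.
have gen Q : I Q -> exists2 b : {poly F}, b != 0 & exists S,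
      opmul (b%:P : diffop F) Q = opmul S L.
  move=> IQ; have [|b b0 [S hS]] := @pseudo_division F Q L k.-1; first by rewrite sL; lia.
  exists b => //; exists S; apply/eqP; rewrite -subr_eq0; apply/negPn/negP => R0.
  have := kmin _ (left_idealB (IM (b%:P) _ IQ) (IM S _ IL)) R0; lia.
have [b b0 [S e]] := gen _ IP.
have S0 : S != 0.
  apply/eqP => S0; move/eqP: e; rewrite S0 opmul0l; apply/negP.
  by apply: opmul_neq0 => //; rewrite polyC_eq0.
have sP : size P = n.+1.
  apply/eqP; rewrite eqn_leq; apply/andP; split.
    apply/leq_sizeP => i hi; apply/polyP => j; rewrite coef0; apply/eqP/negPn/negP => /hP; lia.
  rewrite ltnNge; apply/negP => le; by rewrite (nth_default _ le) coef0 eqxx in Pn.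
have sE : (size S + size L)%N = n.+2.
  have := size_opmul S0 L0; rewrite -e size_opmul ?polyC_eq0 // size_polyC b0 sP.
  by move: S0 L0; rewrite -!size_poly_gt0; lia.
pose B := (size S + size L)%N.
have [|i1 [j1 t1]] := @topp_grlex F B S S0; first exact: leq_addr.
have lB : (size L <= B)%N by exact: leq_addl.
have [i2 [j2 t2]] := @topp_grlex F B L L0 lB.
have B0 : (0 < B)%N by rewrite /B sE.
have t := topp_opmul (isT : (0 < B.+1)%N) B0 t1 t2.
have t' := topp_opmul (isT : (0 < B.+1)%N) B0 (topp_polyC B.+1 B0 b0) (topp_good B0 hP Pn).
rewrite e in t'; have [ei _] := topp_uniq t t'.
have /andP[h1 _] := coef_neq0_lt t1.1; have /andP[h2 _] := coef_neq0_lt t2.1.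
have i2E : i2 = k.-1 by lia.
exists L, k.-1, j2; split => //.
- lia.
- move=> i j Lij; have /andP[hi _] := coef_neq0_lt Lij; rewrite -i2E; split; first by lia.
  exact: topp_grlex_order lB t2 Lij.
- by rewrite -i2E; case: t2.
Qed.

End LeftIdeals.

(** * Straightening *)

Section TransportEstimates.
Variables (F : diffField) (d e : F -> F) (dP : is_derivation d) (eP : is_derivation e).
Hypothesis de : forall a, d (e a) = e (d a).
Variables (al be ga ep : F).
Hypotheses (dxE : forall a, dx a = al * d a + be * e a) (dyE : forall a, dy a = ga * d a + ep * e a).
Hypotheses (hX : dx ga = dy al) (hY : dx ep = dy be).
Local Notation tr := (trans dP eP de hX hY).

Lemma wlt_linear x y : wlt 0 1 1 2 (const2 F x * 'X + const2 F y * 'X%:P)%:P.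
Proof.
rewrite polyCD !polyCM; apply: wltD.
  by apply: (@wlt_scale F 0 1 1 2 x 'X%:P); exact: wlt_X.
by apply: (@wlt_scale F 0 1 1 2 y 'X%:P%:P); exact: wlt_Y.
Qed.

(** In the top order a change of derivations is a linear substitution in the symbol. *)
Lemma trans_coef (L : diffop F) N0 i' j' : (forall i j, L`_i`_j != 0 -> (i + j <= N0)%N) ->
  (N0 <= i' + j')%N ->
  (tr L : {poly {poly F}})`_i'`_j' = (ev1 (tr_x al be) (tr_y ga ep) L)`_i'`_j'.
Proof.
move=> ordL le.
have sp := trans_subproof hX hY.
have C1 : wlt 0 1 1 1 (1%:P : {poly {poly {poly F}}}) by exact: wlt1.
have := @act_estimate F 0 1 1 _ _ (x12_lift sp) 1 1 (@wlt_linear al be) (@wlt_linear ga ep) isT isT 0 N0 1%:P L C1.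
have hp i j : L`_i`_j != 0 -> (i * 1 + j * 1 <= N0)%N by rewrite !muln1; exact: ordL.
move/(_ hp); rewrite -act_lift tev_lift mulr1 -polyCB => h.
have := wlt_coef (e := 0) (i := i') (j := j') h; rewrite coefC /= 2!coefB mul0n !mul1n add0n => /(_ le)/eqP.
by rewrite subr_eq0 => /eqP.
Qed.

Lemma trans_order (L : diffop F) N0 : op_order_le N0 L -> op_order_le N0 (tr L).
Proof.
move=> ordL i' j' h; rewrite leqNgt; apply/negP => lt; move/eqP: h; apply.
apply: etrans (trans_coef ordL (ltnW lt)) _.
have w : wlt 0 1 1 N0.+1 (ev1 (tr_x al be) (tr_y ga ep) L)%:P.
  rewrite -tev_lift; apply: wlt_sum => i _; apply: wlt_sum => j _.
  have [L0|/ordL le] := eqVneq L`_i`_j 0; first by rewrite L0 rmorph0 mul0r; exact: wlt0.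
  have h := wltM1 (wltX (i := i) (@wlt_linear al be)) (wltX (i := j) (@wlt_linear ga ep)).
  apply: wlt_scale; apply: wlt_leq h; lia.
have := wlt_coef (e := 0) (i := i') (j := j') w; rewrite coefC; apply; lia.
Qed.

Lemma trans_ser m (s : m.-tuple rat) (f : m.+1.-tuple F) (L : diffop F) (H : rat -> F) :
  act L (H : ser_module s f) =
  (act (tr L) (H : ser_module s (f : m.+1.-tuple (cf dP eP de))) : rat -> F).
Proof.
have lin (u : F -> F) x y (K : rat -> F) : (forall a, u a = x * d a + y * e a) ->
    series_deriv s f u K = (fun t => x * series_deriv s f d K t + y * series_deriv s f e K t).
  move=> uE; apply/funext => t; rewrite /series_deriv uE.
  rewrite !mulrDr addrACA !mulr_sumr -big_split; congr (_ + _); apply: eq_bigr => j _.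
  by rewrite /= uE; ring.
apply: (@trans_act F d e dP eP de al be ga ep dxE dyE hX hY
  (ser_module s f) (@ser_module (cf dP eP de) m s f) id) => // K; exact: lin.
Qed.

End TransportEstimates.

Lemma antidiagonal_sum (F : fieldType) (q : {poly F}) (N i : nat) (G : F -> nat -> F) : (forall j, G 0 j = 0) ->
  \sum_(j < size q) (if (N == i + j)%N then G q`_j j else 0) =
  if (i <= N)%N then G q`_(N - i) (N - i)%N else 0.
Proof.
move=> G0; case: leqP => [le|lt]; last first.
  by rewrite big1 // => j _; case: eqP => // e; lia.
case: (ltnP (N - i) (size q)) => h; last first.
  rewrite nth_default // G0 big1 // => j _; case: eqP => // e; have := ltn_ord j; lia.
rewrite (bigD1 (Ordinal h)) //= subnKC // eqxx big1 ?addr0 // => j.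
rewrite -val_eqE /= => ne; case: eqP => // e; case/eqP: ne; lia.
Qed.

Section Straighten.
Variables (F : diffField) (c f1 : F).
Local Notation v := (dy f1).
Hypotheses (f1E : dx f1 = c * dy f1) (v0 : dy f1 != 0).

Definition dlt (a : F) : F := dx a - c * dy a.
Definition eta (a : F) : F := v^-1 * dy a.

Lemma dlt_der : is_derivation dlt.
Proof.
have xP := @is_der_df_x F; have yP := @is_der_df_y F.
split=> a b; rewrite /dlt ?(derD xP) ?(derD yP) ?(derM xP) ?(derM yP); ring.
Qed.

Lemma eta_der : is_derivation eta.
Proof.
have yP := @is_der_df_y F.
split=> a b; rewrite /eta ?(derD yP) ?(derM yP); ring.
Qed.

Lemma dlt_v : dlt v = dy c * v.
Proof.
have yP := @is_der_df_y F.
by rewrite /dlt dx_dy_comm f1E (derM yP) addrK.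
Qed.

(** The commutator of [dlt] and [dy] is [dy c] times [dy]; the eikonal equation gives
    [dlt v = dy c * v], so dividing by [v] cancels it. *)
Lemma dlt_eta a : dlt (eta a) = eta (dlt a).
Proof.
have xP := @is_der_df_x F; have yP := @is_der_df_y F.
have ev : v * eta a = dy a by rewrite /eta mulrA mulfV // mul1r.
have h : dlt (v * eta a) = dlt v * eta a + v * dlt (eta a) by rewrite dlt_der.2.
apply: (mulfI v0); rewrite {2}/eta mulrA mulfV // mul1r.
apply: (addrI (dlt v * eta a)); rewrite -h ev dlt_v -mulrA ev.
by rewrite /dlt (derB yP) (derM yP) dx_dy_comm; ring.
Qed.

Lemma dx_dlt a : dx a = 1 * dlt a + c * v * eta a.
Proof. by rewrite /dlt /eta mul1r -mulrA (mulrA v) mulfV // mul1r subrK. Qed.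

Lemma dy_eta a : dy a = 0 * dlt a + v * eta a.
Proof. by rewrite /eta mul0r add0r mulrA mulfV // mul1r. Qed.

Lemma st_hX : dx (0 : F) = dy 1.
Proof. by rewrite (der0 (@is_der_df_x F)) (der1 (@is_der_df_y F)). Qed.

Lemma st_hY : dx v = dy (c * v).
Proof. by rewrite dx_dy_comm f1E. Qed.

Definition st_field : diffField := cf dlt_der eta_der dlt_eta.

Definition st_trans : diffop F -> diffop st_field :=
  trans dlt_der eta_der dlt_eta st_hX st_hY.

Lemma st_monomial (a : F) i j i' j' :
  (const2 F a * (tr_x 1 (c * v) ^+ i * tr_y 0 v ^+ j))`_i'`_j' =
  if (i' <= i)%N && (i' + j' == i + j)%N then a * (c * v) ^+ (i - i') * v ^+ j *+ 'C(i, i') else 0.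
Proof.
have -> : const2 F a * (tr_x 1 (c * v) ^+ i * tr_y 0 v ^+ j) =
    (a%:P * (v%:P * 'X) ^+ j) *: ('X + ((c * v)%:P * 'X)%:P) ^+ i.
  by rewrite /tr_x /tr_y /const2 /= -mul_polyC !polyCM polyC_exp !polyCM !polyC1 !polyC0 mul1r mul0r add0r -mulrA [(_ ^+ j) * _]mulrC.
rewrite comp_shift_coef; case: leqP => [le|_] /=; last by rewrite coef0.
rewrite !exprMn -!polyC_exp mulrnAr coefMn.
have -> : a%:P * ((v ^+ j)%:P * 'X^j) * (((c * v) ^+ (i - i'))%:P * 'X^(i - i')) =
    (a * (c * v) ^+ (i - i') * v ^+ j)%:P * 'X^(j + (i - i')).
  by rewrite !polyCM exprD; ring.
rewrite coefCM coefXn; have -> : (j' == j + (i - i'))%N = (i' + j' == i + j)%N by lia.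
by case: eqP => _; rewrite ?mulr1 ?mulr0 ?mul0rn ?exprMn.
Qed.

Lemma ev1_coef (L : diffop F) i' j' :
  (ev1 (tr_x 1 (c * v)) (tr_y 0 v) L)`_i'`_j' =
  \sum_(i < size L) \sum_(j < size L`_i) if (i' <= i)%N && (i' + j' == i + j)%N
    then L`_i`_j * (c * v) ^+ (i - i') * v ^+ j *+ 'C(i, i') else 0.
Proof.
rewrite /ev1 !coef_sum; apply: eq_bigr => i _; rewrite !coef_sum; apply: eq_bigr => j _.
exact: st_monomial.
Qed.

End Straighten.

Theorem straighten (F : diffField) (L : diffop F) (n1 a : nat) : kolchin_universal F ->
    (0 < n1)%N -> (forall i j, L`_i`_j != 0 -> (i <= n1)%N /\ (i + j <= n1 + a)%N) ->
    L`_n1`_a != 0 ->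
  exists m (s : m.-tuple rat) (f : m.+1.-tuple F),
    [/\ G_exponents s, dy (tnth f ord0) != 0 &
      exists H, [/\ V_G s H, act L (H : ser_module s f) = 0 & exists t, H t != 0]].
Proof.
move=> hF n10 ordL La; pose N0 := (n1 + a)%N.
(* The top symbol at (X, 1); its degree is [n1 > 0], so it has a root. *)
pose P := \poly_(i < n1.+1) L`_i`_(N0 - i).
have [c /rootP Pc] : exists c, root P c.
  apply: universal_root => //; rewrite size_poly_eq; first by rewrite ltnS.
  by rewrite /N0 addKn.
have [kappa k0] := universal_nonconstant hF.
(* The initial value [kappa], not constant for [dy], is what makes [dy f1] non-zero. *)
have [f1 [f1E _ /(_ k0) v0]] := @universal_ode F kappa c 1 (fun _ => 0) 0 hF isT.
have {}f1E : dx f1 = c * dy f1.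
  by apply/eqP; rewrite -subr_eq0; apply/eqP; move: f1E; rewrite /= big_ord1 mul0r addr0.
have ordL' i j : L`_i`_j != 0 -> (i + j <= N0)%N by move/ordL => [].
have sL : size L = n1.+1.
  apply/eqP; rewrite eqn_leq; apply/andP; split.
    apply/leq_sizeP => i hi; apply/polyP => j; rewrite coef0; apply/eqP/negPn/negP => /ordL[]; lia.
  by rewrite ltnNge; apply/negP => le; rewrite (nth_default _ le) coef0 eqxx in La.
pose cF := st_field f1E v0; pose L' : diffop cF := st_trans f1E v0 L.
pose T i j : F := \sum_(k < size L) \sum_(k' < size L`_k)
  if (i <= k)%N && (i + j == k + k')%N
    then L`_k`_k' * (c * dy f1) ^+ (k - i) * dy f1 ^+ k' *+ 'C(k, i) else 0.
have coefL' i j : (N0 <= i + j)%N -> L'`_i`_j = T i j.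
  by move=> le; exact: etrans (trans_coef (dlt_der c) (eta_der f1) (dlt_eta f1E v0) (st_hX F) (st_hY f1E) ordL' le) (ev1_coef c v0 L i j).
have ordL2 : op_order_le N0 L' by exact: trans_order.
(* This coefficient is the top symbol at (c dy f1, dy f1), that is [P.[c]] times a power of
   [dy f1]. *)
have L'0 : L'`_0`_N0 = 0.
  rewrite (coefL' 0%N N0 (leqnn _)) /T.
  apply: (@etrans _ _ (dy f1 ^+ N0 * P.[c])); last by rewrite Pc mulr0.
  rewrite horner_poly mulr_sumr sL; apply: eq_bigr => i _ /=.
  rewrite (@antidiagonal_sum F _ _ _ (fun z j => z * (c * dy f1) ^+ (i - 0) * dy f1 ^+ j *+ 'C(i, 0))); last first.
    by move=> j; rewrite !mul0r mul0rn.
  have le : (i <= N0)%N by have := ltn_ord i; rewrite /N0; lia.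
  rewrite add0n le subn0 bin0 mulr1n.
  have -> : dy f1 ^+ N0 = dy f1 ^+ i * dy f1 ^+ (N0 - i) by rewrite -exprD subnKC.
  by rewrite exprMn; ring.
(* Only monomials with d_x^n1 reach this coefficient, as [n1] is the highest power of d_x. *)
have L'1 : L'`_n1`_a != 0.
  rewrite (coefL' _ _ (leqnn _)).
  suff -> : T n1 a = L`_n1`_a * dy f1 ^+ a by rewrite mulf_neq0 // expf_neq0.
  rewrite /T.
  rewrite sL big_ord_recr big1 ?add0r /=; last first.
    by move=> i _; rewrite big1 // => j _; rewrite leqNgt ltn_ord.
  rewrite leqnn /=.
  rewrite (@antidiagonal_sum F _ _ _ (fun z j => z * (c * dy f1) ^+ (n1 - n1) * dy f1 ^+ j *+ 'C(n1, n1))); last first.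
    by move=> j; rewrite !mul0r mul0rn.
  by rewrite leq_addr addKn subnn binn mulr1n expr0 mulr1 add0r.
have [|||||||m [s [f [Gs f0 [H [VH H0 Hn]]]]]] := @newton_puiseux cF f1 L' N0.
- by rewrite /= /dlt f1E subrr.
- by rewrite /= /eta mulVf.
- by move=> p; exact: (@universal_root F p).
- move=> n aa z n0; have [h [hE h0 _]] := @universal_ode F 1 c n aa z hF n0.
  by exists h; [apply: h0; exact: oner_neq0 | exact: hE].
- exact: ordL2.
- exact: L'0.
- by exists n1, a.
exists m, s, f; split=> //; first by rewrite f0.
by exists H; split=> //; rewrite (trans_ser (dlt_der c) (eta_der f1) (dlt_eta f1E v0) (dx_dlt c v0) (dy_eta c v0) (st_hX F) (st_hY f1E)).
Qed.

(** * Systems *)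

Section VectorAction.
Variables (F : diffField) (l : nat) (M : dmodule F).
Implicit Types (p q : 'rV[diffop F]_l) (H : 'I_l -> M).

Definition vact H p : M := \sum_(i < l) act (p 0 i) (H i).

Lemma vactB H p q : vact H (p - q) = vact H p - vact H q.
Proof. by rewrite -sumrB; apply: eq_bigr => i _; rewrite !mxE actBl. Qed.

Lemma act_sumr (r : diffop F) (G : 'I_l -> M) :
  act r (\sum_(i < l) G i) = \sum_(i < l) act r (G i).
Proof. exact: (big_morph (act r) (@actDr F M r) (@act0r F M r)). Qed.

Lemma vact_opmul H r p : vact H (map_mx (opmul r) p) = act r (vact H p).
Proof. by rewrite act_sumr; apply: eq_bigr => i _; rewrite mxE act_opmul. Qed.

End VectorAction.

Section Coordinates.
Variables (F : diffField) (l : nat) (U : 'rV[diffop F]_l -> Prop).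
Hypothesis (subU : left_submodule U).
Implicit Types p q u w : 'rV[diffop F]_l.

Definition coord_ideal (r : 'I_l) (p : diffop F) : Prop :=
  exists u, [/\ U u, u 0 r = p & forall j : 'I_l, (r < j)%N -> u 0 j = 0].

Lemma coord_ideal_left r : left_ideal (coord_ideal r).
Proof.
have [U0 UD UM] := subU; split.
- by exists 0; split; rewrite ?mxE // => j _; rewrite mxE.
- move=> p q [u [Uu <- hu]] [v [Uv <- hv]]; exists (u + v); split; rewrite ?mxE //; first exact: UD.
  by move=> j lt; rewrite mxE hu // hv // addr0.
move=> s p [u [Uu <- hu]]; exists (map_mx (opmul s) u); split; rewrite ?mxE //; first exact: UM.
by move=> j lt; rewrite mxE hu // opmul0r.
Qed.

Lemma submodule_subspace : scalar_subspace (@vscale F l) U.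
Proof.
have [U0 UD _] := subU.
exact: ScalarSubspace (@vscaleDl F l) (@vscaleDr F l) (@vscaleA F l) (@vscale1 F l) U0 UD
  (submodule_vscale subU).
Qed.

(** A vector is reduced from its last non-zero coordinate downwards: the element of [U] that
    corrects coordinate [r] vanishes after [r], so cleared coordinates stay cleared. *)
Lemma cofinite_coords : (forall r, cofinite (@op_scale F) (coord_ideal r)) ->
  cofinite (@vscale F l) U.
Proof.
move=> hI; have lin := submodule_subspace.
have claim k : exists E, forall w, (forall j : 'I_l, (k <= j)%N -> w 0 j = 0) -> spanmod (@vscale F l) U E w.
  elim: k => [|k [E hE]].
    exists [::] => w hw; have -> : w = 0 by apply/rowP => j; rewrite hw // mxE.
    exact: spanmod_P lin _ _ (ss_P0 lin).
  have [lt|ge] := ltnP k l; last first.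
    by exists E => w hw; apply: hE => j le; have := ltn_ord j; lia.
  pose r := Ordinal lt; have [E1 hE1] := hI r.
  pose dl (e : diffop F) : 'rV[diffop F]_l := \row_j if j == r then e else 0.
  exists (E ++ map dl E1) => w hw.
  have [c [u [Uu ur hu]]] := hE1 (w 0 r).
  pose D := \sum_(i < size E1) vscale (c i) (dl E1`_i).
  have Dj (j : 'I_l) : D 0 j = if j == r then \sum_(i < size E1) op_scale (c i) E1`_i else 0.
    rewrite /D summxE; case: (j =P r) => [->|ne].
      by apply: eq_bigr => i _; rewrite !mxE eqxx.
    apply: big1 => i _; rewrite !mxE; case: eqP => // _.
    exact: (@dm_sc0r F (op_module F)).
  have -> : w = (w - u - D) + (u + D) by rewrite -[w - u - D]addrA -opprD subrK.
  apply: (spanmodD lin).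
    apply: (spanmod_cat lin); apply: hE => j le; rewrite !mxE Dj.
    case: (j =P r) => [->|ne]; first by rewrite ur; ring.
    have lt' : (k < j)%N.
      rewrite ltn_neqAle le andbT; apply/eqP => e; apply: ne; exact: val_inj.
    by rewrite hw // hu // !subr0.
  apply: (spanmodD lin); first exact: (spanmod_P lin).
  apply: (spanmod_sum lin) => i _; apply: (spanmod_sc lin); apply: (spanmod_mem lin).
  by rewrite mem_cat map_f ?orbT // mem_nth.
have [E hE] := claim l; exists E => w; apply: hE => j le; have := ltn_ord j; lia.
Qed.

End Coordinates.

(** An Ore condition: the remainder of pseudo-division by an operator of d_x-order 0 is zero. *)
Lemma eliminate (F : diffField) (b : {poly F}) (Q : diffop F) : b != 0 ->
  exists2 c : {poly F}, c != 0 & exists S, opmul (c%:P : diffop F) Q = opmul S (b%:P : diffop F).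
Proof.
move=> b0; have [|c c0 [S hS]] := @pseudo_division F Q (b%:P) 0; first by rewrite size_polyC b0.
by exists c => //; exists S; apply/eqP; rewrite -subr_eq0 -size_poly_leq0.
Qed.

Theorem solve_good (F : diffField) (l : nat) (U : 'rV[diffop F]_l -> Prop) :
    kolchin_universal F -> left_submodule U -> ~ cofinite (@vscale F l) U ->
    (forall r, (forall p, coord_ideal U r p -> p = 0) \/
       exists n P, [/\ coord_ideal U r P, op_order_le n P & P`_n`_0 != 0]) ->
  exists m (s : m.-tuple rat) (f : m.+1.-tuple F),
    [/\ G_exponents s, dy (tnth f ord0) != 0 &
      exists H : 'I_l -> ser_module s f, [/\ forall i, V_G s (H i), exists i t, H i t != 0 &
        forall p, U p -> vact H p = 0]].
Proof.
move=> hF subU Unot good; have [U0 UD UM] := subU.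
have idI r := coord_ideal_left subU r.
pose cof r := cofinite (@op_scale F) (coord_ideal U r).
have [r rnot rmax] : exists2 r, ~ cof r & forall i : 'I_l, (r < i)%N -> cof i.
  have [r0 r0not] : exists r, ~ cof r.
    by apply/existsNP => h; apply: Unot; exact: (cofinite_coords subU).
  pose A (r : 'I_l) := `[< ~ cof r >]; have A0 : A r0 by apply/asboolP.
  have [r /asboolP rnot rmax] := arg_maxnP (fun i : 'I_l => i : nat) A0.
  exists r => // i lt; apply: contrapT => inot.
  by have := rmax i (asboolT inot); rewrite /= leqNgt lt.
have /choice[b bP] : forall i : 'I_l, exists b : {poly F}, (r < i)%N ->
    b != 0 /\ coord_ideal U i b%:P.
  move=> i; have [lt|ge] := ltnP r i; last by exists 0.
  by have [b b0 Ib] := cofinite_const (idI i) (rmax i lt); exists b.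
have /choice[u uP] : forall i : 'I_l, exists u : 'rV[diffop F]_l, (r < i)%N ->
    [/\ U u, u 0 i = (b i)%:P & forall j : 'I_l, (i < j)%N -> u 0 j = 0].
  move=> i; have [lt|ge] := ltnP r i; last by exists 0.
  by have [_ [u hu]] := bP i lt; exists u.
(* A non-zero operator in d_y alone, next to the good operator [P], would give this ideal finite
   codimension. *)
have noconst (c : {poly F}) : coord_ideal U r c%:P -> c = 0.
  move=> Ic; apply/eqP/negPn/negP => c0; case: (good r) => [z|[n [P [IP hP Pn]]]].
    by have /eqP := z _ Ic; rewrite polyC_eq0 (negbTE c0).
  by apply: rnot; exact: cofinite_good (idI r) _ _ _ IP hP Pn c0 Ic.
have [L [n1 [a [n10 ordL La gen]]]] : exists L n1 a, [/\ (0 < n1)%N,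
    forall i j, (L : diffop F)`_i`_j != 0 -> (i <= n1)%N /\ (i + j <= n1 + a)%N, L`_n1`_a != 0 &
    forall Q, coord_ideal U r Q -> exists2 b : {poly F}, b != 0 & exists S,
      opmul (b%:P : diffop F) Q = opmul S L].
  case: (good r) => [z|[n [P [IP hP Pn]]]]; last exact: ideal_generator (idI r) _ _ IP hP Pn noconst.
  (* When the ideal is zero, nothing constrains coordinate [r], and d_x is a convenient operator to
     which [straighten] applies. *)
  exists 'X, 1%N, 0%N; split=> //.
  - move=> i j; rewrite coefX; case: (i =P 1%N) => [->|_]; last by rewrite coef0 eqxx.
    by rewrite coef1; case: j => [|j]; rewrite ?eqxx.
  - by rewrite coefX eqxx coef1 oner_neq0.
  by move=> Q /z ->; exists 1; [exact: oner_neq0 | exists 0; rewrite opmul0r opmul0l].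
have [m [s [f [Gs f0 [Hr [VHr LHr [t Hrt]]]]]]] := straighten hF n10 ordL La.
have s1 := G_exponents_lt1 Gs.
exists m, s, f; split=> //; pose M := ser_module s f.
have Yinj (c : {poly F}) (K : M) : c != 0 -> V_G s K -> act (c%:P : diffop F) K = 0 -> K = 0.
  by move=> c0 VK; exact: polyY_inj.
(* Coordinates before [r] are zero. A later coordinate [i] is found by inverting [b i] on the
   contribution of the preceding ones to the equation [u i], which involves none after [i]. *)
have [H [VH HrE Hlt Hgt]] : exists H : 'I_l -> M, [/\ forall i, V_G s (H i), H r = Hr,
    forall i : 'I_l, (i < r)%N -> H i = 0 & forall i : 'I_l, (r < i)%N -> vact H (u i) = 0].
  suff /(_ l)[H [VH e h1 h2]] : forall k, exists H : 'I_l -> M, [/\ forall i, V_G s (H i), H r = Hr,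
    forall i : 'I_l, (i < r)%N -> H i = 0 & forall i : 'I_l, (r < i < k)%N -> vact H (u i) = 0].
    by exists H; split=> // i lt; apply: h2; rewrite lt ltn_ord.
  elim=> [|k [H [VH HrE Hlt Hgt]]].
    exists (fun i => if i == r then Hr else 0); split=> //.
    - by move=> i; case: eqP => // _; exact: V_G0.
    - by rewrite eqxx.
    - by move=> i lt; case: eqP => // e; rewrite e ltnn in lt.
    by move=> i; rewrite ltn0 andbF.
  have [lk|] := boolP ((r < k) && (k < l))%N; last first.
    move=> h; exists H; split=> // i lt; apply: Hgt; have := ltn_ord i; lia.
  have /andP[rk kl] := lk; pose i0 := Ordinal kl.
  have [b0 _] := bP i0 rk; have [_ ub u0] := uP i0 rk.
  pose H0 i : M := if i == i0 then 0 else H i.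
  have VN (K : M) : V_G s K -> V_G s (- K : M).
    move=> VK; have -> : - K = act (op_scale (-1) 1) K by rewrite act_scale act1 dm_scNl dm_sc1.
    exact: V_G_act.
  have [K VK KE] : exists2 K : M, V_G s K & act ((b i0)%:P : diffop F) K = - vact H0 (u i0).
    apply: polyY_surj => //; apply: VN; apply: (big_ind (fun K : M => V_G s K)); [exact: V_G0 | exact: V_GD |].
    by move=> i _; apply: V_G_act => //; rewrite /H0; case: eqP => // _; exact: V_G0.
  pose H1 i : M := if i == i0 then K else H i.
  exists H1; split.
  - by move=> i; rewrite /H1; case: eqP.
  - by rewrite /H1; case: eqP => // e; rewrite e /= ltnn in rk.
  - by move=> i lt; rewrite /H1; case: eqP => [e|_]; [rewrite e /= in lt; lia | exact: Hlt].
  move=> i /andP[ri]; rewrite ltnS leq_eqVlt => /orP[/eqP ik|ik].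
    have -> : i = i0 by exact: val_inj.
    have H00 : H0 i0 = 0 by rewrite /H0 eqxx.
    have H1K : H1 i0 = K by rewrite /H1 eqxx.
    have -> : vact H1 (u i0) = act (u i0 0 i0) (H1 i0) + vact H0 (u i0).
      rewrite [LHS](bigD1 i0) //=; congr (_ + _); rewrite [RHS](bigD1 i0) //= H00 act0r add0r.
      by apply: eq_bigr => j /negbTE ne; rewrite /H1 /H0 ne.
    by rewrite H1K ub KE addNr.
  have [_ _ ui0] := uP i ri.
  rewrite -(Hgt i _) ?ri //; apply: eq_bigr => j _; rewrite /H1; case: eqP => // ->.
  by rewrite ui0 // !act0l.
exists H; split=> //; first by exists r, t; rewrite HrE.
(* Induction on the last coordinate that may be non-zero. Multiplying [p] by some c(d_y) makes that
   coordinate a multiple of [L], or lets a multiple of [u i0] cancel it; [Yinj] then removes the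
   factor. *)
suff claim : forall k p, U p -> (forall j : 'I_l, (k <= j)%N -> p 0 j = 0) -> vact H p = 0.
  by move=> p Up; apply: (claim l) => // j le; have := ltn_ord j; lia.
have Vvact p : V_G s (vact H p).
  apply: (big_ind (fun K : M => V_G s K)); [exact: V_G0 | exact: V_GD |].
  by move=> i _; exact: V_G_act.
elim=> [|k IH] p Up hp; first by apply: big1 => j _; rewrite hp // act0l.
have [kl|ge] := ltnP k l; last by apply: IH => // j le; have := ltn_ord j; lia.
pose i0 := Ordinal kl.
have hp' (j : 'I_l) : (k < j)%N -> p 0 j = 0 by exact: hp.
have Ip : coord_ideal U i0 (p 0 i0) by exists p.
have [lt|rk] := ltnP k r.
  apply: big1 => j _; have [lt'|ge'] := ltnP j r; first by rewrite Hlt // act0r.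
  by rewrite hp' ?act0l //; lia.
have [e|ne] := eqVneq k r.
  have er : i0 = r by exact: val_inj.
  have [c c0 [S cS]] := gen _ (eq_ind _ (fun x => coord_ideal U x (p 0 x)) Ip _ er).
  apply: (Yinj c) => //.
  have -> : vact H p = act (p 0 r) (Hr : M).
    rewrite /vact (bigD1 r) //= HrE big1 ?addr0 // => j; rewrite -val_eqE /= => ne.
    have [lt'|ge'] := ltnP j r; first by rewrite Hlt // act0r.
    by rewrite hp' ?act0l //; lia.
  by rewrite -act_opmul cS act_opmul LHr act0r.
have ri : (r < i0)%N by rewrite /=; lia.
have [b0 _] := bP i0 ri; have [Uu ub u0] := uP i0 ri.
have [c c0 [S cS]] := eliminate (p 0 i0) b0.
apply: (Yinj c) => //.
have := IH (map_mx (opmul (c%:P : diffop F)) p - map_mx (opmul S) (u i0)).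
rewrite vactB !vact_opmul Hgt // act0r subr0; apply.
  have lin := submodule_subspace subU.
  by apply: UD; [exact: UM | apply: (PN lin); exact: UM].
move=> j le; rewrite !mxE; have [e|ne'] := eqVneq j i0; first by rewrite e ub cS subrr.
have lt' : (k < j)%N.
  rewrite ltn_neqAle le andbT; apply/eqP => e; case/eqP: ne'; exact: val_inj.
by rewrite hp' // u0 // !opmul0r subr0.
Qed.

Lemma avoid_roots (F : diffField) (q : {poly F}) : q != 0 -> exists c : nat, q.[- c%:R] != 0.
Proof.
move=> q0; apply: contrapT => /forallNP h.
pose rs := [seq - (z%:R : F) | z <- iota 0 (size q)].
have := @max_poly_roots _ q rs q0; rewrite size_map size_iota ltnn => hh.
suff : false by []; apply: hh.
  by apply/allP => _ /mapP[z _ ->]; apply/rootP/eqP/negPn/negP/h.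
rewrite map_inj_uniq ?iota_uniq // => x y /oppr_inj.
wlog le : x y / (x <= y)%N => [wl e|e].
  by have [le|le] := leqP x y; [exact: wl | apply/esym/wl => //; exact: ltnW].
have : (y - x)%:R == 0 :> F by rewrite natrB // e subrr.
have /pcharf0P -> := @df_pchar0 F; rewrite subn_eq0 => le'; by apply/eqP; rewrite eqn_leq le.
Qed.

(** * Shears and their effect on top-order terms *)

Section Shear.
Variables (F : diffField) (c : nat).
Local Notation F1 := (shear_df F c).
Local Notation xP := (@dx_derivation F).
Local Notation eP := (is_der_shear c (@is_der_df_x F) (@is_der_df_y F)).
Local Notation cR := (c%:R : F).

Lemma der_intr (d : F -> F) : is_der d -> d cR = 0.
Proof. by move=> dP; exact: der_nat. Qed.

Lemma shear_dx (a : F) : dx a = 1 * dx a + 0 * (dy a + dx a *~ c).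
Proof. by rewrite mul1r mul0r addr0. Qed.
Lemma shear_dy (a : F) : dy a = (- cR) * dx a + 1 * (dy a + dx a *~ c).
Proof. by rewrite mul1r mulNr mulr_natl -pmulrn addrC addrK. Qed.
Lemma shear_hX : dx (- cR) = dy (1 : F).
Proof. by rewrite (derN (@is_der_df_x F)) der_intr // oppr0 (der1 (@is_der_df_y F)). Qed.
Lemma shear_hY : dx (1 : F) = dy (0 : F).
Proof. by rewrite (der1 (@is_der_df_x F)) (der0 (@is_der_df_y F)). Qed.

Definition shear_op : diffop F -> diffop F1 :=
  @trans F (@dx F) (fun a => dy a + dx a *~ c) xP eP (shear_comm c) 1 0 (- cR) 1 shear_hX shear_hY.
Local Notation T := shear_op.

Lemma shear_opD p q : T (p + q) = T p + T q. Proof. exact: transD. Qed.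
Lemma shear_op0 : T 0 = 0. Proof. exact: trans0. Qed.
Lemma shear_opB p q : T (p - q) = T p - T q. Proof. exact: transB. Qed.
Lemma shear_op_scale a p : T (op_scale a p) = op_scale (a : F1) (T p).
Proof. exact: trans_scale. Qed.
Lemma shear_opM r p : T (opmul r p) = opmul (T r) (T p).
Proof. exact: trans_opmul shear_dx shear_dy _ _ _ _. Qed.

Lemma shear_op_dx p : T (op_dx p) = op_dx (T p).
Proof.
apply: etrans (trans_op_dx _ _ _ shear_dx _ _ p) _.
by rewrite -/(T p) [op_scale (0 : F1) _](@dm_sc0l F1 (op_module F1)) addr0 op_scale1.
Qed.

Lemma shear_op_dy p : T (op_dy p) = op_dy (T p) - op_scale (cR : F1) (op_dx (T p)).
Proof.
apply: etrans (trans_op_dy _ _ _ shear_dy _ _ p) _.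
by rewrite -/(T p) [op_scale (- cR : F1) _](@dm_scNl F1 (op_module F1)) op_scale1 addrC.
Qed.

Lemma shear_op_surj (r : diffop F1) : exists p, T p = r.
Proof.
rewrite -[r]opmul_1r opmulE.
apply: (@act_closed F1 (op_module F1) (fun q => exists p, T p = q)).
- by exists 0; exact: shear_op0.
- by move=> _ _ [p <-] [q <-]; exists (p + q); exact: shear_opD.
- by move=> a _ [p <-]; exists (op_scale (a : F) p); exact: shear_op_scale.
- by move=> _ [p <-]; exists (op_dx p); rewrite op_module_dx shear_op_dx.
- move=> _ [p <-]; exists (op_dy p + op_scale cR (op_dx p)); rewrite op_module_dy.
  by rewrite shear_opD shear_op_dy shear_op_scale shear_op_dx subrK.
by exists 1; rewrite /T /trans act1.
Qed.

Definition unshear_module (M : dmodule F) : dmodule F1.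
Proof.
refine (@Dmodule F1 M (@dm_sc F M) (@dm_x F M) (fun v => dm_y v + dm_sc cR (dm_x v)) _ _ _ _ _ _ _ _ _).
- exact: (@dm_scDl F M).
- exact: (@dm_scDr F M).
- exact: (@dm_scA F M).
- exact: (@dm_sc1 F M).
- exact: (@dm_xD F M).
- by move=> v w; rewrite dm_xD dm_yD dm_scDr addrACA.
- exact: (@dm_xsc F M).
- move=> a w; rewrite dm_xsc dm_ysc /= !dm_scDr !dm_scDl -!dm_scA.
  rewrite (mulrC cR a) -[dx a *~ c]/(dx a *+ c) -(mulr_natl (dx a)) [X in X = _]addrACA.
  by [].
move=> w; rewrite /= dm_xD dm_xsc der_intr // dm_sc0l add0r dm_xy.
by [].
Defined.

Lemma unshear_act (M : dmodule F) p (w : M) : act p w = act (T p) (w : unshear_module M).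
Proof.
apply: (@trans_act F (@dx F) (fun a => dy a + dx a *~ c) xP eP (shear_comm c) 1 0 (- cR) 1
  shear_dx shear_dy shear_hX shear_hY M (unshear_module M) id) => // v.
  by rewrite /= dm_sc1 dm_sc0l addr0.
by rewrite /= dm_sc1 dm_scNl addrC addrK.
Qed.

(** On the module of operators, [p] acts through [T p] by [unshear_act], and [p] applied to 1 is
    [p]. *)
Lemma shear_op_inj p : T p = 0 -> p = 0.
Proof. by move=> Tp; rewrite -[p]opmul_1r opmulE unshear_act Tp act0l. Qed.

(** The old d_y is the new one minus c d_x; setting the new d_y to 0 in the top symbol evaluates it
    at (1, -c). *)
Lemma shear_top (P : diffop F) n : op_order_le n P -> op_order_le n (T P) /\
  (T P : {poly {poly F}})`_n`_0 = \sum_(j < n.+1) P`_(n - j)`_j * (- cR) ^+ j.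
Proof.
move=> hP; split.
  exact: trans_order.
apply: etrans (trans_coef _ _ _ _ _ hP _) _; first by rewrite addn0.
rewrite -horner_coef0.
pose phi : {rmorphism {poly {poly F}} -> {poly F}} := map_poly (horner_eval (0 : F)).
have phiC a : phi (const2 F a) = a%:P by rewrite /phi /= map_polyC /= /horner_eval hornerC.
have phiX : phi 'X = 'X by rewrite /phi /= map_polyX.
have phiY : phi 'X%:P = 0 by rewrite /phi /= map_polyC /= /horner_eval hornerX.
have phix : phi (tr_x (1 : F) 0) = 'X.
  by rewrite rmorphD !rmorphM /= !phiC phiX phiY mulr0 addr0 mul1r.
have phiy : phi (tr_y (- cR) 1) = (- cR)%:P * 'X.
  by rewrite rmorphD !rmorphM /= !phiC phiX phiY mulr0 addr0.
have <- : (phi (ev1 (tr_x 1 0) (tr_y (- cR) 1) P))`_n = ((ev1 (tr_x 1 0) (tr_y (- cR) 1) P)`_n).[0].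
  by rewrite coef_map.
rewrite /ev1 rmorph_sum coef_sum.
have sP : (size P <= n.+1)%N.
  apply/leq_sizeP => i hi; apply/polyP => j; rewrite coef0; apply/eqP/negPn/negP => /hP; lia.
pose G (i : nat) := P`_i`_(n - i) * (- cR) ^+ (n - i).
transitivity (\sum_(i < n.+1) G i); last first.
  rewrite (reindex_inj rev_ord_inj) /=; apply: eq_bigr => j _; rewrite /G subSS.
  by rewrite subKn // -ltnS.
rewrite -(big_mkord xpredT G) (big_cat_nat (leq0n (size P)) sP) /= big_mkord.
rewrite [X in _ = _ + X]big_nat_cond [X in _ = _ + X]big1 ?addr0 => [|i]; last first.
  by case/andP=> /andP[le _] _; rewrite /G (nth_default _ le) coef0 mul0r.
apply: eq_bigr => i _; rewrite rmorph_sum coef_sum.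
have le : (i <= n)%N by rewrite -ltnS; exact: leq_trans (ltn_ord i) sP.
have := @antidiagonal_sum F P`_i n i (fun z j => z * (- cR) ^+ j) (fun j => mul0r _).
rewrite le /G => <-; apply: eq_bigr => j _.
rewrite !rmorphM !rmorphXn phiC phix phiy exprMn -polyC_exp.
rewrite [(P`_i`_j)%:P * _](_ : _ = (P`_i`_j * (- cR) ^+ j)%:P * 'X^(i + j)); last first.
  by rewrite polyCM exprD; ring.
by rewrite coefCM coefXn; case: eqP => _; rewrite ?mulr1 ?mulr0.
Qed.

End Shear.

(** [q] is the top form of [P] at (1, X), non-zero because the total order is attained by some
    monomial. *)
Lemma shear_good (F : diffField) (P : diffop F) : P != 0 ->
  exists2 q : {poly F}, q != 0 & forall c : nat, q.[- c%:R] != 0 ->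
    exists n, op_order_le n (shear_op c P) /\ (shear_op c P)`_n`_0 != 0.
Proof.
move=> P0; have [i [j tp]] := topp_grlex P0 (leqnn _).
pose n := (i + j)%N; have hP : op_order_le n P by move=> i' j'; exact: topp_grlex_order tp.
exists (\poly_(k < n.+1) P`_(n - k)`_k).
  apply/eqP => /polyP/(_ j); rewrite coef_poly coef0 ltnS leq_addl addnK.
  by apply/eqP; case: tp.
move=> c qc; exists n; have [h1 h2] := shear_top c hP; split=> //.
apply: contraNneq qc => h; rewrite horner_poly; apply/eqP.
exact: etrans (esym h2) h.
Qed.

Section ShearModule.
Variables (F : diffField) (c l : nat) (U : 'rV[diffop F]_l -> Prop).
Hypothesis subU : left_submodule U.

Definition shear_submodule (w : 'rV[diffop (shear_df F c)]_l) : Prop :=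
  exists2 u, U u & w = map_mx (@shear_op F c) u.

Lemma shear_left_submodule : left_submodule shear_submodule.
Proof.
have [U0 UD UM] := subU; split.
- by exists 0 => //; apply/rowP => i; rewrite !mxE shear_op0.
- move=> _ _ [u Uu ->] [v Uv ->]; exists (u + v); first exact: UD.
  by apply/rowP => i; rewrite !mxE shear_opD.
move=> r _ [u Uu ->]; have [p <-] := shear_op_surj r; exists (map_mx (opmul p) u); first exact: UM.
by apply/rowP => i; rewrite !mxE shear_opM.
Qed.

Lemma shear_not_cofinite : ~ cofinite (@vscale F l) U ->
  ~ cofinite (@vscale (shear_df F c) l) shear_submodule.
Proof.
move=> Unot [E1 hE1]; apply: Unot.
have /choice[g gP] : forall w : 'rV[diffop (shear_df F c)]_l, exists u, map_mx (@shear_op F c) u = w.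
  move=> w; have /choice[h hP] := @shear_op_surj F c.
  by exists (map_mx h w); apply/rowP => i; rewrite !mxE hP.
exists (map g E1) => w; have [a [u Uu e]] := hE1 (map_mx (@shear_op F c) w).
exists a; suff -> : w - \sum_(k < size (map g E1)) vscale (a k) (map g E1)`_k = u by [].
have inj (v v' : 'rV[diffop F]_l) : map_mx (@shear_op F c) v = map_mx (@shear_op F c) v' -> v = v'.
  move=> /rowP h; apply/rowP => i; apply/eqP; rewrite -subr_eq0; apply/eqP.
  by apply: (@shear_op_inj F c); have := h i; rewrite !mxE shear_opB => ->; rewrite subrr.
apply: inj; rewrite -e; apply/rowP => i; rewrite !mxE !summxE shear_opB; congr (_ - _).
rewrite size_map (big_morph _ (@shear_opD F c) (@shear_op0 F c)).
apply: eq_bigr => k _; rewrite !mxE shear_op_scale (nth_map 0) //.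
by rewrite -[in RHS](gP E1`_k) mxE.
Qed.

Lemma shear_coord_ideal r q : coord_ideal shear_submodule r q ->
  exists2 p, coord_ideal U r p & q = shear_op c p.
Proof.
move=> [_ [[u Uu ->] <- h]]; exists (u 0 r); last by rewrite mxE.
exists u; split=> // j lt; apply: (@shear_op_inj F c); by rewrite -(h j lt) mxE.
Qed.

End ShearModule.

Lemma coord_ideal_shear (F : diffField) c l (U : 'rV[diffop F]_l -> Prop) r p :
  coord_ideal U r p -> coord_ideal (@shear_submodule F c l U) r (shear_op c p).
Proof.
move=> [u [Uu <- h]]; exists (map_mx (@shear_op F c) u); split; first by exists u.
  by rewrite mxE.
by move=> j lt; rewrite mxE h // shear_op0.
Qed.

Theorem theorem4p9 (F : diffField) (hF : kolchin_universal F)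
    (l : nat) (hl : (1 <= l)%N)
    (U : 'rV[diffop F]_l -> Prop) (hU : left_submodule U)
    (tau : nat) (htau : differential_type U tau) (htau1 : (1 <= tau)%N) :
  exists (m : nat) (s : m.-tuple rat) (f : m.+1.-tuple F),
    [/\ G_exponents s,
        (dx (tnth f ord0), dy (tnth f ord0)) <> (0, 0)
      & exists H : 'I_l -> rat -> F,
          [/\ forall i, V_G s (H i),
              exists i t, H i t != 0
            & forall p, U p -> forall t,
                \sum_(i < l) op_apply s f (p 0 i) (H i) t = 0]].
Proof.
have Unot := type_not_cofinite hU htau htau1.
(* [P r] is non-zero whenever its ideal is, so the shear has to be good for finitely many operators
   only; an integer off the roots of the product of the [q r] achieves this. *)
have /choice[P hP] : forall r, exists P, coord_ideal U r P /\
    (P = 0 -> forall p, coord_ideal U r p -> p = 0).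
  move=> r; have [[P [IP P0]]|none] := pselect (exists P, coord_ideal U r P /\ P != 0).
    by exists P; split=> // P0'; rewrite P0' eqxx in P0.
  have [I0 _ _] := coord_ideal_left hU r; exists 0; split=> // _ p Ip.
  by apply/eqP/negPn/negP => p0; apply: none; exists p.
have /choice[q hq] : forall r, exists q : {poly F}, q != 0 /\ (P r != 0 -> forall c : nat, q.[- c%:R] != 0 ->
    exists n, op_order_le n (shear_op c (P r)) /\ (shear_op c (P r))`_n`_0 != 0).
  move=> r; have [->|P0] := eqVneq (P r) 0; first by exists 1; rewrite oner_neq0.
  by have [q q0 h] := shear_good P0; exists q.
have [c qc] : exists c : nat, (\prod_r q r).[- c%:R] != 0.
  by apply: avoid_roots; apply/prodf_neq0 => r _; have [] := hq r.
have hF1 : kolchin_universal (shear_df F c) by exact: universal_shear.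
have [|m [s [f [Gs f0 [H [VH Hn HU]]]]]] := solve_good hF1 (shear_left_submodule c hU)
    (@shear_not_cofinite F c l U Unot).
  move=> r; have [IP Pz] := hP r; have [P0|P0] := eqVneq (P r) 0.
    left=> p /shear_coord_ideal[p' /(Pz P0) -> ->]; exact: shear_op0.
  right; have qr : (q r).[- c%:R] != 0.
    by move: qc; rewrite horner_prod => /prodf_neq0; apply.
  have [n [h1 h2]] := (hq r).2 P0 c qr; exists n, (shear_op c (P r)); split=> //.
  exact: coord_ideal_shear.
exists m, s, f; split=> //.
  by case=> x0 y0; move/eqP: f0; apply; rewrite /= x0 y0 mul0rz addr0.
exists H; split=> // p Up t.
have := congr1 (fun K : rat -> F => K t) (HU (map_mx (@shear_op F c) p) (ex_intro2 _ _ p Up erefl)).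
rewrite /vact fct_sumE => e; apply: etrans e; apply: eq_bigr => i _; rewrite mxE op_applyE.
(* The series are the same functions over both fields, and an operator acts on them as its sheared
   form does. *)
have h := trans_ser (@dx_derivation F)
  (is_der_shear c (@is_der_df_x F) (@is_der_df_y F)) (shear_comm c) (shear_dx c) (shear_dy c)
  (shear_hX F c) (shear_hY F) s f (p 0 i) (H i).
by have := congr1 (fun K : rat -> F => K t) h.
Qed.
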